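(* Let $d\ge1$ and let $\chi\in L^2(\mathbb{R}\times\mathbb{T}^d_x)$ satisfy $\operatorname{supp}\chi\subset(-\pi,\pi)\times\mathbb{T}^d_x$. If $$|\chi|^2\in Y^{\infty,-\infty}_{0,+}\setminus\{0\},$$ then the free Schrödinger propagator $\mathcal{U}_0(t)=e^{it\Delta}$ is $\chi$-observable: there is $C=C_{d,\chi}>0$ such that for all $u_0\in L^2(\mathbb{T}^d_x)$, $$\|u_0\|_{L^2(\mathbb{T}^d_x)}\le C\,\|\chi\,e^{it\Delta}u_0\|_{L^2(\mathbb{R}\times\mathbb{T}^d_x)}.$$
   Context: $\mathbb{T}=\mathbb{R}/2\pi\mathbb{Z}$; $\mathbb{T}_t=\mathbb{T}$ and $\mathbb{T}^d_x=\mathbb{T}^d$ are the temporal and spatial tori. $X^\infty=\mathscr{S}=\{u:t\mapsto e^{it\Delta}u_0:u_0\in L^2(\mathbb{T}^d_x)\}$ is the space of free Schrödinger waves, regarded (by time periodicity) as a closed subspace of $L^2(\mathbb{T}_t\times\mathbb{T}^d_x)$, and $X^{-\infty}$ is its dual. $Y^{\infty,-\infty}=\mathfrak{L}(X^\infty,X^{-\infty})$ (bounded linear operators). A bounded function $\phi$ on $\mathbb{T}_t\times\mathbb{T}^d_x$ defines an element of $Y^{\infty,-\infty}$ by multiplication, i.e. through the sesquilinear form $(u,v)\mapsto\iint\phi\,u\,\overline{v}\,\mathrm{d}t\,\mathrm{d}x$ on $\mathscr{S}\times\mathscr{S}$. $Y^{\infty,-\infty}_{0,+}$ is the closure in $Y^{\infty,-\infty}$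 of the set of nonnegative continuous functions on $\mathbb{T}_t\times\mathbb{T}^d_x$. An integrable function $f$ belongs to it if the form $(u,v)\mapsto\iint f\,u\,\overline v$, defined on trigonometric polynomials in $\mathscr{S}$, extends to a bounded operator belonging to this closure. $\chi$ is identified with its $2\pi$-periodic extension in time when the condition on $|\chi|^2$ is considered. *)

(* Defs.v *)
From HB Require Import structures.
From mathcomp Require Import all_boot all_order all_algebra.
From mathcomp Require Import all_classical all_reals all_analysis.
From mathcomp Require Import complex.
Set Implicit Arguments.
Unset Strict Implicit.
Unset Printing Implicit Defensive.
Import Order.TTheory GRing.Theory Num.Theory.
Import numFieldNormedType.Exports.
Import ComplexField.Normc.
Local Open Scope classical_set_scope.
Local Open Scope ring_scope.
Local Open Scope complex_scope.

(** Functions on the torus [(R/2piZ)^d] are represented by functions on [R^d]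
    that are 2pi-periodic in each coordinate, and integrated over the
    fundamental domain [[-pi, pi[^d].  Points of [R^d] are [d]-tuples, and
    space-time points are pairs [(t, x)].  Elements of [L^2] are represented by
    functions rather than by classes modulo a.e. equality. *)

(** The library equips [n.-tuple T] with the product sigma-algebra but with no
    topology; the product topology is transported from row vectors. *)
HB.instance Definition _ (n : nat) (T : topologicalType) :=
  Topological.copy (n.-tuple T)
    (initial_topology (fun x : n.-tuple T => \row_(i < n) tnth x i)).

Section LebesgueR.
Context {R : realType}.

(** The library's [lebesgue_measure] lives on the alias [measurableTypeR R];
    this is the same measure on [R] with its default measurable structure,
    which [n.-tuple R] and [R * n.-tuple R] inherit. *)
Definition lebesgueR : set R -> \bar R := @lebesgue_measure R.

Let lebesgue : {sigma_finite_measure set (measurableTypeR R) -> \bar R} :=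
  @lebesgue_measure R.

HB.instance Definition _ := isMeasure.Build _ R R lebesgueR
  (measure0 lebesgue) (@measure_ge0 _ _ _ lebesgue)
  (@measure_semi_sigma_additive _ _ _ lebesgue).

HB.instance Definition _ :=
  Measure_isSigmaFinite.Build _ R R lebesgueR (sigma_finiteT lebesgue).

End LebesgueR.

Section LebesgueTuple.
Context {R : realType}.

Definition tcons n (z : R * n.-tuple R) : n.+1.-tuple R :=
  [tuple of z.1 :: z.2].

Lemma measurable_tcons n : measurable_fun [set: R * n.-tuple R] (@tcons n).
Proof. exact: measurable_cons. Qed.

Section Step.
Variables (n : nat) (mu : {sigma_finite_measure set (n.-tuple R) -> \bar R}).

Definition lebesgue_step : set (n.+1.-tuple R) -> \bar R :=
  pushforward (lebesgueR \x mu)%E (@tcons n).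

HB.instance Definition _ := Measure.copy lebesgue_step
  (measure_function_pushforward__canonical__measure_function_Measure
     (lebesgueR \x mu)%E (@measurable_tcons n)).

Let lebesgue_step_sigma_finite : sigma_finite setT lebesgue_step.
Proof.
have /sigma_finiteP[F [TF ndF Foo]] := sigma_finiteT (@lebesgueR R).
have /sigma_finiteP[G [TG ndG Goo]] := sigma_finiteT mu.
pose un (x : n.+1.-tuple R) : R * n.-tuple R := (thead x, [tuple of behead x]).
have consK : cancel (@tcons n) un.
  by move=> [a x]; rewrite /un /tcons theadE; congr (_, _); exact/val_inj.
have mun : measurable_fun setT un.
  apply: measurable_fun_pair; last exact: measurable_behead.
  exact: (measurable_tnth ord0).
exists (fun i => un @^-1` (F i `*` G i)).
  rewrite -preimage_bigcup; apply/esym/seteqP; split=> // x _.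
  have [i _ Fi] : (\bigcup_i F i) (un x).1 by rewrite -TF.
  have [j _ Gj] : (\bigcup_j G j) (un x).2 by rewrite -TG.
  exists (maxn i j) => //; split.
  - by move: Fi; exact/subsetPset/ndF/leq_maxl.
  - by move: Gj; exact/subsetPset/ndG/leq_maxr.
move=> i; have [mF Fioo] := Foo i; have [mG Gioo] := Goo i; split.
  by rewrite -[X in measurable X]setTI; apply: mun => //; exact: measurableX.
rewrite /lebesgue_step /pushforward -comp_preimage (_ : un \o _ = id)//.
  by rewrite preimage_id product_measure1E// lte_mul_pinfty// ge0_fin_numE.
by apply/funext => z; exact: consK.
Qed.

HB.instance Definition _ :=
  Measure_isSigmaFinite.Build _ _ _ lebesgue_step lebesgue_step_sigma_finite.

End Step.

Let dirac_nil_sigma_finite :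
  sigma_finite setT (\d_([tuple] : 0.-tuple R) : set _ -> \bar R).
Proof.
apply: fin_num_fun_sigma_finite; first by rewrite measure0.
by move=> A _; rewrite /dirac fin_numE.
Qed.

(** Lebesgue measure on [R^n]. *)
Fixpoint lebesgue_tuple (n : nat) :
    {sigma_finite_measure set (n.-tuple R) -> \bar R} :=
  match n with
  | 0 => \d_([tuple] : 0.-tuple R)
  | m.+1 => lebesgue_step (lebesgue_tuple m)
  end.

End LebesgueTuple.
Arguments lebesgue_tuple R n : clear implicits.

Section ComplexL2.
Context {R : realType}.

Definition cis (a : R) : R[i] := cos a +i* sin a.

Context {disp : measure_display} {T : measurableType disp}.
Variables (mu : {measure set T -> \bar R}) (D : set T).

Definition cmeasurable (f : T -> R[i]) :=
  measurable_fun setT (fun z => complex.Re (f z)) /\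
  measurable_fun setT (fun z => complex.Im (f z)).

Definition cintegral (f : T -> R[i]) : R[i] :=
  (\int[mu]_(z in D) complex.Re (f z)) +i* (\int[mu]_(z in D) complex.Im (f z)).

Definition L2norm (f : T -> R[i]) : \bar R :=
  ((\int[mu]_(z in D) (normc (f z) ^+ 2)%:E) `^ 2^-1)%E.

Definition memL2 (f : T -> R[i]) := cmeasurable f /\ (L2norm f < +oo)%E.

End ComplexL2.

Section Schrodinger.
Context {R : realType} (d : nat).

Local Notation Rd := (d.-tuple R).
Local Notation Zd := (d.-tuple int).
Local Notation spacetime := (R * d.-tuple R)%type.

Definition dot (k : Zd) (x : Rd) : R := \sum_(i < d) (tnth k i)%:~R * tnth x i.
Definition sqlen (k : Zd) : R := \sum_(i < d) (tnth k i)%:~R ^+ 2.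

Definition translate (x : Rd) (k : Zd) : Rd :=
  [tuple tnth x i + 2 * pi * (tnth k i)%:~R | i < d].

Definition space_periodic (A : Type) (f : Rd -> A) :=
  forall x k, f (translate x k) = f x.

Definition st_periodic (A : Type) (f : spacetime -> A) :=
  forall t x (n : int) k, f (t + 2 * pi * n%:~R, translate x k) = f (t, x).

Definition cell : set Rd := [set x | forall i, - pi <= tnth x i < pi].
Definition st_cell : set spacetime := `[- pi, pi[ `*` cell.
Definition strip : set spacetime := [set: R] `*` cell.

Definition dxdt : {measure set spacetime -> \bar R} :=
  (lebesgueR \x lebesgue_tuple R d)%E.

(** [L^2(T^d)] and its norm. *)
Definition L2T (u0 : Rd -> R[i]) :=
  space_periodic u0 /\ memL2 (lebesgue_tuple R d) cell u0.
Definition normT (u0 : Rd -> R[i]) := L2norm (lebesgue_tuple R d) cell u0.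

(** Norms of [L^2(T_t x T^d)] and [L^2(R x T^d)]. *)
Definition normTT (u : spacetime -> R[i]) := L2norm dxdt st_cell u.
Definition normRT (u : spacetime -> R[i]) := L2norm dxdt strip u.

Definition L2RT (u : spacetime -> R[i]) :=
  (forall t, space_periodic (fun x => u (t, x))) /\ memL2 dxdt strip u.

Definition fourier (u0 : Rd -> R[i]) (k : Zd) : R[i] :=
  ((2 * pi) ^- d)%:C *
  cintegral (lebesgue_tuple R d) cell (fun x => u0 x * cis (- dot k x)).

(** [e^{it Delta}] is the Fourier multiplier [exp (- i t |k|^2)]; [u] is a
    jointly measurable version of [(t, x) |-> (e^{it Delta} u0)(x)]. *)
Definition is_propagation (u0 : Rd -> R[i]) (u : spacetime -> R[i]) :=
  cmeasurable u /\
  forall t, L2T (fun x => u (t, x)) /\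
    forall k, fourier (fun x => u (t, x)) k = cis (- t * sqlen k) * fourier u0 k.

(** [X^oo], the space of free waves. *)
Definition waves : set (spacetime -> R[i]) :=
  [set u | exists2 u0, L2T u0 & is_propagation u0 u].

(** Trigonometric polynomials on [T_t x T^d]; an entry [(c, n, k)] stands for
    the term [c e^{i(n t + k.x)}]. *)
Definition trigpoly (u : spacetime -> R[i]) :=
  exists s : seq (R[i] * int * Zd),
    forall t x, u (t, x) = \sum_(p <- s) p.1.1 * cis (p.1.2%:~R * t + dot p.2 x).

(** An operator from [X^oo] to its (anti)dual [X^-oo], in curried form:
    [T u v] is the value of [T u] at [v].  Only the values on [waves] matter. *)
Definition operator := (spacetime -> R[i]) -> (spacetime -> R[i]) -> R[i].

Definition sesquilinear (T : operator) :=
  (forall a u u' v, waves u -> waves u' -> waves v ->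
     T (fun z => a * u z + u' z) v = a * T u v + T u' v) /\
  (forall a u v v', waves u -> waves v -> waves v' ->
     T u (fun z => a * v z + v' z) = a^* * T u v + T u v').

Definition opnorm (T : operator) : \bar R :=
  ereal_inf [set C%:E | C in [set C : R | 0 <= C /\
    forall u v, waves u -> waves v ->
      ((normc (T u v))%:E <= C%:E * (normTT u * normTT v))%E]].

(** [Y^{oo,-oo}].  Boundedness makes [T u v] depend only on the a.e. classes of
    [u] and [v]. *)
Definition Yspace : set operator :=
  [set T | sesquilinear T /\ (opnorm T < +oo)%E].

Definition Yzero : set operator :=
  [set T | forall u v, waves u -> waves v -> T u v = 0].

Definition mult (f : spacetime -> R) : operator :=
  fun u v => cintegral dxdt st_cell (fun z => (f z)%:C * u z * (v z)^*).

(** [Y^{oo,-oo}_{0,+}]. *)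
Definition Y0plus : set operator :=
  [set T | Yspace T /\ forall e : R, 0 < e -> exists phi : spacetime -> R,
     [/\ continuous phi, st_periodic phi, forall z, 0 <= phi z &
         (opnorm (fun u v => T u v - mult phi u v)%R < e%:E)%E]].

(** The integrable function [f] belongs to the set of operators [A]. *)
Definition fun_mem (A : set operator) (f : spacetime -> R) :=
  dxdt.-integrable st_cell (EFin \o f) /\
  exists2 T, A T & forall u v, trigpoly u -> waves u -> trigpoly v -> waves v ->
    T u v = mult f u v.

(** The 2pi-periodic extension in time of the restriction to [[-pi, pi[]. *)
Definition time_periodize (A : Type) (f : spacetime -> A) : spacetime -> A :=
  fun z => f (z.1 - 2 * pi * (Num.floor ((z.1 + pi) / (2 * pi)))%:~R, z.2).

(** The support of a function defined almost everywhere. *)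
Definition esupport (f : spacetime -> R[i]) : set spacetime :=
  [set z | forall U, nbhs z U -> ~ dxdt.-negligible (U `&` [set w | f w != 0])].

End Schrodinger.
Arguments Yzero {R d}.
Arguments Y0plus {R d}.

(* Main.v *)
(** Write f = |chi|^2 and, for a finitely supported family a on Z^d, let Q(a) be
    the mean over space-time of f |sum_k a_k e^(i(k.x - |k|^2 t))|^2.  By density
    it is enough to prove sum_k |a_k|^2 <= C Q(a).

    Since f is a limit, in operator norm, of continuous functions, and these are
    uniform limits of trigonometric polynomials, Q differs by at most
    eps sum |a_k|^2 from a form in which a_k and a_l interact only when
    (|k|^2 - |l|^2, l - k) lies in a finite set S of shifts.  The estimate is
    proved for k's in a coset of a rational subspace V, by induction on the rank
    of V.  Cut Z^d into large cubes; for a suitable offset, interactions across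
    their faces are negligible.  Inside a cube the interacting k's differ by
    elements of the span of the shifts acting there.  Where this span is smaller
    than V, the induction hypothesis applies.  Elsewhere k.m is bounded for
    shifts m spanning V, so that only finitely many such k are left modulo
    translations orthogonal to V, which preserve Q.

    A single coefficient is controlled as follows.  Order the frequencies so that
    each (-|k|^2, k) has finitely many predecessors, and remove these from the
    wave by induction.  Let E be a set of positive measure on which f is bounded
    below.  By Szego's argument there are trigonometric polynomials q with
    constant term 1 and all other frequencies positive that are arbitrarily
    small in L^2 off E.  Pairing the wave with q extracts a_k, and only the
    restriction of the wave to E, which Q controls, contributes significantly. *)

Require Import Defs.
From HB Require Import structures.
From mathcomp Require Import all_boot all_order all_algebra.
From mathcomp Require Import all_classical all_reals all_analysis.
From mathcomp Require Import complex.
From mathcomp Require Import measurable_realfun ring lra zify.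
Set Implicit Arguments.
Unset Strict Implicit.
Unset Printing Implicit Defensive.
Import Order.TTheory GRing.Theory Num.Theory.
Import numFieldNormedType.Exports.
Import ComplexField.Normc.
Local Open Scope ring_scope.

(** * Frequencies on the paraboloid *)

(** For l = k + m the condition (|k|^2 - |l|^2, l - k) = (tau, m) reads 2 k.m = -tau - |m|^2: a
    shift acts only along a hyperplane normal to m. This is why cubes help: within one cube k.m
    varies by at most the side times the l1 norm of m, so a shift acting somewhere in a cube keeps
    k.m bounded on all of it. The difficulty is uniformity, as there are infinitely many cosets and
    infinitely many V. The k.m are integers, so bounded ones take finitely many values, and finitely
    many cosets remain after translation. If V has an exceptional point, it is spanned by some of
    the shifts in S, and S depends only on the constant for smaller ranks; so finitely many V need a
    constant of their own, and the others are covered by the induction constant alone. Szego's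
    infimum vanishes because, for near-minimizers q, the function |q|^2 off E has small nonconstant
    Fourier coefficients and varies little in L^1: it is nearly constant, yet it is 0 on E. *)

Lemma leq_neq_trans (T : eqType) (x y z : T) :
  ((x != z) <= (x != y) + (y != z))%N.
Proof. by case: (eqVneq x y) => [->|_] //=; case: (x != z); case: (y != z). Qed.

Section Lattice.
Variable d : nat.
Implicit Types (k l m w : 'rV[int]_d) (V : 'M[rat]_d).

Definition idot k m : int := \sum_i k 0 i * m 0 i.
(** The space-time frequency of the free wave e^{i(k.x - |k|^2 t)}, a point of the paraboloid. *)
Definition freq k : int * 'rV[int]_d := (- idot k k, k).
(** Embeds Z^d in Q^d, so that spans and cosets become row spaces of rational matrices. *)
Definition ratv k : 'rV[rat]_d := map_mx intr k.
(** Label of the cube of side N containing k. One offset o serves all coordinates: N offsets along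
    the diagonal suffice, since [count_tile] treats the coordinates by a union bound. *)
Definition tile (N o : nat) k : 'rV[int]_d :=
  \row_(i < d) ((k ord0 i - o%:Z) %/ N%:Z)%Z.
Definition onorm m : nat := \sum_i absz (m ord0 i).

Definition in_coset V (s : seq 'rV[int]_d) :=
  {in s &, forall k l, (ratv (k - l) <= V)%MS}.

Lemma idotC k m : idot k m = idot m k.
Proof. by apply: eq_bigr => i _; rewrite mulrC. Qed.

Lemma idotDl k l m : idot (k + l) m = idot k m + idot l m.
Proof. by rewrite -big_split; apply: eq_bigr => i _; rewrite mxE mulrDl. Qed.

Lemma idotNl k m : idot (- k) m = - idot k m.
Proof. by rewrite -sumrN; apply: eq_bigr => i _; rewrite mxE mulNr. Qed.

Lemma idotDr k l m : idot m (k + l) = idot m k + idot m l.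
Proof. by rewrite idotC idotDl !(idotC _ m). Qed.

Lemma idotNr k m : idot k (- m) = - idot k m.
Proof. by rewrite idotC idotNl idotC. Qed.

Definition idotE := (idotDl, idotNl, idotDr, idotNr).

Lemma ratvB k l : ratv (k - l) = ratv k - ratv l.
Proof. exact: map_mxB. Qed.

Lemma idot_ratv k m : ((idot k m)%:~R : rat)%:M = ratv k *m (ratv m)^T.
Proof.
apply/matrixP => i j; rewrite !ord1 mxE eqxx mulr1n rmorph_sum mxE.
by apply: eq_bigr => h _; rewrite !mxE rmorphM.
Qed.

Lemma ratv_orth k m : (ratv k *m (ratv m)^T == 0) = (idot k m == 0).
Proof.
rewrite -idot_ratv; apply/eqP/eqP => [/matrixP /(_ 0 0)|->]; last first.
  by apply/matrixP => i j; rewrite !mxE mul0rn.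
by rewrite !mxE eqxx mulr1n => /eqP; rewrite intr_eq0 => /eqP.
Qed.

Lemma idot_eq0 k : (idot k k == 0) = (k == 0).
Proof.
apply/eqP/eqP => [|->]; last by rewrite /idot big1 // => i _; rewrite mxE mul0r.
move/eqP; rewrite psumr_eq0 => [|i _]; last by rewrite -expr2 sqr_ge0.
move=> /allP h; apply/rowP => i; rewrite mxE.
by move: (h i (mem_index_enum _)); rewrite mulf_eq0 orbb => /eqP.
Qed.

(** |k + w|^2 - |l + w|^2 differs from |k|^2 - |l|^2 by 2 w.(k - l). *)
Lemma freq_shift k l w : idot w (k - l) = 0 ->
  freq (k + w) - freq (l + w) = freq k - freq l.
Proof.
move=> h; congr (_, _) => /=; last by rewrite opprD addrACA subrr addr0.
move: h; rewrite !idotE (idotC k w) (idotC l w); lia.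
Qed.

(** A face separates x from x + 1 only when N divides x + 1 - o, which determines o modulo N. *)
Lemma count_divz_step (N : nat) (x : int) : (0 < N)%N ->
  (\sum_(o < N) ((x - o%:Z) %/ N%:Z != (x + 1 - o%:Z) %/ N%:Z)%Z <= 1)%N.
Proof.
move=> N0; rewrite -big_mkcond /= sum1_card.
have H (o : 'I_N) : ((x - o%:Z) %/ N%:Z != (x + 1 - o%:Z) %/ N%:Z)%Z ->
  (N%:Z %| x + 1 - o%:Z)%Z.
  apply: contraR => /dvdz_mod0P h.
  have N0' : N%:Z != 0 by lia.
  have := divz_eq (x + 1 - o%:Z) N%:Z.
  have := modz_ge0 (x + 1 - o%:Z) N0'.
  have : ((x + 1 - o%:Z) %% N%:Z < N%:Z)%Z by rewrite ltz_pmod //; lia.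
  move: h; set r := modz _ _; set q := divz _ _ => h r1 r2 e.
  have -> : x - o%:Z = q * N%:Z + (r - 1) by lia.
  rewrite divzMDl // (@divz_small (r - 1)) ?addr0 //.
  by rewrite /=; apply/andP; split; lia.
apply/card_le1_eqP => o o'; rewrite !unfold_in => /H ho /H ho'.
have : (N%:Z %| o%:Z - o'%:Z)%Z.
  have -> : o%:Z - o'%:Z = (x + 1 - o'%:Z) - (x + 1 - o%:Z) by lia.
  exact: rpredB.
move=> /dvdzP [q hq]; apply: val_inj => /=.
have := ltn_ord o; have := ltn_ord o'.
have [q0|q0|q0] := ltrgtP q 0; last by move: hq; rewrite q0; lia.
  by nia.
by nia.
Qed.

Lemma count_divz (N : nat) (x y : int) : (0 < N)%N ->
  (\sum_(o < N) ((x - o%:Z) %/ N%:Z != (y - o%:Z) %/ N%:Z)%Z <= absz (x - y))%N.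
Proof.
move=> N0.
have H (n : nat) : forall z, (\sum_(o < N)
    ((z - o%:Z) %/ N%:Z != (z + n%:Z - o%:Z) %/ N%:Z)%Z <= n)%N.
  elim: n => [|n IH] z; first by rewrite big1 // => o _; rewrite addr0 eqxx.
  rewrite -addn1; apply: leq_trans (leq_add (IH z) (count_divz_step (z + n%:Z) N0)).
  rewrite -big_split; apply: leq_sum => o _ /=.
  have -> : z + (n + 1)%:Z - o%:Z = z + n%:Z + 1 - o%:Z by lia.
  exact: leq_neq_trans.
have [xy|yx] := lerP x y.
  by have := H (absz (x - y)) x; have -> : x + (absz (x - y))%:Z = y by lia.
have := H (absz (x - y)) y; have -> : y + (absz (x - y))%:Z = x by lia.
by under eq_bigr do rewrite eq_sym.
Qed.

(** Points in different cubes are separated along some coordinate i, and at most |k_i - l_i| offsets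
    do so for a given i. *)
Lemma count_tile (N : nat) k l : (0 < N)%N ->
  (\sum_(o < N) (tile N o k != tile N o l) <= onorm (k - l))%N.
Proof.
move=> N0; apply: (@leq_trans (\sum_(i < d) \sum_(o < N)
   ((k ord0 i - o%:Z) %/ N%:Z != (l ord0 i - o%:Z) %/ N%:Z)%Z)%N).
  rewrite exchange_big /=; apply: leq_sum => o _.
  case: eqP => //= /eqP; apply: contra_neqT; rewrite -ltnNge ltnS leqn0 sum_nat_eq0.
  move=> /forallP h; apply/rowP => i; rewrite !mxE.
  by move: (h i); rewrite implyTb eqb0 negbK => /eqP.
apply: leq_sum => i _; apply: leq_trans (count_divz _ _ N0) _.
by rewrite !mxE.
Qed.

Lemma tile_near (N o : nat) k l i : (0 < N)%N -> tile N o k = tile N o l ->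
  `|k ord0 i - l ord0 i| <= N%:Z.
Proof.
move=> N0 /rowP /(_ i); rewrite !mxE => e.
have N0' : N%:Z != 0 by lia.
have := divz_eq (k ord0 i - o%:Z) N%:Z; have := divz_eq (l ord0 i - o%:Z) N%:Z.
have := modz_ge0 (k ord0 i - o%:Z) N0'; have := modz_ge0 (l ord0 i - o%:Z) N0'.
have : ((k ord0 i - o%:Z) %% N%:Z < N%:Z)%Z by rewrite ltz_pmod //; lia.
have : ((l ord0 i - o%:Z) %% N%:Z < N%:Z)%Z by rewrite ltz_pmod //; lia.
rewrite e; lia.
Qed.

Lemma idot_near (B : int) k l m : (forall i, `|k 0 i - l 0 i| <= B) ->
  `|idot k m| <= `|idot l m| + B * (onorm m)%:Z.
Proof.
move=> h; have -> : k = l + (k - l) by rewrite addrC subrK.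
rewrite idotDl; apply: le_trans (ler_normD _ _) _; rewrite lerD2l.
apply: le_trans (ler_norm_sum _ _ _) _.
rewrite /onorm (big_morph Posz PoszD (erefl _)) mulr_sumr.
apply: ler_sum => i _; rewrite normrM abszE !mxE ler_wpM2r //; exact: h.
Qed.

End Lattice.

(** * An order on the frequencies with finite initial segments *)

Section FrequencyOrder.
Variable d : nat.
Implicit Types (k l m : 'rV[int]_d) (s t : int * 'rV[int]_d).

Definition lexpos m := [exists i : 'I_d,
  (0 < m ord0 i) && [forall j : 'I_d, (j < i)%N ==> (m ord0 j == 0)]].

(* Positivity for a total group order on [Z x Z^d] in which every [freq k] has
   finitely many predecessors. *)
Definition pos s := (s.1 < 0) || (s.1 == 0) && lexpos s.2.

(** As [freq k - freq l] is (|l|^2 - |k|^2, k - l), shorter vectors come first and equal lengths are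
    ordered lexicographically. *)
Definition prec l k := pos (freq k - freq l).

Lemma lexposD m m' : lexpos m -> lexpos m' -> lexpos (m + m').
Proof.
move=> /existsP [i /andP[i0 /forallP hi]] /existsP [j /andP[j0 /forallP hj]].
have hi' (x : 'I_d) : (x < i)%N -> m ord0 x = 0 by move=> xi; have := hi x; rewrite xi => /eqP.
have hj' (x : 'I_d) : (x < j)%N -> m' ord0 x = 0 by move=> xj; have := hj x; rewrite xj => /eqP.
apply/existsP; have [ij|ji|ij] := ltngtP i j.
- exists i; rewrite mxE (hj' i) // addr0 i0; apply/forallP => x; apply/implyP => xi.
  by rewrite mxE hi' // hj' ?addr0 // (ltn_trans xi).
- exists j; rewrite mxE (hi' j) // add0r j0; apply/forallP => x; apply/implyP => xj.
  by rewrite mxE hj' // hi' ?addr0 // (ltn_trans xj).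
have {}ij : i = j by exact: val_inj.
subst j; exists i; rewrite mxE addr_gt0 //; apply/forallP => x; apply/implyP => xi.
by rewrite mxE hi' // hj' ?addr0.
Qed.

Lemma lexpos_total m : m != 0 -> lexpos m || lexpos (- m).
Proof.
move=> m0; have /existsP [i0 hi0] : [exists i, m ord0 i != 0].
  apply: contraR m0; rewrite negb_exists => /forallP h; apply/eqP/rowP => i.
  by rewrite mxE; apply/eqP; rewrite -[_ == _]negbK.
case: (@arg_minnP _ i0 (fun i => m ord0 i != 0) (fun i => i : nat) hi0) => i hi hmin.
have hj (j : 'I_d) : (j < i)%N -> m ord0 j = 0.
  move=> ji; apply/eqP; apply: contraLR ji => /hmin; by rewrite -leqNgt.
have [hp|hn|h0] := ltrgtP (m ord0 i) 0; last by rewrite h0 eqxx in hi.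
  apply/orP; right; apply/existsP; exists i; rewrite mxE oppr_gt0 hp.
  by apply/forallP => j; apply/implyP => ji; rewrite mxE hj ?oppr0.
apply/orP; left; apply/existsP; exists i; rewrite hn.
by apply/forallP => j; apply/implyP => ji; rewrite hj.
Qed.

Lemma pos0 : ~~ pos 0.
Proof.
rewrite /pos ltxx /=; apply/negP => /existsP [j].
by rewrite mxE ltxx.
Qed.

Lemma posD s t : pos s -> pos t -> pos (s + t).
Proof.
rewrite /pos => /orP[s0|/andP[/eqP s0 hs]] /orP[t0|/andP[/eqP t0 ht]] /=.
- by have -> : s.1 + t.1 < 0 by lia.
- by rewrite t0 addr0 s0.
- by rewrite s0 add0r t0.
- by rewrite s0 t0 addr0 lexposD // orbT.
Qed.

Lemma pos_total s : s != 0 -> pos s || pos (- s).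
Proof.
move=> s0; rewrite /pos /=; have [h|h|h] := ltrgtP s.1 0; rewrite ?h //.
  by rewrite oppr_lt0 h orbT.
rewrite oppr0 eqxx /=; apply: lexpos_total; apply: contra s0 => /eqP h2.
by apply/eqP; rewrite (surjective_pairing s) h h2.
Qed.

Lemma prec_irr k : ~~ prec k k.
Proof. by rewrite /prec subrr pos0. Qed.

Lemma prec_trans k l m : prec k l -> prec l m -> prec k m.
Proof. by move=> h h'; have := posD h h'; rewrite /prec addrC addrA subrK. Qed.

(** A predecessor has |l|^2 <= |k|^2, and the absolute value of an integer is at most its square, so
    its coordinates lie in [-B, B] with B = |k|^2. *)
Lemma prec_finite k : exists P : seq 'rV[int]_d, forall l, prec l k -> l \in P.
Proof.
pose B := absz (idot k k).
exists [seq \row_i ((f i : nat)%:Z - B%:Z) | f : {ffun 'I_d -> 'I_(2 * B).+1}] => l hl.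
have h : idot l l <= idot k k.
  by move: hl; rewrite /prec /pos /= => /orP[|/andP[/eqP]]; lia.
have hi (i : 'I_d) : (absz (l ord0 i) <= B)%N.
  have hx (x z K : int) : 0 <= z -> x * x + z <= K -> (absz x <= absz K)%N by nia.
  apply: (hx _ (\sum_(j < d | j != i) l 0 j * l 0 j)).
    by apply: sumr_ge0 => j _; rewrite -expr2 sqr_ge0.
  by have := h; rewrite {1}/idot (bigD1 i).
have hb (i : 'I_d) : (absz (l ord0 i + B%:Z)%R < (2 * B).+1)%N by have := hi i; lia.
apply/fintype.imageP; exists [ffun i => Ordinal (hb i)] => //.
have e (x : int) b : (absz x <= b)%N -> x = (absz (x + b%:Z)%R)%:Z - b%:Z by lia.
by apply/rowP => i; rewrite mxE ffunE; exact: e (hi i).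
Qed.

End FrequencyOrder.

(** * Forms with finitely many shifts *)

Section ComplexNorm.
Variable R : rcfType.
Implicit Types z w : R[i].

Lemma normc_ge0 z : 0 <= normc z.
Proof. by case: z => x y; exact: sqrtr_ge0. Qed.

Lemma normc_conj z : normc (conjc z) = normc z.
Proof. by case: z => x y; rewrite /= sqrrN. Qed.

Lemma sqr_normcE z : normc z ^+ 2 = complex.Re z ^+ 2 + complex.Im z ^+ 2.
Proof. by case: z => x y; rewrite /= sqr_sqrtr // addr_ge0 // sqr_ge0. Qed.

Lemma ler_Re_normc z : `|complex.Re z| <= normc z.
Proof.
rewrite -(@ler_pXn2r _ 2) ?nnegrE ?normc_ge0 // real_normK ?num_real //.
by rewrite sqr_normcE lerDl sqr_ge0.
Qed.

End ComplexNorm.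

Lemma exists_le_average (R : realDomainType) (N : nat) (F : 'I_N -> R) (A : R) :
  (0 < N)%N -> \sum_o F o <= A -> exists o, F o *+ N <= A.
Proof.
move=> N0 h; apply/existsP; apply: contraLR h; rewrite negb_exists => /forallP h.
rewrite -ltNge -(ltr_pMn2r N0).
have -> : A *+ N = \sum_(o < N) A by rewrite sumr_const card_ord.
rewrite -sumrMnl.
case: N N0 F h => // N _ F h; rewrite !big_ord_recl /=.
apply: ltr_leD; first by rewrite ltNge h.
by apply: ler_sum => i _; rewrite ltW // ltNge h.
Qed.

Lemma big_label (R : nmodType) (I T : eqType) (g : I -> T) (s : seq I) (F : I -> R) :
  \sum_(c <- undup (map g s)) \sum_(k <- s | g k == c) F k = \sum_(k <- s) F k.
Proof.
rewrite (exchange_big_dep predT) //= big_seq [RHS]big_seq; apply: eq_bigr => k ks.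
rewrite (eq_bigl (pred1 (g k))) => [|c]; last by rewrite /= eq_sym.
by rewrite -big_filter filter_pred1_uniq ?undup_uniq ?mem_undup ?map_f // big_seq1.
Qed.

Section BandForm.
Variables (R : rcfType) (d : nat).
Local Notation Zd := 'rV[int]_d.
Implicit Types (s : seq Zd) (a : Zd -> R[i]) (S : seq (R[i] * (int * Zd))).

Definition mass s a : R := \sum_(k <- s) normc (a k) ^+ 2.

(** For x = (c, tau), the contribution of the term c e_tau of a trigonometric polynomial P to the
    mean of P |wave|^2; other pairs integrate to 0 (see [band_integral]). *)
Definition bterm (x : R[i] * (int * Zd)) a k l : R :=
  if freq l - freq k == x.2 then complex.Re (x.1 * (a k * conjc (a l))) else 0.

Definition band S s a : R :=
  \sum_(x <- S) \sum_(k <- s) \sum_(l <- s) bterm x a k l.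

(** Bounds what [band] can lose when the interactions between pairs in P are severed. *)
Definition berr S s a (P : rel Zd) : R :=
  \sum_(x <- S) \sum_(k <- s) \sum_(l <- s)
    if (freq l - freq k == x.2) && P k l
    then normc x.1 * (normc (a k) * normc (a l)) else 0.

Lemma mass_ge0 s a : 0 <= mass s a.
Proof. by apply: sumr_ge0 => k _; exact: sqr_ge0. Qed.

(** 2 h_k h_l <= h_k^2 + h_l^2, and tau determines l from k and k from l, so each square is counted
    at most once on either side. *)
Lemma pair_sum_le s (h : Zd -> R) (tau : int * Zd) : uniq s ->
  \sum_(k <- s) \sum_(l <- s) (if freq l - freq k == tau then h k * h l else 0)
  <= \sum_(k <- s) h k ^+ 2.
Proof.
move=> us.
have half (F : Zd -> Zd -> bool) : (forall k l l', F k l -> F k l' -> l = l') ->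
    \sum_(k <- s) \sum_(l <- s) (if F k l then h k ^+ 2 else 0)
    <= \sum_(k <- s) h k ^+ 2.
  move=> hF; apply: ler_sum => k _; rewrite -big_mkcond /= big_const_seq iter_addr_0.
  suff : (count (F k) s <= 1)%N.
    by case: (count _ _) => [|[|]] // _; rewrite ?mulr0n ?mulr1n ?sqr_ge0.
  rewrite -size_filter; have := filter_uniq (F k) us.
  have : {in seq.filter (F k) s &, forall l l', l = l'}.
    by move=> l l'; rewrite !mem_filter => /andP[+ _] /andP[+ _]; apply: hF.
  case: (seq.filter _ _) => [|x [|y t]] //= /(_ x y); rewrite !inE !eqxx orbT /=.
  by move=> /(_ isT isT) ->; rewrite eqxx.
have h1 : \sum_(k <- s) \sum_(l <- s)
    (if freq l - freq k == tau then h k ^+ 2 else 0) <= \sum_(k <- s) h k ^+ 2.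
  apply: (half (fun k l => freq l - freq k == tau)) => k l l' /eqP <-.
  by case/eqP => _ /addIr.
have h2 : \sum_(k <- s) \sum_(l <- s)
    (if freq k - freq l == tau then h k ^+ 2 else 0) <= \sum_(k <- s) h k ^+ 2.
  apply: (half (fun k l => freq k - freq l == tau)) => k l l' /eqP <-.
  by case/eqP => _ /addrI /oppr_inj.
rewrite -(@ler_pM2l _ 2) // [leRHS]mulr_natl mulr2n.
apply: le_trans (lerD h1 h2).
rewrite [X in _ <= _ + X]exchange_big /= -big_split /= mulr_sumr.
apply: ler_sum => k _; rewrite -big_split /= mulr_sumr; apply: ler_sum => l _.
case: ifP => _; last by rewrite mulr0 addr0.
by rewrite -subr_ge0; have := sqr_ge0 (h k - h l); rewrite sqrrB; lra.
Qed.

(** A pair differing by m is separated for at most |m|_1 of the N offsets, so the sum over all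
    offsets is bounded independently of N, and some offset does no worse than the average. *)
Lemma berr_tile (N : nat) s a S : (0 < N)%N -> uniq s ->
  exists o : nat, berr S s a (fun k l => tile N o k != tile N o l) *+ N
    <= (\sum_(x <- S) normc x.1 * (onorm x.2.2)%:R) * mass s a.
Proof.
move=> N0 us.
have [|o ho] := @exists_le_average R N
  (fun o => berr S s a (fun k l => tile N o k != tile N o l))
  ((\sum_(x <- S) normc x.1 * (onorm x.2.2)%:R) * mass s a) N0; last by exists o.
rewrite exchange_big /= mulr_suml; apply: ler_sum => x _.
apply: (@le_trans _ _ (normc x.1 * (onorm x.2.2)%:R *
  \sum_(k <- s) \sum_(l <- s) (if freq l - freq k == x.2
     then normc (a k) * normc (a l) else 0))); last first.
  by rewrite ler_wpM2l ?mulr_ge0 ?normc_ge0 // pair_sum_le.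
rewrite exchange_big mulr_sumr; apply: ler_sum => k _.
rewrite exchange_big mulr_sumr; apply: ler_sum => l _ /=.
case: eqP => /= [e|_]; last by rewrite mulr0 big1.
rewrite -big_mkcond /= sumr_const mulrAC -[leLHS]mulr_natr.
rewrite ler_wpM2l ?mulr_ge0 ?normc_ge0 //.
rewrite ler_nat -sum1_card big_mkcond /= -e /=.
have -> : l - k = - (k - l) by rewrite opprB.
have -> : onorm (- (k - l)) = onorm (k - l).
  by apply: eq_bigr => i _; rewrite mxE abszN.
apply: leq_trans (count_tile _ _ N0); apply: leq_sum => o _.
by rewrite unfold_in; case: (_ != _).
Qed.

(** The two band sums differ only by terms joining different classes, and [berr] dominates their
    real parts. *)
Lemma band_split (T : eqType) (g : Zd -> T) s a S :
  \sum_(c <- undup (map g s)) band S [seq k <- s | g k == c] a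
  <= band S s a + berr S s a (fun k l => g k != g l).
Proof.
have -> : \sum_(c <- undup (map g s)) band S [seq k <- s | g k == c] a =
  \sum_(x <- S) \sum_(k <- s) \sum_(l <- s) if g l == g k then bterm x a k l else 0.
  rewrite exchange_big /=; apply: eq_bigr => x _.
  rewrite -[RHS](big_label g); apply: eq_bigr => c _.
  rewrite big_filter; apply: eq_bigr => k /eqP ->.
  by rewrite big_filter big_mkcond.
rewrite -big_split; apply: ler_sum => x _; rewrite -big_split; apply: ler_sum => k _.
rewrite -big_split; apply: ler_sum => l _ /=; rewrite /bterm eq_sym.
case: eqP => _ /=; case: eqP => _ /=; rewrite ?addr0 //.
rewrite -lerBlDl sub0r.
by apply: le_trans (ler_norm _) _; rewrite normrN (le_trans (ler_Re_normc _)) // !normcM normc_conj.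
Qed.

Lemma mass_split (T : eqType) (g : Zd -> T) s a :
  \sum_(c <- undup (map g s)) mass [seq k <- s | g k == c] a = mass s a.
Proof.
rewrite [RHS]/mass -(big_label g); apply: eq_bigr => c _.
by rewrite /mass big_filter.
Qed.

Lemma band_shift w s a S : {in s &, forall k l, idot w (k - l) = 0} ->
  band S [seq k + w | k <- s] (fun k => a (k - w)) = band S s a.
Proof.
move=> h; apply: eq_bigr => x _; rewrite big_map; apply: eq_big_seq => k ks.
rewrite big_map; apply: eq_big_seq => l ls; rewrite /bterm !addrK freq_shift //.
exact: h.
Qed.

Lemma mass_shift w s a :
  mass [seq k + w | k <- s] (fun k => a (k - w)) = mass s a.
Proof. by rewrite /mass big_map; apply: eq_bigr => k _; rewrite addrK. Qed.

End BandForm.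

(** * Coercivity *)

Lemma finite_representatives (T : eqType) (F : finType) (h : T -> F) (P : T -> Prop) :
  exists2 l : seq T, (forall x, x \in l -> P x) &
    forall x, P x -> exists2 y, y \in l & h y = h x.
Proof.
suff H (e : seq F) : exists2 l : seq T, (forall x, x \in l -> P x) &
    forall x, P x -> h x \in e -> exists2 y, y \in l & h y = h x.
  have [l l1 l2] := H (enum F); exists l => // x Px; apply: l2 => //.
  exact: mem_enum.
elim: e => [|c e [l l1 l2]]; first by exists [::].
have [[x Px hx]|nx] := pselect (exists2 x, P x & h x = c).
  exists (x :: l) => [y|y Py]; first by rewrite inE => /orP[/eqP ->|/l1].
  rewrite inE => /orP[/eqP yc|ye]; first by exists x; rewrite ?mem_head // hx.
  by have [z zl zy] := l2 y Py ye; exists z => //; rewrite inE zl orbT.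
exists l => // y Py; rewrite inE => /orP[/eqP yc|]; last exact: l2.
by case: nx; exists y.
Qed.

Lemma eq0_le_eps (R : realFieldType) (x M : R) : 0 <= M ->
  (forall e, 0 < e -> `|x| <= e * M) -> x = 0.
Proof.
move=> M0 h; apply/eqP; rewrite -normr_eq0 eq_le normr_ge0 andbT.
have [x0|//] := ltP 0 `|x|.
have M1 : 0 < M + 1 by rewrite ltr_wpDl.
have := h (`|x| / (M + 1) / 2) _; rewrite !divr_gt0 // => /(_ isT).
have -> : `|x| / (M + 1) / 2 * M = `|x| * (M / (M + 1) / 2) by ring.
rewrite -subr_ge0 -[X in _ - X]mulr1 -mulrBr pmulr_rge0 //.
have : M / (M + 1) <= 1 by rewrite ler_pdivrMr // mul1r lerDl.
lra.
Qed.

Section Coercivity.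
Variables (R : realType) (d : nat).
Local Notation Zd := 'rV[int]_d.
Variable Q : seq Zd -> (Zd -> R[i]) -> R.
Hypothesis Q_ge0 : forall s a, 0 <= Q s a.
Hypothesis Q_band : forall e, 0 < e -> exists S, forall s a, uniq s ->
  `|Q s a - band S s a| <= e * mass s a.
Hypothesis Q_obs : forall k e, 0 < e -> exists C, forall s a, uniq s -> k \in s ->
  normc (a k) ^+ 2 <= C * Q s a + e * mass s a.
Implicit Types (s : seq Zd) (a : Zd -> R[i]) (V : 'M[rat]_d).

(** The band forms are exactly invariant under this translation, and one S approximates Q on both
    families within e * mass; e is arbitrary. *)
Lemma Q_shift w s a : uniq s -> {in s &, forall k l, idot w (k - l) = 0} ->
  Q [seq k + w | k <- s] (fun k => a (k - w)) = Q s a.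
Proof.
move=> us hw; apply/eqP; rewrite -subr_eq0; apply/eqP.
apply: (@eq0_le_eps _ _ (2 * mass s a)); first by rewrite mulr_ge0 ?mass_ge0.
move=> e e0; have [S hS] := Q_band e0.
have h1 := hS s a us.
have us' : uniq [seq k + w | k <- s] by rewrite map_inj_uniq //; exact: addIr.
have h2 := hS _ (fun k => a (k - w)) us'.
rewrite band_shift // mass_shift in h2.
move: h1 h2; rewrite !ler_norml => /andP[h1 h2] /andP[h3 h4].
by apply/andP; split; lra.
Qed.

Section Bad.
Variables (S : seq (R[i] * (int * Zd))) (K : int).
Let n := size S.
Let m (i : 'I_n) : Zd := (nth (0, 0) S i).2.2.

(** K will be [band_width], which bounds 2 k.m whenever the shift acts somewhere in the cube of k
    ([active_near]). *)
Definition near_orth V k : pred 'I_n :=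
  fun i => (ratv (m i) <= V)%MS && (`|2 * idot k (m i)| <= K).

Definition bspan V k : 'M[rat]_d :=
  (\sum_(i < n | near_orth V k i) <<ratv (m i)>>)%MS.

(* At the remaining points the shifts that can act span a proper subspace of [V]. *)
Definition bad V k := (V <= bspan V k)%MS.

(* At a bad point the fingerprint determines the inner products of [k] with [V],
   hence [k] up to a translation orthogonal to [V]. *)
Definition finger k : {ffun 'I_n -> option ('I_(absz K).+1 * bool)} :=
  [ffun i => if `|2 * idot k (m i)| <= K
             then Some (inord (absz (idot k (m i))), idot k (m i) < 0) else None].

(** Equal fingerprints give k.m = k'.m for every shift m counted in [bspan], so k' - k is orthogonal
    to their span, which contains V. *)
Lemma finger_orth V k k' u : bad V k -> finger k = finger k' ->
  (ratv u <= V)%MS -> idot (k' - k) u = 0.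
Proof.
move=> bk hk uV; have /sub_kermxP : (ratv u <= kermx (ratv (k' - k))^T)%MS.
  apply: submx_trans uV (submx_trans bk _); apply/sumsmx_subP => i /andP[_ hi].
  rewrite genmxE; apply/sub_kermxP/eqP; rewrite ratv_orth idotC idotDl idotNl subr_eq0.
  move: hk => /ffunP /(_ i); rewrite !ffunE hi.
  case: ifP => // hi' [] /(congr1 val) /=; rewrite !inordK; first by lia.
    by rewrite ltnS; lia.
  by rewrite ltnS; lia.
by move/eqP; rewrite ratv_orth idotC => /eqP.
Qed.

(** Here k' - k is both in V and orthogonal to V, hence 0: a coset of V has at most one bad point
    per fingerprint. *)
Lemma in_coset_uniq V k k' : bad V k -> finger k = finger k' ->
  (ratv (k' - k) <= V)%MS -> k' = k.
Proof.
move=> bk hk hV; have := finger_orth bk hk hV; move/eqP.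
by rewrite idot_eq0 subr_eq0 => /eqP.
Qed.

Variables (kappa : R) (V : 'M[rat]_d).
Hypothesis kappa_gt0 : 0 < kappa.
Hypothesis key : forall s a, uniq s -> in_coset V s ->
  kappa * (\sum_(k <- s | ~~ bad V k) normc (a k) ^+ 2) <= Q s a + kappa / 4 * mass s a.

(** The error kappa / 4 * mass is absorbed by the left-hand side. *)
Lemma no_bad s a : uniq s -> in_coset V s -> ~~ has (bad V) s ->
  kappa * mass s a <= 2 * Q s a.
Proof.
move=> us cs nb; have := key a us cs; rewrite -big_filter (_ : [seq _ <- _ | _] = s).
  by rewrite -/(mass s a); have := Q_ge0 s a; have := mass_ge0 s a; nra.
apply/all_filterP/allP => k ks; apply: contra nb => bk; apply/hasP; by exists k.
Qed.

(** The hypothesis [key] handles the good points. The bad points of the coset r + V have finitely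
    many representatives B, each controlled by [Q_obs]; since B is known before e is chosen, their
    errors add up to at most mass / 4. *)
Lemma coset_coercive (r : Zd) : exists2 C, 0 <= C & forall s a, uniq s ->
  in_coset V s -> (forall k, k \in s -> (ratv (k - r) <= V)%MS) -> mass s a <= C * Q s a.
Proof.
have [B B1 B2] := finite_representatives finger
  (fun k => bad V k /\ (ratv (k - r) <= V)%MS).
pose e : R := (4 * (size B).+1%:R)^-1.
have e0 : 0 < e by rewrite invr_gt0 mulr_gt0.
have [Cf hCf] := choice (fun k => Q_obs k e0).
(* Adding the bounds for good and bad points leaves kappa / 2 * mass <= (1 + kappa * C) * Q. *)
pose C := \sum_(k <- B) `|Cf k|; exists ((1 + kappa * C) * (2 / kappa)).
  by rewrite mulr_ge0 ?divr_ge0 ?(ltW kappa_gt0) // addr_ge0 // mulr_ge0 ?(ltW kappa_gt0) // sumr_ge0.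
move=> s a us cs sr; have q0 := Q_ge0 s a; have m0 := mass_ge0 s a.
suff hb : \sum_(k <- s | bad V k) normc (a k) ^+ 2 <= C * Q s a + mass s a / 4.
  have := key a us cs; have : mass s a = \sum_(k <- s | bad V k) normc (a k) ^+ 2 +
    \sum_(k <- s | ~~ bad V k) normc (a k) ^+ 2 by rewrite /mass (bigID (bad V)).
  set x := \sum_(k <- s | bad V k) _ in hb *; set y := \sum_(k <- s | ~~ _) _ => e1 h1.
  rewrite mulrAC mulrA ler_pdivlMr // -subr_ge0.
  have : kappa * x <= kappa * (C * Q s a + mass s a / 4) by rewrite ler_pM2l.
  nra.
have -> : C * Q s a + mass s a / 4 = \sum_(k <- B) `|Cf k| * Q s a + mass s a / 4.
  by rewrite mulr_suml.
apply: (@le_trans _ _ (\sum_(k <- B | k \in s) normc (a k) ^+ 2)).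
  rewrite -big_filter -[leRHS]big_filter.
  apply: (@le_trans _ _ (\sum_(k <- undup [seq k <- B | k \in s]) normc (a k) ^+ 2)).
    have sub : {subset [seq k <- s | bad V k] <= undup [seq k <- B | k \in s]}.
      move=> k; rewrite mem_filter => /andP[bk ks]; rewrite mem_undup mem_filter ks /=.
      have [y yB hy] := B2 k (conj bk (sr k ks)); have [by_ yV] := B1 y yB.
      rewrite (@in_coset_uniq V y k) //.
      have -> : k - y = (k - r) - (y - r) by rewrite opprB addrA subrK.
      by rewrite ratvB; apply: addmx_sub; rewrite ?eqmx_opp //; exact: sr.
    have up : perm_eq [seq k <- undup [seq k <- B | k \in s] | k \in [seq k <- s | bad V k]] [seq k <- s | bad V k].
      apply: uniq_perm; rewrite ?filter_uniq ?undup_uniq // => k.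
      by rewrite mem_filter andb_idr // => /sub.
    rewrite -(perm_big _ up) big_filter /= [leRHS](bigID (mem [seq k <- s | bad V k])) /=.
    by rewrite lerDl sumr_ge0 // => k _; exact: sqr_ge0.
  elim: [seq k <- B | k \in s] => //= k l IH; rewrite big_cons.
  by case: ifP => _; rewrite ?big_cons ?lerD2l // (le_trans IH) // lerDr sqr_ge0.
apply: (@le_trans _ _ (\sum_(k <- B) (`|Cf k| * Q s a + e * mass s a))).
  rewrite big_mkcond /=; apply: ler_sum => k _; case: ifP => ks.
    apply: le_trans (hCf k s a us ks) _; rewrite lerD2r ler_wpM2r //; exact: ler_norm.
  by rewrite addr_ge0 // mulr_ge0 // ltW.
rewrite big_split /= lerD2l big_const_seq count_predT iter_addr_0 -[leLHS]mulr_natr.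
rewrite mulrAC [leRHS]mulrC ler_wpM2r // /e invfM -mulrA -[leRHS]mulr1 ler_pM2l ?invr_gt0 //.
by rewrite mulrC ler_pdivrMr ?ltr0Sn // mul1r ler_nat.
Qed.

(** Makes the constant independent of the coset. If s has a bad point k, let r be the representative
    with its fingerprint: r - k is orthogonal to V, so translating by it preserves Q and moves s
    into r + V. Only finitely many r occur. *)
Lemma fixed_coercive : exists2 C, 0 <= C & forall s a, uniq s ->
  in_coset V s -> mass s a <= C * Q s a.
Proof.
have [Rp R1 R2] := finite_representatives finger (bad V).
have [Cf hCf] := choice (fun r => (let: ex_intro2 C C0 h := coset_coercive r in
   ex_intro (fun C => 0 <= C /\ _) C (conj C0 h))).
exists (2 / kappa + \sum_(r <- Rp) Cf r).
  by rewrite addr_ge0 ?divr_ge0 ?(ltW kappa_gt0) // sumr_ge0 // => r _; have [] := hCf r.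
move=> s a us cs; have q0 := Q_ge0 s a.
have S0 : 0 <= \sum_(r <- Rp) Cf r by rewrite sumr_ge0 // => r _; have [] := hCf r.
have [/hasP[k ks bk]|nb] := boolP (has (bad V) s); last first.
  have h := no_bad a us cs nb; rewrite mulrDl.
  apply: (@le_trans _ _ (2 / kappa * Q s a)).
    by rewrite mulrAC ler_pdivlMr // mulrC.
  by rewrite lerDl mulr_ge0.
have [r rR hr] := R2 k bk.
have ho : {in s &, forall k1 l, idot (r - k) (k1 - l) = 0}.
  by move=> k1 l k1s ls; apply: (@finger_orth V k r) => //; exact: cs.
have [_ /(_ [seq k0 + (r - k) | k0 <- s] (fun k0 => a (k0 - (r - k))))] := hCf r.
rewrite Q_shift // mass_shift map_inj_uniq; last exact: addIr.
move=> /(_ us) h; apply: le_trans (h _ _) _.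
- move=> _ _ /mapP[x xs ->] /mapP[y ys ->].
  by rewrite opprD addrACA subrr addr0; exact: cs.
- move=> _ /mapP[x xs ->].
  have -> : x + (r - k) - r = x - k by rewrite [r - k]addrC addrA addrK.
  exact: cs.
rewrite ler_wpM2r // ler_wpDl ?divr_ge0 ?(ltW kappa_gt0) //.
elim: {R1 R2 S0 hr h} Rp rR => //= x l IH; rewrite inE big_cons => /orP[/eqP ->|/IH h].
  by rewrite lerDl sumr_ge0 // => y _; have [] := hCf y.
by rewrite ler_wpDl //; have [] := hCf x.
Qed.

End Bad.

Lemma berr_mono (P P' : rel Zd) S s a :
  (forall x k l, x \in S -> k \in s -> l \in s -> freq l - freq k = x.2 ->
     P k l -> P' k l) ->
  berr S s a P <= berr S s a P'.
Proof.
move=> h; rewrite /berr big_seq [leRHS]big_seq; apply: ler_sum => x xS.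
rewrite big_seq [leRHS]big_seq; apply: ler_sum => k ks.
rewrite big_seq [leRHS]big_seq; apply: ler_sum => l ls.
case: eqP => //= e; case: ifP => [p|_].
  by rewrite (h x k l).
by case: ifP => // _; rewrite !mulr_ge0 ?normc_ge0.
Qed.

Section TileSpan.
Variables (S : seq (R[i] * (int * Zd))) (s : seq Zd) (N o : nat).

Definition active (t : Zd) : pred 'I_(size S) := fun i =>
  has (fun k => has (fun l => [&& tile N o k == t, tile N o l == t
    & freq l - freq k == (nth (0, 0) S i).2]) s) s.

Definition tile_span (t : Zd) : 'M[rat]_d :=
  (\sum_(i < size S | active t i) <<ratv (nth (0, 0) S i).2.2>>)%MS.

Lemma tile_spanP k l x : x \in S -> k \in s -> l \in s -> freq l - freq k = x.2 ->
  tile N o k = tile N o l -> (ratv (l - k) <= tile_span (tile N o k))%MS.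
Proof.
move=> xS ks ls e kl; have ix : (index x S < size S)%N by rewrite index_mem.
have -> : l - k = (nth (0, 0) S (Ordinal ix)).2.2.
  by rewrite /= nth_index // -e.
apply: (sumsmx_sup (Ordinal ix)); last by rewrite genmxE.
apply/hasP; exists k => //; apply/hasP; exists l => //=.
by rewrite kl !eqxx nth_index // e eqxx.
Qed.

Lemma activeP t i : active t i -> exists k l, [/\ k \in s, l \in s,
  tile N o k = t, tile N o l = t & freq l - freq k = (nth (0, 0) S i).2].
Proof. by case/hasP=> k ks /hasP[l ls /and3P[/eqP ? /eqP ? /eqP ?]]; exists k, l. Qed.

Lemma tile_span_sub V t : in_coset V s -> (tile_span t <= V)%MS.
Proof.
move=> cs; apply/sumsmx_subP => i /activeP[k [l [ks ls _ _ e]]].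
by rewrite genmxE -e; exact: cs.
Qed.

Definition band_width : int :=
  \sum_(x <- S) (`|x.2.1| + `|idot x.2.2 x.2.2| + 2 * (N%:Z * (onorm x.2.2)%:Z)).

(** If the shift (tau, m) takes k' to k' + m, then 2 k'.m = -tau - |m|^2; k is in the cube of k', so
    k.m and k'.m differ by at most N |m|_1. *)
Lemma active_near V k i : (0 < N)%N -> in_coset V s -> active (tile N o k) i ->
  near_orth band_width V k i.
Proof.
move=> N0 cs /activeP[k' [l [k's ls tk tl e]]].
set x := nth (0, 0) S i in e *.
have e2 : l = k' + x.2.2 by rewrite -e addrC subrK.
have e1 : x.2.1 = idot k' k' - idot l l by rewrite -e /= opprK addrC.
suff : (ratv x.2.2 <= V)%MS && (`|2 * idot k x.2.2| <= band_width) by [].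
apply/andP; split; first by rewrite -e; exact: cs.
have -> : band_width = (`|x.2.1| + `|idot x.2.2 x.2.2| + 2 * (N%:Z * (onorm x.2.2)%:Z))
   + (band_width - (`|x.2.1| + `|idot x.2.2 x.2.2| + 2 * (N%:Z * (onorm x.2.2)%:Z))).
  by rewrite addrC subrK.
apply: ler_wpDr.
  rewrite subr_ge0 /band_width (big_nth (0, 0)) big_mkord (bigD1 i) //= lerDl sumr_ge0 //.
have := @idot_near _ N%:Z k k' x.2.2 (fun j => @tile_near _ N o k k' j N0 (esym tk)).
move: e1; rewrite e2 !idotE (idotC x.2.2 k'); lia.
Qed.

End TileSpan.

(** Cuts s into pieces to which the induction hypothesis applies or whose points are all bad. S and
    K are chosen before V, s and a; [rank_coercive] relies on this uniformity. *)
Lemma key_step (r : nat) (kappa : R) : 0 < kappa ->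
  (forall V s a, (\rank V < r)%N -> uniq s -> in_coset V s ->
     kappa * mass s a <= Q s a) ->
  exists S K, forall V s a, (\rank V <= r)%N -> uniq s -> in_coset V s ->
    kappa * (\sum_(k <- s | ~~ bad S K V k) normc (a k) ^+ 2)
      <= Q s a + kappa / 4 * mass s a.
Proof.
(* There are three errors of size e * mass: [Q_band] on s, [Q_band] on the pieces, and the severed
   interactions. Together they make kappa / 4 * mass. *)
move=> k0 IH; pose e := kappa / 12.
have e0 : 0 < e by rewrite divr_gt0.
have [S hS] := Q_band e0.
pose A : R := \sum_(x <- S) normc x.1 * (onorm x.2.2)%:R.
have A0 : 0 <= A by rewrite sumr_ge0 // => x _; rewrite mulr_ge0 ?normc_ge0.
(* With N > A / e the average loss A * mass / N is at most e * mass. *)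
pose N := (Num.truncn (A / e)).+1; exists S, (band_width S N) => V s a rV us cs.
have m0 := mass_ge0 s a.
have [ o ho] := @berr_tile R d N s a S isT us.
have {}ho : berr S s a (fun k l => tile N o k != tile N o l) <= e * mass s a.
  rewrite -(@ler_pMn2r _ N) // (le_trans ho) // -mulrnAl ler_wpM2r //.
  rewrite -mulr_natr mulrC -ler_pdivrMr // ltW //; exact: truncnS_gt.
pose W := tile_span S s N o.
(* Cubes are refined into cosets of the span W of the shifts acting in them. This severs nothing
   new: interacting points of a cube differ by an element of W. *)
pose g k := (tile N o k, ratv k *m cokermx (W (tile N o k))).
have hg : berr S s a (fun k l => g k != g l) <= e * mass s a.
  apply: le_trans ho; apply: berr_mono => x k l xS ks ls exkl.
  apply: contra => /eqP tkl; apply/eqP; rewrite /g -tkl; congr (_, _).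
  apply/eqP; rewrite eq_sym -subr_eq0 -mulmxBl -ratvB -submxE.
  exact: (@tile_spanP S s N o k l x).
have : \sum_(c <- undup (map g s)) Q [seq k <- s | g k == c] a
    <= Q s a + 3 * e * mass s a.
  apply: (@le_trans _ _ (\sum_(c <- undup (map g s))
     (band S [seq k <- s | g k == c] a + e * mass [seq k <- s | g k == c] a))).
    apply: ler_sum => c _; rewrite -lerBlDl.
    exact: le_trans (ler_norm _) (hS _ a (filter_uniq _ us)).
  rewrite big_split /= -mulr_sumr mass_split.
  have := band_split g s a S; have := hS s a us; rewrite ler_norml => /andP[h1 _] h2.
  lra.
have -> : 3 * e = kappa / 4 by rewrite /e; field.
apply: le_trans; rewrite big_mkcond /= -(big_label g) mulr_sumr.
apply: ler_sum => -[t v] _; set sc := [seq k <- s | _].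
rewrite -big_filter -/sc.
have usc : uniq sc by exact: filter_uniq.
have cc : in_coset (W t) sc.
  move=> k l; rewrite !mem_filter => /andP[/eqP[tk ek] ks] /andP[/eqP[tl el] ls].
  by rewrite submxE ratvB mulmxBl -{1}tk ek -el tl subrr.
(* Either W t has smaller rank, or it equals V. In the latter case the shifts acting in the cube
   span V, so all points of the piece are bad and the left-hand side is 0. *)
have [rW|rW] := ltnP (\rank (W t)) r.
  apply: le_trans (IH (W t) sc a rW usc cc); rewrite ler_wpM2l ?(ltW k0) //.
  by apply: ler_sum => k _; case: ifP => // _; exact: sqr_ge0.
have WV : (W t <= V)%MS by exact: tile_span_sub.
have VW : (V <= W t)%MS by rewrite -(mxrank_leqif_sup WV) eqn_leq mxrankS //= (leq_trans rV).
rewrite big_seq big1 ?mulr0 // => k; rewrite mem_filter => /andP[/eqP[tk _] ks].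
suff -> : bad S (band_width S N) V k by [].
apply: submx_trans VW _; apply/sumsmx_subP => i ai.
rewrite (sumsmx_sup i) ?submx_refl //; apply: (@active_near S s N o V k i) => //.
by rewrite tk.
Qed.

(** One C has to serve the infinitely many V of each rank. If s has a bad point, V is spanned by
    shifts of S and so is one of the finitely many [Vb b]; otherwise [no_bad] gives the constant 2 /
    kappa. *)
Lemma rank_coercive (r : nat) : exists2 C, 0 <= C &
  forall V s a, (\rank V < r)%N -> uniq s -> in_coset V s -> mass s a <= C * Q s a.
Proof.
elim: r => [|r [C C0 IH]]; first by exists 0.
(* C + 1 instead of C, because C may be 0. *)
pose kappa := (C + 1)^-1.
have k0 : 0 < kappa by rewrite invr_gt0 ltr_wpDl.
have [|S [K key]] := @key_step r kappa k0.
  move=> V s a rV us cs; rewrite mulrC ler_pdivrMr ?ltr_wpDl //.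
  apply: le_trans (IH V s a rV us cs) _; rewrite mulrC ler_wpM2l ?Q_ge0 //.
  by rewrite lerDl.
pose Vb (b : {ffun 'I_(size S) -> bool}) : 'M[rat]_d :=
  (\sum_(i < size S | b i) <<ratv (nth (0, 0) S i).2.2>>)%MS.
have hb b : exists C', 0 <= C' /\ forall s a, (\rank (Vb b) <= r)%N -> uniq s ->
    in_coset (Vb b) s -> mass s a <= C' * Q s a.
  have [rb|rb] := leqP (\rank (Vb b)) r; last by exists 0.
  have [C' C'0 h] := fixed_coercive k0 (fun s a => @key (Vb b) s a rb).
  by exists C'; split => // s a _; exact: h.
have [Cf hCf] := choice hb.
exists (2 / kappa + \sum_b Cf b).
  by rewrite addr_ge0 ?divr_ge0 ?(ltW k0) // sumr_ge0 // => b _; have [] := hCf b.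
move=> V s a; rewrite ltnS => rV us cs; have q0 := Q_ge0 s a.
have S0 : 0 <= \sum_b Cf b by rewrite sumr_ge0 // => b _; have [] := hCf b.
have [/hasP[k ks bk]|nb] := boolP (has (bad S K V) s); last first.
  have h := no_bad (fun s a => @key V s a rV) a us cs nb; rewrite mulrDl.
  apply: (@le_trans _ _ (2 / kappa * Q s a)).
    by rewrite mulrAC ler_pdivlMr // mulrC.
  by rewrite lerDl mulr_ge0.
pose b : {ffun 'I_(size S) -> bool} := [ffun i => near_orth K V k i].
have Vbb : (V <= Vb b)%MS.
  by apply: submx_trans bk _; rewrite /bspan /Vb; under [X in (_ <= X)%MS]eq_bigl do rewrite ffunE.
have bV : (Vb b <= V)%MS.
  by apply/sumsmx_subP => i; rewrite ffunE genmxE => /andP[].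
have [_ /(_ s a)] := hCf b.
rewrite (leq_trans (mxrankS bV) rV) => /(_ isT us) h.
apply: le_trans (h _) _ => [x y xs ys|]; first exact: submx_trans (cs x y xs ys) Vbb.
rewrite ler_wpM2r // ler_wpDl ?divr_ge0 ?(ltW k0) // (bigD1 b) //= lerDl.
by rewrite sumr_ge0 // => c _; have [] := hCf c.
Qed.

Theorem coercive : exists2 C, 0 <= C & forall s a, uniq s -> mass s a <= C * Q s a.
Proof.
have [C C0 h] := rank_coercive d.+1; exists C => // s a us.
by apply: (h 1%:M) => //; rewrite ?ltnS ?rank_leq_row // => k l _ _; exact: submx1.
Qed.

End Coercivity.

Local Open Scope classical_set_scope.
Local Open Scope ring_scope.
Local Open Scope complex_scope.

(** * Bounded functions and complex integrals *)

Section BoundedMeasurable.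
Context {R : realType} {disp : measure_display} {T : measurableType disp}.
Implicit Types (g h : T -> R) (u v : T -> R[i]).

Definition bmfun g := measurable_fun setT g /\ exists B, forall x, `|g x| <= B.

Lemma bmfun_cst c : bmfun (fun=> c).
Proof. by split; [exact: measurable_cst | exists `|c|]. Qed.

Lemma bmfunD g h : bmfun g -> bmfun h -> bmfun (fun x => g x + h x).
Proof.
move=> [mg [B hB]] [mh [C hC]]; split; first exact: measurable_funD.
by exists (B + C) => x; rewrite (le_trans (ler_normD _ _)) // lerD.
Qed.

Lemma bmfunM g h : bmfun g -> bmfun h -> bmfun (fun x => g x * h x).
Proof.
move=> [mg [B hB]] [mh [C hC]]; split; first exact: measurable_funM.
by exists (B * C) => x; rewrite normrM ler_pM.
Qed.

Lemma bmfunN g : bmfun g -> bmfun (fun x => - g x).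
Proof.
move=> [mg [B hB]]; split; first exact: measurable_funN.
by exists B => x; rewrite normrN.
Qed.

Lemma bmfunB g h : bmfun g -> bmfun h -> bmfun (fun x => g x - h x).
Proof. by move=> bg bh; apply: bmfunD => //; exact: bmfunN. Qed.

Lemma bmfun_norm g : bmfun g -> bmfun (fun x => `|g x|).
Proof.
move=> [mg [B hB]]; split; first exact: measurableT_comp.
by exists B => x; rewrite normr_id.
Qed.

Lemma bmfun_indic (A : set T) : measurable A -> bmfun (\1_A : T -> R).
Proof.
move=> mA; split; first exact: measurable_indic.
exists 1 => x; rewrite indicE; case: (_ \in _); rewrite ?normr1 ?normr0 //.
Qed.

Definition bcmfun u := bmfun (@complex.Re R \o u) /\ bmfun (@complex.Im R \o u).

Lemma bcmfun_cst c : bcmfun (fun=> c).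
Proof. by split; exact: bmfun_cst. Qed.

Lemma bcmfun_ext u v : (forall x, u x = v x) -> bcmfun u -> bcmfun v.
Proof. by move=> /funext ->. Qed.

Lemma bmfun_ext g h : (forall x, g x = h x) -> bmfun g -> bmfun h.
Proof. by move=> /funext ->. Qed.

Lemma RecD (z w : R[i]) : @complex.Re R (z + w) = complex.Re z + complex.Re w.
Proof. by case: z w => [a b] [c d]. Qed.

Lemma ImcD (z w : R[i]) : @complex.Im R (z + w) = complex.Im z + complex.Im w.
Proof. by case: z w => [a b] [c d]. Qed.

Lemma RecM (z w : R[i]) :
  @complex.Re R (z * w) = complex.Re z * complex.Re w - complex.Im z * complex.Im w.
Proof. by case: z w => [a b] [c d]. Qed.

Lemma ImcM (z w : R[i]) :
  @complex.Im R (z * w) = complex.Re z * complex.Im w + complex.Im z * complex.Re w.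
Proof. by case: z w => [a b] [c d]. Qed.

Lemma RecJ (z : R[i]) : complex.Re (conjc z) = complex.Re z.
Proof. by case: z. Qed.

Lemma ImcJ (z : R[i]) : complex.Im (conjc z) = - complex.Im z.
Proof. by case: z. Qed.

Lemma Rec_sum (I : Type) (s : seq I) (F : I -> R[i]) :
  @complex.Re R (\sum_(i <- s) F i) = \sum_(i <- s) complex.Re (F i).
Proof. by elim/big_rec2 : _ => // i x y _ <-; rewrite RecD. Qed.

Lemma RecZ (r : R) (z : R[i]) : @complex.Re R (r%:C * z) = r * complex.Re z.
Proof. by rewrite RecM /= mul0r subr0. Qed.

Lemma mulc_conj (z : R[i]) : z * conjc z = (normc z ^+ 2)%:C.
Proof.
rewrite sqr_normcE; case: z => x y; congr Complex => /=; ring.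
Qed.

Lemma bcmfunD u v : bcmfun u -> bcmfun v -> bcmfun (fun x => u x + v x).
Proof.
move=> [ru iu] [rv iv]; split.
  by apply: (bmfun_ext _ (bmfunD ru rv)) => x /=; rewrite RecD.
by apply: (bmfun_ext _ (bmfunD iu iv)) => x /=; rewrite ImcD.
Qed.

Lemma bcmfunM u v : bcmfun u -> bcmfun v -> bcmfun (fun x => u x * v x).
Proof.
move=> [ru iu] [rv iv]; split.
  by apply: (bmfun_ext _ (bmfunB (bmfunM ru rv) (bmfunM iu iv))) => x /=; rewrite RecM.
by apply: (bmfun_ext _ (bmfunD (bmfunM ru iv) (bmfunM iu rv))) => x /=; rewrite ImcM.
Qed.

Lemma bcmfunJ u : bcmfun u -> bcmfun (fun x => conjc (u x)).
Proof.
move=> [ru iu]; split; first by apply: (bmfun_ext _ ru) => x /=; rewrite RecJ.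
by apply: (bmfun_ext _ (bmfunN iu)) => x /=; rewrite ImcJ.
Qed.

Lemma bcmfun_real g : bmfun g -> bcmfun (fun x => (g x)%:C).
Proof. by move=> bg; split => //=; exact: bmfun_cst. Qed.

Lemma bcmfun_sum (I : Type) (s : seq I) (F : I -> T -> R[i]) :
  (forall i, bcmfun (F i)) -> bcmfun (fun x => \sum_(i <- s) F i x).
Proof.
move=> h; elim: s => [|i s IH].
  by apply: (bcmfun_ext _ (bcmfun_cst 0)) => x; rewrite big_nil.
by apply: (bcmfun_ext _ (bcmfunD (h i) IH)) => x; rewrite big_cons.
Qed.

Lemma bmfun_sqrnormc u : bcmfun u -> bmfun (fun x => normc (u x) ^+ 2).
Proof.
move=> [ru iu]; apply: (bmfun_ext _ (bmfunD (bmfunM ru ru) (bmfunM iu iu))) => x /=.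
by rewrite sqr_normcE !expr2.
Qed.

End BoundedMeasurable.

Section Integral.
Context {R : realType} {disp : measure_display} {T : measurableType disp}.
Variables (mu : {measure set T -> \bar R}) (D : set T).
Hypothesis mD : measurable D.
Implicit Types (g h : T -> R) (u v : T -> R[i]).

Definition rintegrable g := mu.-integrable D (EFin \o g).
Definition cintegrable u :=
  rintegrable (@complex.Re R \o u) /\ rintegrable (@complex.Im R \o u).

Lemma rintegrableD g h : rintegrable g -> rintegrable h ->
  rintegrable (fun x => g x + h x).
Proof. by move=> ig ih; exact: (@integrableD _ _ _ mu D mD _ _ ig ih). Qed.

Lemma rintegrableZ c g : rintegrable g -> rintegrable (fun x => c * g x).
Proof. by move=> ig; exact: (@integrableZl _ _ _ mu D mD c _ ig). Qed.

Lemma rintegrableN g : rintegrable g -> rintegrable (fun x => - g x).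
Proof. by move=> ig; exact: (@integrableN _ _ _ mu D _ ig). Qed.

Lemma rintegrable_norm g : rintegrable g -> rintegrable (fun x => `|g x|).
Proof. by move=> ig; exact: (@integrable_norm _ _ _ mu D _ ig). Qed.

Lemma rintegrableM g h : rintegrable g -> bmfun h -> rintegrable (fun x => g x * h x).
Proof.
move=> ig [mh [B hB]].
have := @integrableMr _ _ _ mu D mD h (EFin \o g).
move=> /(_ (measurable_funTS mh)).
have -> : ((EFin \o h) \* (EFin \o g))%E = EFin \o (fun x => g x * h x).
  by apply/funext => x /=; rewrite -EFinM mulrC.
apply => //; exists B; split; first exact: num_real.
by move=> C BC x _; exact: le_trans (hB x) (ltW BC).
Qed.

Lemma cintegrableD u v : cintegrable u -> cintegrable v ->
  cintegrable (fun x => u x + v x).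
Proof.
move=> [ru iu] [rv iv]; split; rewrite /rintegrable.
  by have := rintegrableD ru rv; congr integrable; apply/funext => x /=; rewrite RecD.
by have := rintegrableD iu iv; congr integrable; apply/funext => x /=; rewrite ImcD.
Qed.

Lemma cintegrableM u v : cintegrable u -> bcmfun v -> cintegrable (fun x => u x * v x).
Proof.
move=> [ru iu] [rv iv]; split; rewrite /rintegrable.
  have := rintegrableD (rintegrableM ru rv) (rintegrableN (rintegrableM iu iv)).
  by congr integrable; apply/funext => x /=; rewrite RecM.
have := rintegrableD (rintegrableM ru iv) (rintegrableM iu rv).
by congr integrable; apply/funext => x /=; rewrite ImcM.
Qed.

Lemma cintegrableZ c u : cintegrable u -> cintegrable (fun x => c * u x).
Proof.
move=> iu; have := cintegrableM iu (bcmfun_cst c).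
by congr cintegrable; apply/funext => x; rewrite mulrC.
Qed.

Lemma cintegrable_real g : rintegrable g -> cintegrable (fun x => (g x)%:C).
Proof.
move=> ig; split => //; have := rintegrableZ 0 ig.
by congr integrable; apply/funext => x /=; rewrite mul0r.
Qed.

Lemma cintegrable_sum (I : Type) (s : seq I) (F : I -> T -> R[i]) :
  (forall i, cintegrable (F i)) -> cintegrable (fun x => \sum_(i <- s) F i x).
Proof.
move=> h; elim: s => [|i s IH].
  have i0 : rintegrable (fun=> 0) by exact: integrable0.
  have := cintegrable_real i0.
  by congr cintegrable; apply/funext => x; rewrite big_nil.
by have := cintegrableD (h i) IH; congr cintegrable; apply/funext => x; rewrite big_cons.
Qed.

Local Notation "'cI' u" := (cintegral mu D u) (at level 10, u at level 8).

Lemma eq_cintegral u v : (forall x, D x -> u x = v x) -> cI u = cI v.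
Proof.
by move=> h; congr Complex; apply: eq_Rintegral => x /[!inE] /h ->.
Qed.

Lemma cintegralD u v : cintegrable u -> cintegrable v ->
  cI (fun x => u x + v x) = cI u + cI v.
Proof.
move=> [ru iu] [rv iv]; congr Complex => /=.
  by rewrite -(RintegralD mD ru rv); apply: eq_Rintegral => x _; rewrite RecD.
by rewrite -(RintegralD mD iu iv); apply: eq_Rintegral => x _; rewrite ImcD.
Qed.

Lemma cintegralZ c u : cintegrable u -> cI (fun x => c * u x) = c * cI u.
Proof.
move=> [ru iu]; case: c => a b; congr Complex => /=.
  rewrite -(RintegralZl a mD ru) -(RintegralZl b mD iu) -RintegralB //.
  - by apply: eq_Rintegral => x _; rewrite RecM.
  - exact: rintegrableZ.
  - exact: rintegrableZ.
rewrite -(RintegralZl a mD iu) -(RintegralZl b mD ru) -RintegralD //.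
- by apply: eq_Rintegral => x _; rewrite ImcM.
- exact: rintegrableZ.
- exact: rintegrableZ.
Qed.

Lemma cintegral0 : cI (fun=> 0) = 0.
Proof. by congr Complex; rewrite Rintegral_cst // mul0r. Qed.

Lemma cintegral_sum (I : Type) (s : seq I) (F : I -> T -> R[i]) :
  (forall i, cintegrable (F i)) ->
  cI (fun x => \sum_(i <- s) F i x) = \sum_(i <- s) cI (F i).
Proof.
move=> h; elim: s => [|i s IH].
  rewrite big_nil -[RHS]cintegral0.
  by apply: eq_cintegral => x _; rewrite big_nil.
rewrite big_cons -IH -cintegralD //; last exact: cintegrable_sum.
by apply: eq_cintegral => x _; rewrite big_cons.
Qed.

Lemma cintegralJ u : cintegrable u -> cI (fun x => conjc (u x)) = conjc (cI u).
Proof.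
move=> [ru iu]; congr Complex => /=.
  by apply: eq_Rintegral => x _; rewrite RecJ.
rewrite -mulN1r -RintegralZl //; apply: eq_Rintegral => x _.
by rewrite ImcJ mulN1r.
Qed.

Lemma cintegral_real g : cI (fun x => (g x)%:C) = (\int[mu]_(x in D) g x)%:C.
Proof. by congr Complex; rewrite /= Rintegral_cst // mul0r. Qed.

Hypothesis muD : (mu D < +oo)%E.

Lemma bmfun_rintegrable g : bmfun g -> rintegrable g.
Proof.
move=> [mg [B hB]]; apply: measurable_bounded_integrable => //.
  exact: measurable_funTS.
exists B; split; first exact: num_real.
by move=> C BC x _; exact: le_trans (hB x) (ltW BC).
Qed.

Lemma bcmfun_cintegrable u : bcmfun u -> cintegrable u.
Proof. by move=> [ru iu]; split; exact: bmfun_rintegrable. Qed.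

End Integral.

(** * Density of trigonometric polynomials *)

Section Smoothstep.
Context {R : realType}.

(** A polynomial map of [0, 1] into itself fixing 0, 1/2 and 1, of which 0 and 1 attract. Its
    iterates sharpen a trigonometric polynomial into the indicator of a level set and remain
    trigonometric polynomials. *)
Definition smoothstep (y : R) : R := 3 * y ^+ 2 - 2 * y ^+ 3.

Lemma smoothstep_itv y : 0 <= y <= 1 -> 0 <= smoothstep y <= 1.
Proof.
move=> /andP[y0 y1]; rewrite /smoothstep; apply/andP; split.
  have -> : 3 * y ^+ 2 - 2 * y ^+ 3 = y ^+ 2 * (3 - 2 * y) by ring.
  by rewrite mulr_ge0 ?sqr_ge0 //; lra.
rewrite -subr_ge0.
have -> : 1 - (3 * y ^+ 2 - 2 * y ^+ 3) = (1 - y) ^+ 2 * (1 + 2 * y) by ring.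
by rewrite mulr_ge0 ?sqr_ge0 //; lra.
Qed.

Lemma iter_smoothstep_itv n y : 0 <= y <= 1 -> 0 <= iter n smoothstep y <= 1.
Proof. by move=> h; elim: n => //= n IH; exact: smoothstep_itv. Qed.

Lemma iter_smoothstep_sym n y : iter n smoothstep (1 - y) = 1 - iter n smoothstep y.
Proof. by elim: n => //= n ->; rewrite /smoothstep; ring. Qed.

(** The image of z is z (3 - 2 z) times z; the factor z (3 - 2 z) increases on [0, 1/2) and stays
    below 1, so the iterates decay geometrically. *)
Lemma iter_smoothstep_lt n y : 0 <= y -> y < 2^-1 ->
  0 <= iter n smoothstep y <= (y * (3 - 2 * y)) ^+ n * y.
Proof.
move=> y0 y1; have r1 : y * (3 - 2 * y) <= 1 by nra.
have r0 : 0 <= y * (3 - 2 * y) by nra.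
elim: n => [|n /andP[z0 zn]] /=; first by rewrite expr0 mul1r y0 lexx.
set z := iter n smoothstep y in z0 zn *.
have zy : z <= y by rewrite (le_trans zn) // ler_piMl // exprn_ile1.
have -> : smoothstep z = (z * (3 - 2 * z)) * z by rewrite /smoothstep; ring.
apply/andP; split; first by rewrite !mulr_ge0 //; lra.
rewrite exprS -[leRHS]mulrA.
have h1 : 0 <= z * (3 - 2 * z) by rewrite mulr_ge0 //; lra.
have h2 : z * (3 - 2 * z) <= y * (3 - 2 * y).
  rewrite -subr_ge0.
  have -> : y * (3 - 2 * y) - z * (3 - 2 * z) = (y - z) * (3 - 2 * (y + z)) by ring.
  by rewrite mulr_ge0 //; lra.
exact: ler_pM.
Qed.

Lemma cvg_smoothstep_lt y : 0 <= y -> y < 2^-1 ->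
  iter n smoothstep y @[n --> \oo] --> (0 : R).
Proof.
move=> y0 y1; apply: (@squeeze_cvgr _ _ _ _ (fun=> 0)
   (fun n => (y * (3 - 2 * y)) ^+ n * y)).
- by apply: nearW => n; exact: iter_smoothstep_lt.
- exact: cvg_cst.
rewrite -[X in _ --> X](mul0r y); apply: cvgMl; apply: cvg_expr.
by rewrite ger0_norm; nra.
Qed.

Lemma cvg_smoothstep_gt y : 2^-1 < y -> y <= 1 ->
  iter n smoothstep y @[n --> \oo] --> (1 : R).
Proof.
move=> y1 y2; have -> : (fun n => iter n smoothstep y) =
    (fun n => 1 - iter n smoothstep (1 - y)).
  by apply/funext => n; rewrite iter_smoothstep_sym opprB addrC subrK.
rewrite -[X in _ --> X](subr0 1); apply: cvgB; first exact: cvg_cst.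
by apply: cvg_smoothstep_lt; lra.
Qed.

Lemma iter_smoothstep_half n : iter n smoothstep 2^-1 = 2^-1.
Proof. by elim: n => //= n ->; rewrite /smoothstep; field. Qed.

End Smoothstep.

Section BoundedConvergence.
Context {R : realType} {disp : measure_display} {T : measurableType disp}.
Variables (mu : {measure set T -> \bar R}) (D : set T).
Hypothesis mD : measurable D.
Hypothesis muD : (mu D < +oo)%E.

Lemma bounded_cvg0 (h : nat -> T -> R) (C : R) :
  (forall n, measurable_fun setT (h n)) -> (forall n x, `|h n x| <= C) ->
  (forall x, D x -> h n x @[n --> \oo] --> (0 : R)) ->
  forall e, 0 < e -> exists n, \int[mu]_(x in D) `|h n x| <= e.
Proof.
move=> mh hC h0 e e0.
have bmh n : bmfun (h n) by split => //; exists C.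
have cv : (\int[mu]_(x in D) (`|h n x|)%:E)%E @[n --> \oo] -->
    (\int[mu]_(x in D) (cst 0 x))%E.
  apply: (@dominated_cvg _ _ _ mu D mD _ _ (cst C%:E)) => //.
  - by move=> n; apply/measurable_EFinP; apply: measurable_funTS; exact: measurableT_comp.
  - move=> x Dx; apply: cvg_EFin; first exact: nearW.
    by rewrite /= -[X in _ --> X](@normr0 _ R); apply: cvg_norm; exact: h0.
  - by have := bmfun_rintegrable mD muD (bmfun_cst C).
  - by move=> n x _; rewrite /= lee_fin normr_id.
rewrite integral0 in cv.
have /cvgr0Pnorm_le /(_ e e0) [N _ hN] := fine_cvg (FF := eventually_filter) cv.
exists N; apply: le_trans (hN N (leqnn _)); exact: ler_norm.
Qed.

End BoundedConvergence.

(** Treats the characters of T^d and those of space-time at once: Gm is the group of frequencies and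
    M the volume of the fundamental domain. *)
Record trig_system (R : realType) (disp : measure_display) (T : measurableType disp)
    (mu : {measure set T -> \bar R}) (D : set T) (Gm : zmodType)
    (e : Gm -> T -> R[i]) (M : R) : Prop := TrigSystem {
  ts_mD : measurable D;
  ts_muD : mu D = M%:E;
  ts_M : 0 < M;
  ts_0 : forall x, e 0 x = 1;
  ts_D : forall s t x, e (s + t) x = e s x * e t x;
  ts_N : forall s x, e (- s) x = conjc (e s x);
  ts_b : forall s, bcmfun (e s);
  ts_I : forall s, s != 0 -> cintegral mu D (e s) = 0
}.

Section TrigPoly.
Context {R : realType} {disp : measure_display} {T : measurableType disp}.
Variables (mu : {measure set T -> \bar R}) (D : set T) (Gm : zmodType)
  (e : Gm -> T -> R[i]) (M : R).
Hypothesis ts : trig_system mu D e M.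
Let mD := ts_mD ts.

Let muD : (mu D < +oo)%E.
Proof. by rewrite (ts_muD ts) ltry. Qed.

Definition tp (c : seq (R[i] * Gm)) (x : T) : R[i] := \sum_(p <- c) p.1 * e p.2 x.
Definition trig (u : T -> R[i]) := exists c, forall x, u x = tp c x.
Definition rtrig (g : T -> R) := trig (fun x => (g x)%:C).

Lemma trig_ext u v : (forall x, u x = v x) -> trig u -> trig v.
Proof. by move=> /funext ->. Qed.

Lemma trig_cst c : trig (fun=> c).
Proof. by exists [:: (c, 0)] => x; rewrite /tp big_seq1 /= (ts_0 ts) mulr1. Qed.

Lemma trig_e s : trig (e s).
Proof. by exists [:: (1, s)] => x; rewrite /tp big_seq1 mul1r. Qed.

Lemma trigD u v : trig u -> trig v -> trig (fun x => u x + v x).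
Proof.
move=> [c hc] [c' hc']; exists (c ++ c') => x.
by rewrite /tp big_cat -/(tp c x) -/(tp c' x) hc hc'.
Qed.

Lemma trigM u v : trig u -> trig v -> trig (fun x => u x * v x).
Proof.
move=> [c hc] [c' hc'].
exists [seq (p.1 * q.1, p.2 + q.2) | p <- c, q <- c'] => x.
rewrite hc hc' /tp big_allpairs_dep /= mulr_suml; apply: eq_bigr => p _.
rewrite mulr_sumr; apply: eq_bigr => q _; rewrite (ts_D ts); ring.
Qed.

Lemma trigZ c u : trig u -> trig (fun x => c * u x).
Proof. by move=> tu; apply: trigM => //; exact: trig_cst. Qed.

Lemma trigJ u : trig u -> trig (fun x => conjc (u x)).
Proof.
move=> [c hc]; exists [seq (conjc p.1, - p.2) | p <- c] => x.
rewrite hc /tp big_map rmorph_sum; apply: eq_bigr => p _.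
by rewrite rmorphM (ts_N ts).
Qed.

Lemma trig_sum (I : Type) (s : seq I) (F : I -> T -> R[i]) :
  (forall i, trig (F i)) -> trig (fun x => \sum_(i <- s) F i x).
Proof.
move=> h; elim: s => [|i s IH].
  by apply: (trig_ext _ (trig_cst 0)) => x; rewrite big_nil.
by apply: (trig_ext _ (trigD (h i) IH)) => x; rewrite big_cons.
Qed.

Lemma trig_prod (I : Type) (s : seq I) (F : I -> T -> R[i]) :
  (forall i, trig (F i)) -> trig (fun x => \prod_(i <- s) F i x).
Proof.
move=> h; elim: s => [|i s IH].
  by apply: (trig_ext _ (trig_cst 1)) => x; rewrite big_nil.
by apply: (trig_ext _ (trigM (h i) IH)) => x; rewrite big_cons.
Qed.

Lemma trig_bcmfun u : trig u -> bcmfun u.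
Proof.
move=> [c hc]; apply: (@bcmfun_ext _ _ _ (tp c)) => [x|]; first by rewrite hc.
apply: bcmfun_sum => p; apply: bcmfunM; [exact: bcmfun_cst|exact: (ts_b ts)].
Qed.

Lemma rtrig_cst c : rtrig (fun=> c).
Proof. exact: trig_cst. Qed.

Lemma rtrigD g h : rtrig g -> rtrig h -> rtrig (fun x => g x + h x).
Proof.
move=> tg th; apply: (trig_ext _ (trigD tg th)) => x.
by rewrite -rmorphD.
Qed.

Lemma rtrigM g h : rtrig g -> rtrig h -> rtrig (fun x => g x * h x).
Proof.
move=> tg th; apply: (trig_ext _ (trigM tg th)) => x.
by rewrite -rmorphM.
Qed.

Lemma rtrigB g h : rtrig g -> rtrig h -> rtrig (fun x => g x - h x).
Proof.
move=> tg th; apply: (trig_ext _ (trigD tg (trigZ (-1) th))) => x.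
by rewrite mulN1r -rmorphB.
Qed.

Lemma rtrig_Re u : trig u -> rtrig (fun x => complex.Re (u x)).
Proof.
move=> tu; apply: (trig_ext _ (trigZ 2^-1 (trigD tu (trigJ tu)))) => x.
by rewrite addcJ mulrA mulVf ?mul1r.
Qed.

Lemma rtrig_bmfun g : rtrig g -> bmfun g.
Proof. by move=> /trig_bcmfun []. Qed.

Lemma rtrig_smoothstep n g : rtrig g -> rtrig (fun x => iter n smoothstep (g x)).
Proof.
move=> tg; elim: n => //= n IH.
have t2 := rtrigM IH IH; have t3 := rtrigM IH t2.
apply: (trig_ext _ (rtrigB (rtrigM (rtrig_cst 3) t2) (rtrigM (rtrig_cst 2) t3))) => x.
by rewrite /smoothstep !exprS expr0 !mulr1.
Qed.

Definition unit_fun (g : T -> R) := forall x, 0 <= g x <= 1.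
(** Keeping psi in [0, 1] makes L^1 closeness stable under products ([good_mul]) and sufficient for
    L^2 closeness ([L2approx_indic]). *)
Definition approximable (g : T -> R) := forall eps, 0 < eps ->
  exists psi, [/\ rtrig psi, unit_fun psi & \int[mu]_(x in D) `|psi x - g x| <= eps].

(* Measurable functions into [0, 1] that are L^1-limits of trigonometric
   polynomials with values in [0, 1]; being stable under products, complement
   and bounded pointwise limits, the indicators among them form a sigma-algebra. *)
Definition good (g : T -> R) :=
  [/\ measurable_fun setT g, unit_fun g & approximable g].

Lemma good_bmfun g : good g -> bmfun g.
Proof.
move=> [mg ug _]; split => //; exists 1 => x.
by have /andP[g0 g1] := ug x; rewrite ger0_norm.
Qed.

Let intb g : bmfun g -> rintegrable mu D g := bmfun_rintegrable mD muD (g := g).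

Lemma good_rtrig g : rtrig g -> unit_fun g -> good g.
Proof.
move=> tg ug; split => //; first by have [] := rtrig_bmfun tg.
move=> eps eps0; exists g; split => //.
rewrite (@eq_Rintegral _ _ _ mu D (fun=> 0)) ?Rintegral_cst ?mul0r ?ltW // => x _.
by rewrite subrr normr0.
Qed.

Lemma good_compl g : good g -> good (fun x => 1 - g x).
Proof.
move=> gg; have [mg ug ag] := gg; split.
- by have [] := bmfunB (bmfun_cst 1) (good_bmfun gg).
- by move=> x; have := ug x; lra.
move=> eps eps0; have [psi [tp_ up ip]] := ag eps eps0.
exists (fun x => 1 - psi x); split.
- by apply: rtrigB => //; exact: rtrig_cst.
- by move=> x; have := up x; lra.
rewrite (@eq_Rintegral _ _ _ mu D (fun x => `|psi x - g x|)) // => x _.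
by rewrite -normrN; congr (`|_|); ring.
Qed.

Lemma good_mul g h : good g -> good h -> good (fun x => g x * h x).
Proof.
move=> gg gh; have [mg ug ag] := gg; have [mh uh ah] := gh; split.
- by have [] := bmfunM (good_bmfun gg) (good_bmfun gh).
- by move=> x; have /andP[? ?] := ug x; have /andP[? ?] := uh x; rewrite mulr_ge0 // mulr_ile1.
move=> eps eps0; have e2 : 0 < eps / 2 by rewrite divr_gt0.
have [p [tp_ up ip]] := ag _ e2; have [q [tq uq iq]] := ah _ e2.
exists (fun x => p x * q x); split; first exact: rtrigM.
  by move=> x; have /andP[? ?] := up x; have /andP[? ?] := uq x; rewrite mulr_ge0 // mulr_ile1.
have bp := rtrig_bmfun tp_; have bq := rtrig_bmfun tq.
have bg := good_bmfun gg; have bh := good_bmfun gh.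
apply: (@le_trans _ _ (\int[mu]_(x in D) (`|p x - g x| + `|q x - h x|))); last first.
  rewrite RintegralD //; first by rewrite [leRHS](splitr eps) lerD.
  - exact/intb/bmfun_norm/bmfunB.
  - exact/intb/bmfun_norm/bmfunB.
apply: le_Rintegral => //.
- by apply/intb/bmfun_norm/bmfunB; exact: bmfunM.
- by apply: intb; apply: bmfunD; apply/bmfun_norm/bmfunB.
move=> x _; have -> : p x * q x - g x * h x = (p x - g x) * q x + g x * (q x - h x) by ring.
rewrite (le_trans (ler_normD _ _)) // !normrM lerD //.
  by rewrite ler_piMr //; have /andP[? ?] := uq x; rewrite ger0_norm.
by rewrite ler_piMl //; have /andP[? ?] := ug x; rewrite ger0_norm.
Qed.

Lemma good_exp g n : good g -> good (fun x => g x ^+ n).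
Proof.
move=> gg; elim: n => [|n IH].
  apply: good_rtrig => [|x]; first exact: rtrig_cst.
  by rewrite expr0 ler01 lexx.
by have := good_mul gg IH; congr good; apply/funext => x; rewrite exprS.
Qed.

Lemma good_lim (h : nat -> T -> R) g : (forall n, good (h n)) ->
  (forall x, h n x @[n --> \oo] --> g x) -> good g.
Proof.
move=> gh cv.
have mg : measurable_fun setT g.
  by apply: (measurable_fun_cvg (h := h)) => [m|x _] //; have [] := gh m.
have ug : unit_fun g.
  have cvx x : cvgn (h ^~ x) by apply/cvg_ex; exists (g x).
  move=> x; rewrite -(cvg_lim (@Rhausdorff R) (cv x)); apply/andP; split.
    by apply: limr_ge => //; apply: nearW => n; have [_ /(_ x)/andP[]] := gh n.
  by apply: limr_le => //; apply: nearW => n; have [_ /(_ x)/andP[]] := gh n.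
split => // eps eps0; have e2 : 0 < eps / 2 by rewrite divr_gt0.
have bg : bmfun g.
  by split => //; exists 1 => x; have /andP[? ?] := ug x; rewrite ger0_norm.
have hC n x : `|h n x - g x| <= 1.
  have [_ /(_ x) /andP[? ?] _] := gh n; have /andP[? ?] := ug x.
  by rewrite ler_norml; lra.
have h0 x : D x -> h n x - g x @[n --> \oo] --> (0 : R).
  by move=> _; rewrite -[X in _ --> X](subrr (g x)); apply: cvgB; [exact: cv|exact: cvg_cst].
have mhg n : measurable_fun setT (fun x => h n x - g x).
  by have [] := bmfunB (good_bmfun (gh n)) bg.
have [n hn] := bounded_cvg0 mD muD mhg hC h0 e2.
have [_ _ /(_ _ e2) [psi [tpsi upsi ipsi]]] := gh n.
exists psi; split => //.
have bpsi := rtrig_bmfun tpsi; have bh := good_bmfun (gh n).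
apply: (@le_trans _ _ (\int[mu]_(x in D) (`|psi x - h n x| + `|h n x - g x|))); last first.
  rewrite RintegralD //; first by rewrite [leRHS](splitr eps) lerD.
  - exact/intb/bmfun_norm/bmfunB.
  - exact/intb/bmfun_norm/bmfunB.
apply: le_Rintegral => //.
- exact/intb/bmfun_norm/bmfunB.
- by apply: intb; apply: bmfunD; apply/bmfun_norm/bmfunB.
by move=> x _; exact: ler_distD.
Qed.

(** An affine map sends g into [0, 1] and r to 1/2. The iterated smoothsteps converge to l, equal to
    0, 1/2 or 1 as g is below, at or above r; the powers of l then send the value 1/2 to 0 too. *)
Lemma good_indic_gt (g : T -> R) r : rtrig g -> good (\1_[set x | r < g x]).
Proof.
move=> tg; have [mg [B hB]] := rtrig_bmfun tg.
pose C := `|B| + `|r| + 1.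
have C0 : 0 < C by rewrite ltr_wpDl ?addr_ge0.
pose y x := 2^-1 + (g x - r) / (2 * C).
have ty : rtrig y.
  apply: rtrigD; first exact: rtrig_cst.
  apply: rtrigM; last exact: rtrig_cst.
  by apply: rtrigB => //; exact: rtrig_cst.
have uy : unit_fun y.
  move=> x; have h : `|g x - r| <= C.
    rewrite (le_trans (ler_normB _ _)) // /C -addrA lerD ?(le_trans (hB x)) ?ler_norm // lerDl //.
  have : `|(g x - r) / (2 * C)| <= 2^-1.
    rewrite normrM normfV (ger0_norm (ltW _ : 0 <= 2 * C)) ?mulr_gt0 //.
    by rewrite ler_pdivrMr ?mulr_gt0 // mulrA mulVf ?mul1r.
  by rewrite ler_norml /y; lra.
pose l x : R := if y x < 2^-1 then 0 else if 2^-1 < y x then 1 else 2^-1.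
have gl : good l.
  apply: (@good_lim (fun n x => iter n smoothstep (y x))) => [n|x].
    apply: good_rtrig; first exact: rtrig_smoothstep.
    by move=> x; exact: iter_smoothstep_itv.
  rewrite /l; have /andP[y0 y1] := uy x.
  have [lt1|gt1|->] := ltgtP (y x) 2^-1.
  - exact: cvg_smoothstep_lt.
  - exact: cvg_smoothstep_gt.
  - under eq_fun do rewrite iter_smoothstep_half; exact: cvg_cst.
apply: (@good_lim (fun n x => l x ^+ n)) => [n|x]; first exact: good_exp.
rewrite indicE; have -> : (x \in [set x | r < g x]) = (r < g x).
  by apply/idP/idP; rewrite inE.
have -> : (r < g x) = (2^-1 < y x).
  by rewrite /y ltrDl pmulr_lgt0 ?subr_gt0 // invr_gt0 mulr_gt0.
rewrite /l; have [lt1|gt1|_] := ltgtP (y x) 2^-1.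
- by apply: cvg_expr; rewrite normr0.
- by under eq_fun do rewrite expr1n; exact: cvg_cst.
- by apply: cvg_expr; rewrite ger0_norm //; lra.
Qed.

Definition good_set (B : set T) := good (\1_B).

Lemma good_set0 : good_set set0.
Proof.
rewrite /good_set indic0; apply: good_rtrig => [|x]; first exact: rtrig_cst.
by rewrite /= lexx ler01.
Qed.

Lemma good_setC B : good_set B -> good_set (~` B).
Proof.
move=> /good_compl; congr good; apply/funext => x; rewrite !indicE in_setC.
by case: (x \in B); rewrite ?subrr ?subr0.
Qed.

Lemma good_setI A B : good_set A -> good_set B -> good_set (A `&` B).
Proof.
move=> gA gB; have := good_mul gA gB; congr good; apply/funext => x.
by rewrite indicI.
Qed.

Lemma good_bigcup (F : nat -> set T) : (forall n, good_set (F n)) ->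
  good_set (\bigcup_n F n).
Proof.
move=> gF; pose G n := \big[setI/setT]_(i < n) ~` F i.
have gG n : good_set (G n).
  rewrite /G; elim: n => [|n IH].
    by rewrite big_ord0 -setC0; apply: good_setC; exact: good_set0.
  by rewrite big_ord_recr; apply: good_setI => //; exact: good_setC.
apply: (@good_lim (fun n => \1_(~` G n))) => [n|x]; first exact: good_setC.
apply: cvg_near_cst.
have GE n : (\1_(~` G n) x : R) = (~~ [forall i : 'I_n, x \notin F i])%:R.
  rewrite indicE in_setC; congr (~~ _)%:R; rewrite /G.
  apply/idP/forallP => [|h].
    rewrite inE => Gx i; apply/negP; rewrite inE => Fx.
    by move: Gx; rewrite (bigD1 i) //= => -[].
  by apply: (big_ind (fun A : set T => x \in A)) => [|A B|i _]; rewrite ?in_setI ?in_setC //;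
    [rewrite inE|move=> -> ->].
have [[k _ Fk]|nF] := pselect ((\bigcup_n F n) x); last first.
  apply: nearW => n; rewrite GE indicE memNset //.
  suff -> : [forall i : 'I_n, x \notin F i] by [].
  by apply/forallP => i; apply/negP; rewrite inE => Fx; apply: nF; exists i.
exists k.+1 => // n /= kn; rewrite GE indicE mem_set; last by exists k.
suff -> : [forall i : 'I_n, x \notin F i] = false by [].
by apply/negP => /forallP /(_ (Ordinal kn)) /=; rewrite mem_set.
Qed.

End TrigPoly.

(** * From indicators to density in L^2 *)

Section SquareDistance.
Context {R : realType} {disp : measure_display} {T : measurableType disp}.
Variables (mu : {measure set T -> \bar R}) (D : set T).
Hypothesis mD : measurable D.
Implicit Types f g h : T -> R.

Definition sqdist f g : \bar R := (\int[mu]_(x in D) ((f x - g x) ^+ 2)%:E)%E.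

Let msq f g : measurable_fun setT f -> measurable_fun setT g ->
  measurable_fun D (fun x => ((f x - g x) ^+ 2)%:E).
Proof.
move=> mf mg; apply/measurable_EFinP; apply: measurable_funTS.
by apply: measurable_funX; exact: measurable_funB.
Qed.

Lemma sqdist_tri f g h : measurable_fun setT f -> measurable_fun setT g ->
  measurable_fun setT h -> (sqdist f h <= 2%:E * (sqdist f g + sqdist g h))%E.
Proof.
move=> mf mg mh; rewrite -ge0_integralD //; last 4 first.
- by move=> x _; rewrite lee_fin sqr_ge0.
- exact: msq.
- by move=> x _; rewrite lee_fin sqr_ge0.
- exact: msq.
rewrite -ge0_integralZl //; last 2 first.
- by apply: emeasurable_funD; exact: msq.
- by move=> x _; rewrite -EFinD lee_fin addr_ge0 // sqr_ge0.
apply: ge0_le_integral => //.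
- by move=> x _; rewrite lee_fin sqr_ge0.
- exact: msq.
- by apply: measurable_funeM; apply: emeasurable_funD; exact: msq.
move=> x _; rewrite -EFinD -EFinM lee_fin -subr_ge0.
have -> : 2 * ((f x - g x) ^+ 2 + (g x - h x) ^+ 2) - (f x - h x) ^+ 2 =
  (f x - g x - (g x - h x)) ^+ 2 by ring.
exact: sqr_ge0.
Qed.

Lemma sqdistZ c f g : measurable_fun setT f -> measurable_fun setT g ->
  sqdist (fun x => c * f x) (fun x => c * g x) = ((c ^+ 2)%:E * sqdist f g)%E.
Proof.
move=> mf mg; rewrite -ge0_integralZl //; last 3 first.
- exact: msq.
- by move=> x _; rewrite lee_fin sqr_ge0.
- by rewrite lee_fin sqr_ge0.
by apply: eq_integral => x _; rewrite -EFinM -mulrBr exprMn.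
Qed.

End SquareDistance.

Section L2Density.
Context {R : realType} {disp : measure_display} {T : measurableType disp}.
Variables (mu : {measure set T -> \bar R}) (D : set T) (Gm : zmodType)
  (e : Gm -> T -> R[i]) (M : R).
Hypothesis ts : trig_system mu D e M.
Hypothesis dens : forall A, measurable A -> approximable mu D e (\1_A).
Let mD := ts_mD ts.
Let muD : (mu D < +oo)%E.
Proof. by rewrite (ts_muD ts) ltry. Qed.
Implicit Types f g h : T -> R.
Local Notation sqd := (sqdist mu D).

Definition L2approx g := measurable_fun setT g /\ forall eps : R, 0 < eps ->
  exists P, rtrig e P /\ (sqd g P <= eps%:E)%E.

Let mrt P : rtrig e P -> measurable_fun setT P.
Proof. by move=> /(rtrig_bmfun ts)[]. Qed.

Lemma L2approx_lim g : measurable_fun setT g ->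
  (forall eps : R, 0 < eps -> exists h, L2approx h /\ (sqd g h <= eps%:E)%E) ->
  L2approx g.
Proof.
move=> mg hg; split => // eps eps0.
have e4 : 0 < eps / 4 by rewrite divr_gt0.
have [h [[mh ah] gh]] := hg _ e4; have [P [tP hP]] := ah _ e4.
exists P; split => //; apply: le_trans (sqdist_tri mu mD mg mh (mrt tP)) _.
have -> : eps%:E = (2%:E * ((eps / 4)%:E + (eps / 4)%:E))%E.
  by rewrite -EFinD -EFinM; congr EFin; field.
by rewrite lee_pmul2l // leeD.
Qed.

Lemma L2approxD f g : L2approx f -> L2approx g -> L2approx (fun x => f x + g x).
Proof.
move=> [mf af] [mg ag]; split => [|eps eps0]; first exact: measurable_funD.
have e4 : 0 < eps / 4 by rewrite divr_gt0.
have [P [tP hP]] := af _ e4; have [Q [tQ hQ]] := ag _ e4.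
exists (fun x => P x + Q x); split; first exact: rtrigD.
apply: le_trans (sqdist_tri mu mD (g := fun x => P x + g x) _ _ _) _ => //.
- exact: measurable_funD.
- by apply: measurable_funD => //; exact: mrt.
- by apply: measurable_funD; exact: mrt.
have -> : eps%:E = (2%:E * ((eps / 4)%:E + (eps / 4)%:E))%E.
  by rewrite -EFinD -EFinM; congr EFin; field.
rewrite lee_pmul2l //; apply: leeD.
  rewrite (_ : sqd _ _ = sqd f P) //.
  by apply: eq_integral => x _; congr (_ ^+ 2)%:E; ring.
rewrite (_ : sqd _ _ = sqd g Q) //.
by apply: eq_integral => x _; congr (_ ^+ 2)%:E; ring.
Qed.

Lemma L2approxZ c f : L2approx f -> L2approx (fun x => c * f x).
Proof.
move=> [mf af]; split => [|eps eps0]; first by apply: measurable_funM.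
have c0 : 0 < c ^+ 2 + 1 by rewrite ltr_wpDl // sqr_ge0.
have e0 : 0 < eps / (c ^+ 2 + 1) by rewrite divr_gt0.
have [P [tP hP]] := af _ e0; exists (fun x => c * P x); split.
  by apply: (rtrigM ts) => //; exact: (rtrig_cst ts).
rewrite sqdistZ //; last exact: mrt.
apply: (@le_trans _ _ ((c ^+ 2)%:E * (eps / (c ^+ 2 + 1))%:E)%E).
  by rewrite lee_wpmul2l // lee_fin sqr_ge0.
by rewrite -EFinM lee_fin mulrCA ger_pMr // ler_pdivrMr // mul1r lerDl.
Qed.

(** A difference of two values in [0, 1] has its square below its absolute value, so L^1
    approximation is enough. *)
Lemma L2approx_indic A : measurable A -> L2approx (\1_A).
Proof.
move=> mA; split => [|eps eps0]; first exact: measurable_indic.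
have [psi [tpsi upsi hpsi]] := dens mA eps0; exists psi; split => //.
have bpsi := rtrig_bmfun ts tpsi; have b1 := @bmfun_indic R _ _ _ mA.
have ib := bmfun_rintegrable mD muD (bmfun_norm (bmfunB bpsi b1)).
apply: (@le_trans _ _ (\int[mu]_(x in D) (`|psi x - \1_A x|)%:E)%E); last first.
  by rewrite -(@fineK _ (\int[mu]_(x in D) _)%E) ?lee_fin //; exact: integrable_fin_num.
apply: ge0_le_integral => //.
- by move=> x _; rewrite lee_fin sqr_ge0.
- apply/measurable_EFinP; apply: measurable_funTS; apply: measurable_funX.
  by apply: measurable_funB; [have [] := b1|have [] := bpsi].
- by apply/measurable_EFinP; apply: measurable_funTS; apply: measurableT_comp => //;
    apply: measurable_funB; [have [] := bpsi|have [] := b1].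
move=> x _; rewrite lee_fin -normrN opprB -real_normK ?num_real // expr2 ler_piMr //.
have /andP[p0 p1] := upsi x; rewrite indicE; case: (_ \in _) => /=; rewrite ler_norml; lra.
Qed.

Lemma L2approx_sum (I : Type) (s : seq I) (F : I -> T -> R) :
  (forall i, L2approx (F i)) -> L2approx (fun x => \sum_(i <- s) F i x).
Proof.
move=> h; elim: s => [|i s IH].
  have -> : (fun x => \sum_(i <- [::]) F i x) = (\1_set0 : T -> R).
    by apply/funext => x; rewrite big_nil indic0.
  exact: L2approx_indic.
have -> : (fun x => \sum_(j <- i :: s) F j x) = (fun x => F i x + \sum_(j <- s) F j x).
  by apply/funext => x; rewrite big_cons.
exact: L2approxD.
Qed.

Import HBSimple HBNNSimple.

Lemma L2approx_nnsfun (f : {nnsfun T >-> R}) : L2approx f.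
Proof.
have h x := @fimfunEord _ _ f x.
have -> : L2approx f = L2approx (fun x => f x) by [].
rewrite (funext h).
apply: L2approx_sum => i; apply: L2approxZ; apply: L2approx_indic.
exact: measurable_sfunP.
Qed.

(** Simple functions increase to g and (g - gn)^2 <= g^2, so dominated convergence applies. *)
Lemma L2approx_ge0 g : measurable_fun setT g -> (forall x, 0 <= g x) ->
  rintegrable mu D (fun x => g x ^+ 2) -> L2approx g.
Proof.
move=> mg g0 ig; apply: L2approx_lim => // eps eps0.
have mEg : measurable_fun setT (EFin \o g) by exact/measurable_EFinP.
pose gn n := nnsfun_approx measurableT mEg n.
have gle n x : gn n x <= g x.
  have nd m : (n <= m)%N -> gn n x <= gn m x.
    by move=> nm; have /lefP := nd_nnsfun_approx measurableT mEg nm; apply.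
  have := @cvg_nnsfun_approx _ _ _ setT measurableT _ mEg (fun x _ => g0 x) x I.
  move=> /fine_cvg cv; rewrite -(cvg_lim (@Rhausdorff R) cv).
  apply: limr_ge; first by apply/cvg_ex; exists (g x).
  by exists n => // m /= nm; exact: nd.
have cv : (\int[mu]_(x in D) ((g x - gn n x) ^+ 2)%:E)%E @[n --> \oo] -->
    (\int[mu]_(x in D) (cst 0 x))%E.
  apply: (@dominated_cvg _ _ _ mu D mD _ _ (fun x => (g x ^+ 2)%:E)) => //.
  - move=> n; apply/measurable_EFinP; apply: measurable_funTS; apply: measurable_funX.
    exact: measurable_funB.
  - move=> x Dx; apply: cvg_EFin; first exact: nearW.
    have c0 : g x - gn n x @[n --> \oo] --> (0 : R).
      rewrite -[X in _ --> X](subrr (g x)); apply: cvgB; first exact: cvg_cst.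
      have := @cvg_nnsfun_approx _ _ _ setT measurableT _ mEg (fun x _ => g0 x) x I.
      by move/fine_cvg.
    have cc : (g x - gn n x) ^+ 2 @[n --> \oo] --> (0 : R).
      under eq_fun do rewrite expr2.
      by have := cvgM (FF := eventually_filter) c0 c0; rewrite mulr0.
    exact: cc.
  - move=> n x _; rewrite gee0_abs ?lee_fin ?sqr_ge0 //.
    rewrite ler_pXn2r ?nnegrE ?subr_ge0 ?g0 ?gle // gerBl; exact: fun_ge0.
rewrite integral0 in cv.
have cvr := fine_cvg (FF := eventually_filter) cv.
have /cvgr0Pnorm_le /(_ eps eps0) [N _ hN] := cvr.
exists (gn N); split; first exact: L2approx_nnsfun.
have i2 : mu.-integrable D (EFin \o (fun x => (g x - gn N x) ^+ 2)).
  apply: (le_integrable mD _ _ ig).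
    apply/measurable_EFinP; apply: measurable_funTS; apply: measurable_funX.
    exact: measurable_funB.
  move=> x _; rewrite /= !ger0_norm ?sqr_ge0 // lee_fin.
  rewrite ler_pXn2r ?nnegrE ?subr_ge0 ?g0 ?gle // gerBl; exact: fun_ge0.
rewrite /sqdist -(@fineK _ (\int[mu]_(x in D) _)%E); last exact: integrable_fin_num.
rewrite lee_fin; apply: le_trans (hN N (leqnn _)); exact: ler_norm.
Qed.

Lemma L2approx_real g : measurable_fun setT g ->
  rintegrable mu D (fun x => g x ^+ 2) -> L2approx g.
Proof.
move=> mg ig.
have H h : measurable_fun setT h -> (forall x, 0 <= h x <= `|g x|) -> L2approx h.
  move=> mh hg; apply: L2approx_ge0 => // [x|]; first by have /andP[] := hg x.
  apply: (le_integrable mD _ _ ig).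
    by apply/measurable_EFinP; apply: measurable_funTS; apply: measurable_funX.
  move=> x _; have /andP[? ?] := hg x.
  rewrite /= !ger0_norm ?sqr_ge0 // lee_fin -[leRHS]real_normK ?num_real //.
  by rewrite ler_pXn2r ?nnegrE.
have -> : g = (fun x => g^\+ x + -1 * g^\- x).
  by apply/funext => x; rewrite mulN1r -[in LHS](funrposBneg g).
apply: L2approxD; last apply: L2approxZ; apply: H.
- exact: measurable_funrpos.
- move=> x; rewrite /funrpos; case: (leP (g x) 0) => h; rewrite ?max_l ?max_r ?(ltW h) //;
    rewrite ?lexx ?normr_ge0 ?ler_norm //.
- exact: measurable_funrneg.
- move=> x; rewrite /funrneg -normrN.
  case: (leP (- g x) 0) => h; rewrite ?max_l ?max_r ?(ltW h) //;
    rewrite ?lexx ?normr_ge0 ?ler_norm //.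
Qed.

Lemma trig_dense_L2 (u : T -> R[i]) : cmeasurable u ->
  rintegrable mu D (fun x => normc (u x) ^+ 2) -> forall eps : R, 0 < eps ->
  exists P, trig e P /\ (\int[mu]_(x in D) (normc (u x - P x) ^+ 2)%:E <= eps%:E)%E.
Proof.
move=> [mr mi] iu eps eps0; have e2 : 0 < eps / 2 by rewrite divr_gt0.
have mu2 : measurable_fun setT (fun x => normc (u x) ^+ 2).
  under eq_fun do rewrite sqr_normcE.
  by apply: measurable_funD; apply: measurable_funX.
have [|_ /(_ _ e2) [P [tP hP]]] := @L2approx_real (fun x => complex.Re (u x)) mr.
  apply: (le_integrable mD _ _ iu).
    by apply/measurable_EFinP; apply: measurable_funTS; apply: measurable_funX.
  by move=> x _; rewrite /= !ger0_norm ?sqr_ge0 // lee_fin sqr_normcE lerDl sqr_ge0.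
have [|_ /(_ _ e2) [Q [tQ hQ]]] := @L2approx_real (fun x => complex.Im (u x)) mi.
  apply: (le_integrable mD _ _ iu).
    by apply/measurable_EFinP; apply: measurable_funTS; apply: measurable_funX.
  by move=> x _; rewrite /= !ger0_norm ?sqr_ge0 // lee_fin sqr_normcE lerDr sqr_ge0.
exists (fun x => (P x)%:C + 'i%C * (Q x)%:C); split.
  by apply: trigD => //; exact: (trigZ ts).
have -> : eps%:E = ((eps / 2)%:E + (eps / 2)%:E)%E by rewrite -EFinD -splitr.
apply: le_trans (leeD hP hQ); rewrite -ge0_integralD //; last 4 first.
- by move=> x _; rewrite lee_fin sqr_ge0.
- apply/measurable_EFinP; apply: measurable_funTS; apply: measurable_funX.
  by apply: measurable_funB => //; exact: mrt.
- by move=> x _; rewrite lee_fin sqr_ge0.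
- apply/measurable_EFinP; apply: measurable_funTS; apply: measurable_funX.
  by apply: measurable_funB => //; exact: mrt.
rewrite le_eqVlt; apply/orP; left; apply/eqP; apply: eq_integral => x _.
rewrite -EFinD; congr EFin; rewrite sqr_normcE; case: (u x) => a b /=.
by congr (_ ^+ 2 + _ ^+ 2); ring.
Qed.

End L2Density.

(** * Fourier coefficients *)

Section Parseval.
Context {R : realType} {disp : measure_display} {T : measurableType disp}.
Variables (mu : {measure set T -> \bar R}) (D : set T) (Gm : zmodType)
  (e : Gm -> T -> R[i]) (M : R).
Hypothesis ts : trig_system mu D e M.
Let mD := ts_mD ts.
Let muD : (mu D < +oo)%E.
Proof. by rewrite (ts_muD ts) ltry. Qed.
Let M0 := ts_M ts.
Local Notation cI u := (cintegral mu D u).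

Lemma cintegral_e s : cI (e s) = if s == 0 then M%:C else 0.
Proof.
case: eqP => [->|/eqP]; last exact: (ts_I ts).
rewrite (@eq_cintegral _ _ _ _ _ _ (fun=> 1%:C)) => [|x _]; last exact: (ts_0 ts).
rewrite (cintegral_real mu mD (fun=> 1)) Rintegral_cst // mul1r.
by rewrite (ts_muD ts).
Qed.

Lemma normc_e s x : normc (e s x) = 1.
Proof.
have := congr1 (@complex.Re R) (mulc_conj (e s x)).
rewrite -(ts_N ts) -(ts_D ts) subrr (ts_0 ts) /= => /esym/eqP.
by rewrite sqrp_eq1 ?normc_ge0 // => /eqP.
Qed.

Lemma cintegral_mul_tp v c : cintegrable mu D v ->
  cI (fun x => v x * tp e c x) = \sum_(p <- c) p.1 * cI (fun x => v x * e p.2 x).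
Proof.
move=> iv.
rewrite (@eq_cintegral _ _ _ _ _ _ (fun x => \sum_(p <- c) p.1 * (v x * e p.2 x))) => [|x _].
  rewrite cintegral_sum // => [|p]; last first.
    by apply: cintegrableZ => //; apply: cintegrableM => //; exact: (ts_b ts).
  apply: eq_bigr => p _; rewrite cintegralZ //.
  by apply: cintegrableM => //; exact: (ts_b ts).
by rewrite /tp mulr_sumr; apply: eq_bigr => p _; rewrite mulrCA.
Qed.

Lemma tp_conj c x : conjc (tp e c x) = tp e [seq (conjc p.1, - p.2) | p <- c] x.
Proof.
rewrite /tp big_map rmorph_sum; apply: eq_bigr => p _ /=.
by rewrite rmorphM (ts_N ts).
Qed.

Lemma sqr_normcB (z w : R[i]) :
  normc (z - w) ^+ 2 = normc z ^+ 2 + normc w ^+ 2 - 2 * complex.Re (z * conjc w).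
Proof. by case: z w => [a b] [c d]; rewrite !sqr_normcE /=; ring. Qed.

Definition fc (u : T -> R[i]) (s : Gm) : R[i] :=
  (M^-1)%:C * cI (fun x => u x * e (- s) x).

Definition L2fun (u : T -> R[i]) :=
  cmeasurable u /\ rintegrable mu D (fun x => normc (u x) ^+ 2).

Lemma cmeasurable_sqr (u : T -> R[i]) : cmeasurable u ->
  measurable_fun setT (fun x : T => normc (u x) ^+ 2).
Proof.
move=> [mr mi]; under eq_fun do rewrite sqr_normcE.
by apply: measurable_funD; apply: measurable_funX.
Qed.

Lemma L2fun_cintegrable u : L2fun u -> cintegrable mu D u.
Proof.
move=> [[mr mi] iu].
have i1 : rintegrable mu D (fun x => 1 + normc (u x) ^+ 2).
  apply: rintegrableD => //.
  exact: (bmfun_rintegrable mD muD (@bmfun_cst R _ _ 1)).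
have h (a b : R) : `|a| <= 1 + (a ^+ 2 + b ^+ 2).
  rewrite -(@real_normK _ a) ?num_real //; have := sqr_ge0 (`|a| - 2^-1).
  by rewrite sqrrB; have := sqr_ge0 b; nra.
split; apply: (le_integrable mD _ _ i1).
- by apply/measurable_EFinP; exact: measurable_funTS.
- move=> x _; rewrite /= lee_fin [leRHS]ger0_norm ?addr_ge0 ?sqr_ge0 // sqr_normcE.
  exact: h.
- by apply/measurable_EFinP; exact: measurable_funTS.
- move=> x _; rewrite /= lee_fin [leRHS]ger0_norm ?addr_ge0 ?sqr_ge0 // sqr_normcE.
  rewrite [X in _ <= _ + X]addrC; exact: h.
Qed.

Definition psum (b : Gm -> R[i]) (F : seq Gm) (x : T) : R[i] :=
  \sum_(s <- F) b s * e s x.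

Lemma psumE b F x : psum b F x = tp e [seq (b s, s) | s <- F] x.
Proof. by rewrite /psum /tp big_map. Qed.

Lemma bcmfun_psum b F : bcmfun (psum b F).
Proof.
apply: bcmfun_sum => s; apply: bcmfunM; [exact: bcmfun_cst|exact: (ts_b ts)].
Qed.

Lemma cintegral_mul_psumJ u b F : cintegrable mu D u ->
  cI (fun x => u x * conjc (psum b F x)) = \sum_(s <- F) conjc (b s) * (M%:C * fc u s).
Proof.
move=> iu; rewrite (@eq_cintegral _ _ _ _ _ _ (fun x => u x *
    tp e [seq (conjc p.1, - p.2) | p <- [seq (b s, s) | s <- F]] x)) => [|x _].
  rewrite cintegral_mul_tp // !big_map; apply: eq_bigr => s _ /=.
  by rewrite /fc [M%:C * (_ * _)]mulrA -rmorphM mulfV ?gt_eqF // rmorph1 mul1r.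
by rewrite psumE tp_conj.
Qed.

Lemma fc_psum b F s : uniq F -> fc (psum b F) s = if s \in F then b s else 0.
Proof.
move=> uF; rewrite /fc.
rewrite (@eq_cintegral _ _ _ _ _ _ (fun x => e (- s) x * tp e [seq (b s, s) | s <- F] x)) => [|x _].
  rewrite cintegral_mul_tp; last by apply: bcmfun_cintegrable => //; exact: (ts_b ts).
  rewrite big_map /=.
  under eq_bigr => t _.
    rewrite (@eq_cintegral _ _ _ _ _ _ (e (t - s))) => [|x _]; last first.
      by rewrite addrC (ts_D ts).
    rewrite cintegral_e subr_eq0; over.
  case: ifPn => sF.
    rewrite (bigD1_seq s) //= eqxx big1 ?addr0 => [|t /negPf ->]; last by rewrite mulr0.
    by rewrite mulrCA -rmorphM mulVf ?gt_eqF // rmorph1 mulr1.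
  rewrite big_seq big1 ?mulr0 // => t tF; case: eqP tF sF => [->|]; last by rewrite mulr0.
  by move=> ->.
by rewrite psumE mulrC.
Qed.

Lemma norm2_psum b F : uniq F ->
  \int[mu]_(x in D) (normc (psum b F x) ^+ 2) = M * \sum_(s <- F) normc (b s) ^+ 2.
Proof.
move=> uF; apply: complexI; rewrite -(cintegral_real mu mD).
rewrite (@eq_cintegral _ _ _ _ _ _ (fun x => psum b F x * conjc (psum b F x))) => [|x _]; last first.
  by rewrite mulc_conj.
rewrite cintegral_mul_psumJ; last by apply: bcmfun_cintegrable => //; exact: bcmfun_psum.
rewrite rmorphM rmorph_sum mulr_sumr big_seq [RHS]big_seq; apply: eq_bigr => s sF.
rewrite fc_psum // sF; transitivity (M%:C * (b s * conjc (b s))); first by ring.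
by rewrite mulc_conj.
Qed.

(** With b = [fc u] this yields Bessel's inequality; with b taken from an approximating polynomial
    it yields Parseval's identity in the limit. *)
Lemma least_squares u b F : L2fun u -> uniq F ->
  \int[mu]_(x in D) (normc (u x - psum b F x) ^+ 2) =
  \int[mu]_(x in D) (normc (u x) ^+ 2) - M * (\sum_(s <- F) normc (fc u s) ^+ 2)
  + M * (\sum_(s <- F) normc (b s - fc u s) ^+ 2).
Proof.
move=> Lu uF; have iu := L2fun_cintegrable Lu; have [mu_ i2] := Lu.
have bp := bcmfun_psum b F.
have icross : cintegrable mu D (fun x => u x * conjc (psum b F x)).
  by apply: cintegrableM => //; exact: bcmfunJ.
have ip : rintegrable mu D (fun x => normc (psum b F x) ^+ 2).
  by apply: bmfun_rintegrable => //; exact: bmfun_sqrnormc.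
transitivity (\int[mu]_(x in D) (normc (u x) ^+ 2 + normc (psum b F x) ^+ 2)
    - 2 * complex.Re (cI (fun x => u x * conjc (psum b F x)))).
  rewrite /= -RintegralZl //; last by case: icross.
  rewrite -RintegralB //; last 2 first.
  - exact: rintegrableD.
  - by apply: rintegrableZ => //; case: icross.
  by apply: eq_Rintegral => x _; rewrite sqr_normcB.
rewrite RintegralD // norm2_psum // cintegral_mul_psumJ //.
have -> : complex.Re (\sum_(s <- F) conjc (b s) * (M%:C * fc u s)) =
   M * \sum_(s <- F) complex.Re (conjc (b s) * fc u s).
  by rewrite mulr_sumr Rec_sum; apply: eq_bigr => s _; rewrite mulrCA RecZ.
rewrite -addrA -[RHS]addrA; congr (_ + _).
rewrite mulrCA -mulrBr addrC -mulrBr; congr (_ * _).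
rewrite mulr_sumr -!sumrB; apply: eq_bigr => s _.
by rewrite sqr_normcB; case: (b s) (fc u s) => [? ?] [? ?] /=; ring.
Qed.

Lemma bessel u F : L2fun u -> uniq F ->
  M * (\sum_(s <- F) normc (fc u s) ^+ 2) <= \int[mu]_(x in D) (normc (u x) ^+ 2).
Proof.
move=> Lu uF; have := least_squares (fc u) Lu uF.
rewrite [X in _ = _ + M * X]big1 => [|s _]; last by rewrite subrr normc0 expr0n.
rewrite mulr0 addr0 -subr_ge0 => <-; apply: Rintegral_ge0 => x _; exact: sqr_ge0.
Qed.

Hypothesis dens : forall A, measurable A -> approximable mu D e (\1_A).

Lemma parseval u : L2fun u -> forall eps : R, 0 < eps -> exists F0 : seq Gm,
  forall F, uniq F -> {subset F0 <= F} ->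
  \int[mu]_(x in D) (normc (u x) ^+ 2) - M * (\sum_(s <- F) normc (fc u s) ^+ 2) <= eps.
Proof.
move=> Lu eps eps0; have [mu_ i2] := Lu.
have [P [[c hc] hP]] := trig_dense_L2 ts dens mu_ i2 eps0.
exists (map snd c) => F uF cF.
(* Collects the terms of P by frequency, since a frequency may be repeated in c; b is 0 outside the
   frequencies of c. *)
pose b s := \sum_(p <- c | p.2 == s) p.1.
have Pb : P = psum b F.
  apply/funext => x; rewrite hc /tp /psum.
  under [RHS]eq_bigr do rewrite mulr_suml.
  rewrite (exchange_big_dep predT) //= big_seq [RHS]big_seq; apply: eq_bigr => p pc.
  rewrite (eq_bigl (pred1 p.2)) => [|s]; last by rewrite /= eq_sym.
  by rewrite -big_filter filter_pred1_uniq ?big_seq1 // cF // map_f.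
have h : \int[mu]_(x in D) (normc (u x - psum b F x) ^+ 2) <= eps.
  rewrite -lee_fin fineK -?Pb // ge0_fin_numE ?(le_lt_trans hP) ?ltry //.
  by apply: integral_ge0 => x _; rewrite lee_fin sqr_ge0.
apply: le_trans h; rewrite least_squares // lerDl mulr_ge0 ?(ltW M0) //.
by apply: sumr_ge0 => s _; exact: sqr_ge0.
Qed.

End Parseval.

(** * Szego's infimum *)

(** Take z = -t conj(B) with t = 1 / C; when C = 0, t = A / |B|^2 forces A = 0 and t = 1 then forces
    B = 0. *)
Lemma quadratic_bound (R : realType) (A C : R) (B : R[i]) : 0 <= A -> 0 <= C ->
  (forall z, 0 <= A + 2 * complex.Re (z * B) + normc z ^+ 2 * C) ->
  normc B ^+ 2 <= A * C.
Proof.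
move=> A0 C0 h.
have key (t : R) : 0 <= A - 2 * t * normc B ^+ 2 + t ^+ 2 * normc B ^+ 2 * C.
  have := h (- t%:C * conjc B).
  have -> : complex.Re (- t%:C * conjc B * B) = - t * normc B ^+ 2.
    by rewrite sqr_normcE; case: (B) => x y /=; ring.
  have -> : normc (- t%:C * conjc B) ^+ 2 = t ^+ 2 * normc B ^+ 2.
    by rewrite !sqr_normcE; case: (B) => x y /=; ring.
  by congr (0 <= _); ring.
set b := normc B ^+ 2 in key *.
move: C0; rewrite le_eqVlt => /orP[/eqP C0|C0].
  rewrite -C0 mulr0 leNgt; apply/negP => B0.
  have := key (A / b); rewrite -C0 mulr0 addr0 mulrA divfK ?gt_eqF // => hA.
  have := key 1; rewrite -C0; lra.
have := key C^-1; have -> : A - 2 * C^-1 * b + C^-1 ^+ 2 * b * C = A - b / C.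
  by field; exact: lt0r_neq0.
by rewrite subr_ge0 ler_pdivrMr.
Qed.

Section Szego.
Context {R : realType} {disp : measure_display} {T : measurableType disp}.
Variables (mu : {measure set T -> \bar R}) (D : set T) (Gm : zmodType)
  (e : Gm -> T -> R[i]) (M : R).
Hypothesis ts : trig_system mu D e M.
Hypothesis dens : forall A, measurable A -> approximable mu D e (\1_A).
Let mD := ts_mD ts.
Let muD : (mu D < +oo)%E.
Proof. by rewrite (ts_muD ts) ltry. Qed.
Let M0 := ts_M ts.
Local Notation cI u := (cintegral mu D u).

Variable pos : pred Gm.
Hypothesis posD : forall s t, pos s -> pos t -> pos (s + t).
Hypothesis pos_total : forall s, s != 0 -> pos s || pos (- s).

(** For the order [pos], the analogue of analytic polynomials with value 1 at the origin. *)
Definition admissible (q : T -> R[i]) := exists2 c,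
  all (fun p => pos p.2) c & q = fun x => 1 + tp e c x.

Lemma admissible1 : admissible (fun=> 1).
Proof. by exists [::] => //; apply/funext => x; rewrite /tp big_nil addr0. Qed.

Lemma admissible_bcmfun q : admissible q -> bcmfun q.
Proof.
move=> [c _ ->]; apply: bcmfunD; first exact: bcmfun_cst.
by apply: (trig_bcmfun ts); exists c.
Qed.

Lemma admissible_mid q q' : admissible q -> admissible q' ->
  admissible (fun x => (2^-1)%:C * (q x + q' x)).
Proof.
move=> [c hc ->] [c' hc' ->].
exists [seq ((2^-1)%:C * p.1, p.2) | p <- c ++ c'].
  by rewrite all_map; rewrite (eq_all (a2 := fun p => pos p.2)) // all_cat hc.
apply/funext => x; rewrite /tp big_map big_cat /=.
have -> : 1 + \sum_(p <- c) p.1 * e p.2 x + (1 + \sum_(p <- c') p.1 * e p.2 x) =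
  2 + (\sum_(p <- c) p.1 * e p.2 x + \sum_(p <- c') p.1 * e p.2 x) by ring.
rewrite mulrDr; congr (_ + _).
  have -> : (2 : R[i]) = 2%:C by congr Complex; rewrite /= addr0.
  by rewrite -rmorphM mulVf.
rewrite mulrDr !mulr_sumr.
by congr (_ + _); apply: eq_bigr => p _; rewrite mulrA.
Qed.

Lemma admissible_perturb q s z : pos s -> admissible q ->
  admissible (fun x => q x * (1 + z * e s x)).
Proof.
move=> ps [c hc ->].
exists (c ++ (z, s) :: [seq (z * p.1, s + p.2) | p <- c]).
  rewrite all_cat hc /= ps all_map; apply/allP => p pc /=.
  by apply: posD => //; exact: (allP hc).
apply/funext => x; rewrite /tp big_cat big_cons big_map /=.
have -> : \sum_(j <- c) z * j.1 * e (s + j.2) x = z * e s x * \sum_(p <- c) p.1 * e p.2 x.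
  by rewrite mulr_sumr; apply: eq_bigr => p _; rewrite (ts_D ts); ring.
ring.
Qed.

Variable E : set T.
Hypothesis mE : measurable E.
Let w : T -> R := \1_(~` E).
Let bw : bmfun w.
Proof. exact/bmfun_indic/measurableC. Qed.
Let w0 x : 0 <= w x.
Proof. by rewrite /w indicE. Qed.

Let ib g : bmfun g -> rintegrable mu D g := bmfun_rintegrable mD muD (g := g).
Let icb u : bcmfun u -> cintegrable mu D u := bcmfun_cintegrable mD muD (u := u).

Definition wnorm (q : T -> R[i]) := \int[mu]_(x in D) (w x * normc (q x) ^+ 2).

Let bwq q : bcmfun q -> bmfun (fun x => w x * normc (q x) ^+ 2).
Proof. by move=> bq; apply: bmfunM => //; exact: bmfun_sqrnormc. Qed.

Lemma wnorm_ge0 q : 0 <= wnorm q.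
Proof. by apply: Rintegral_ge0 => x _; rewrite mulr_ge0 // sqr_ge0. Qed.

Definition wcoef (q : T -> R[i]) s := cI (fun x => (w x * normc (q x) ^+ 2)%:C * e s x).

Lemma wnorm_perturb q s z : bcmfun q ->
  wnorm (fun x => q x * (1 + z * e s x)) =
  wnorm q + 2 * complex.Re (z * wcoef q s) + normc z ^+ 2 * wnorm q.
Proof.
move=> bq; have be := ts_b ts s.
have bm : bcmfun (fun x => (w x * normc (q x) ^+ 2)%:C * e s x).
  by apply: bcmfunM => //; apply: bcmfun_real; exact: bwq.
rewrite /wcoef -cintegralZ //; last exact: icb.
rewrite /= /wnorm -!RintegralZl //; first last.
- by case: (icb (bcmfunM (bcmfun_cst z) bm)).
- exact/ib/bwq.
have i1 := ib (bwq bq).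
have i2 : rintegrable mu D (fun x => 2 * complex.Re (z * ((w x * normc (q x) ^+ 2)%:C * e s x))).
  by apply: rintegrableZ => //; case: (icb (bcmfunM (bcmfun_cst z) bm)).
have i3 : rintegrable mu D (fun x => normc z ^+ 2 * (w x * normc (q x) ^+ 2)).
  exact: rintegrableZ.
rewrite -RintegralD // -RintegralD //; last exact: rintegrableD.
apply: eq_Rintegral => x _; rewrite normcM exprMn.
have -> : normc (1 + z * e s x) ^+ 2 = 1 + 2 * complex.Re (z * e s x) + normc z ^+ 2.
  have <- : normc (z * e s x) = normc z by rewrite normcM (normc_e ts) mulr1.
  by rewrite !sqr_normcE; case: (z * e s x) => a b /=; ring.
have -> : z * ((w x * normc (q x) ^+ 2)%:C * e s x) = (w x * normc (q x) ^+ 2)%:C * (z * e s x).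
  by ring.
rewrite RecZ; ring.
Qed.

Definition winf := inf [set wnorm q | q in admissible].

Lemma winf_le q : admissible q -> winf <= wnorm q.
Proof.
move=> aq; apply: ge_inf; last by exists q.
by exists 0 => _ [p _ <-]; exact: wnorm_ge0.
Qed.

Lemma winf_ge0 : 0 <= winf.
Proof.
apply: lb_le_inf; first by exists (wnorm (fun=> 1)); exists (fun=> 1) => //; exact: admissible1.
by move=> _ [p _ <-]; exact: wnorm_ge0.
Qed.

Lemma winf_adherent eta : 0 < eta -> exists2 q, admissible q & wnorm q <= winf + eta.
Proof.
move=> eta0; have [|_ [q aq <-] /ltW hq] := @inf_adherent R [set wnorm q | q in admissible] _ eta0.
  split; first by exists (wnorm (fun=> 1)); exists (fun=> 1) => //; exact: admissible1.
  by exists 0 => _ [p _ <-]; exact: wnorm_ge0.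
by exists q.
Qed.

Lemma wcoefN q s : bcmfun q -> wcoef q (- s) = conjc (wcoef q s).
Proof.
move=> bq; rewrite /wcoef -cintegralJ //; last first.
  by apply: icb; apply: bcmfunM; [apply: bcmfun_real; exact: bwq|exact: (ts_b ts)].
by apply: eq_cintegral => x _; rewrite (ts_N ts) -[in LHS]conjc_real -rmorphM.
Qed.

(** The first variation at a near-minimizer. For positive s the competitors q (1 + z e_s) are
    admissible, and [quadratic_bound] converts minimality up to eta into smallness of a Fourier
    coefficient of w |q|^2. *)
Lemma wcoef_small q s eta : s != 0 -> admissible q -> wnorm q <= winf + eta ->
  normc (wcoef q s) ^+ 2 <= eta * (winf + eta).
Proof.
move=> s0 aq hq; have bq := admissible_bcmfun aq.
have i0 := winf_le aq; have I0 := winf_ge0.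
(* As w |q|^2 is real, its coefficients at s and -s are conjugate. *)
wlog ps : s s0 / pos s.
  move=> H; have /orP[/H|/H] := pos_total s0; first exact.
  by rewrite wcoefN // normc_conj oppr_eq0; exact.
apply: (@le_trans _ _ ((wnorm q - winf) * wnorm q)).
  apply: quadratic_bound; rewrite ?subr_ge0 ?wnorm_ge0 // => z.
  have := winf_le (admissible_perturb z ps aq); rewrite wnorm_perturb // -subr_ge0.
  by congr (0 <= _); ring.
apply: ler_pM; rewrite ?subr_ge0 ?wnorm_ge0 //; lra.
Qed.

(** The parallelogram identity; the midpoint is admissible, so its [wnorm] is at least [winf]. *)
Lemma near_minimizers q q1 eta : admissible q -> admissible q1 ->
  wnorm q <= winf + eta -> wnorm q1 <= winf + eta ->
  wnorm (fun x => q x - q1 x) <= 4 * eta.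
Proof.
move=> aq aq1 hq hq1; have bq := admissible_bcmfun aq; have bq1 := admissible_bcmfun aq1.
have am := admissible_mid aq aq1; have := winf_le am.
have bmid := admissible_bcmfun am.
have -> : wnorm (fun x => q x - q1 x) = 2 * wnorm q + 2 * wnorm q1 -
    4 * wnorm (fun x => (2^-1)%:C * (q x + q1 x)); last by lra.
have i1 := ib (bwq bq); have i2 := ib (bwq bq1); have i3 := ib (bwq bmid).
rewrite /wnorm -!RintegralZl // -RintegralD //; last 2 first.
- exact: rintegrableZ.
- exact: rintegrableZ.
rewrite -RintegralB //; last 2 first.
- by apply: rintegrableD => //; exact: rintegrableZ.
- exact: rintegrableZ.
apply: eq_Rintegral => x _; rewrite normcM exprMn sqr_normcE.
rewrite [normc (2^-1)%:C ^+ 2]sqr_normcE /= !sqr_normcE.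
by case: (q x) (q1 x) => [a b] [c d'] /=; field.
Qed.

Lemma sqr_norm_dist (z z1 : R[i]) (theta : R) : 0 < theta ->
  `|normc z ^+ 2 - normc z1 ^+ 2| <=
  (2 * theta)^-1 * normc (z - z1) ^+ 2 + theta * (normc z ^+ 2 + normc z1 ^+ 2).
Proof.
move=> t0; set a := normc z; set b := normc z1; set c := normc (z - z1).
have a0 : 0 <= a := normc_ge0 z. have b0 : 0 <= b := normc_ge0 z1.
have ab : `|a - b| <= c.
  have h1 := le_normcD (z - z1) z1; rewrite subrK -/a -/b -/c in h1.
  have h2 := le_normcD (z1 - z) z; rewrite subrK -/a -/b in h2.
  have h3 : normc (z1 - z) = c by rewrite -opprB; exact: normcN.
  by rewrite ler_norml; rewrite h3 in h2; lra.
rewrite subr_sqr normrM (ger0_norm (addr_ge0 a0 b0)).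
apply: (@le_trans _ _ (c * (a + b))); first by rewrite ler_wpM2r // addr_ge0.
have -> : (2 * theta)^-1 * c ^+ 2 = theta * ((c / theta) ^+ 2 / 2) by field; rewrite gt_eqF.
rewrite -mulrDr; have -> : c * (a + b) = theta * ((c / theta) * (a + b)) by field; rewrite gt_eqF.
rewrite ler_pM2l //; have := sqr_ge0 (c / theta - (a + b)); have := sqr_ge0 (a - b).
set r := c / theta; nra.
Qed.

Lemma near_minimizers_L1 q q1 eta theta : 0 < theta -> admissible q -> admissible q1 ->
  wnorm q <= winf + eta -> wnorm q1 <= winf + eta ->
  \int[mu]_(x in D) (w x * `|normc (q x) ^+ 2 - normc (q1 x) ^+ 2|) <=
  2 * eta / theta + theta * (2 * (winf + eta)).
Proof.
move=> t0 aq aq1 hq hq1; have bq := admissible_bcmfun aq; have bq1 := admissible_bcmfun aq1.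
have bd : bcmfun (fun x => q x - q1 x).
  apply: (bcmfun_ext _ (bcmfunD bq (bcmfunM (bcmfun_cst (-1)) bq1))) => x.
  by rewrite mulN1r.
have i1 := ib (bwq bq); have i2 := ib (bwq bq1); have i3 := ib (bwq bd).
apply: (@le_trans _ _ ((2 * theta)^-1 * wnorm (fun x => q x - q1 x) +
    theta * (wnorm q + wnorm q1))); last first.
  apply: lerD; last by rewrite ler_pM2l //; lra.
  have -> : 2 * eta / theta = (2 * theta)^-1 * (4 * eta) by field; rewrite gt_eqF.
  by rewrite ler_pM2l ?invr_gt0 ?mulr_gt0 //; exact: near_minimizers.
rewrite /wnorm -RintegralD // -!RintegralZl //; last exact: rintegrableD.
rewrite -RintegralD //; last 2 first.
- exact: rintegrableZ.
- by apply: rintegrableZ => //; exact: rintegrableD.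
apply: le_Rintegral => //.
- apply: ib; apply: bmfunM => //; apply: bmfun_norm; apply: bmfunB; exact: bmfun_sqrnormc.
- by apply: rintegrableD => //; apply: rintegrableZ => //; exact: rintegrableD.
move=> x _; rewrite -mulrDr mulrCA [theta * (w x * _)]mulrCA -mulrDr ler_wpM2l //.
exact: sqr_norm_dist.
Qed.

(** The zero frequency of psi contributes its mean times [wnorm q]; every other frequency meets a
    coefficient of w |q|^2 of size at most nu. *)
Lemma wnorm_test q c (psi : T -> R) (nu : R) : bcmfun q -> 0 <= nu ->
  (forall x, (psi x)%:C = tp e c x) ->
  (forall s, s != 0 -> normc (wcoef q s) <= nu) ->
  M^-1 * (\int[mu]_(x in D) psi x) * wnorm q - (\sum_(p <- c) normc p.1) * nu <=
  \int[mu]_(x in D) (w x * psi x * normc (q x) ^+ 2).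
Proof.
move=> bq nu0 hpsi hnu.
have iw : cintegrable mu D (fun x => (w x * normc (q x) ^+ 2)%:C).
  by apply: icb; apply: bcmfun_real; exact: bwq.
have e1 : \int[mu]_(x in D) (w x * psi x * normc (q x) ^+ 2) =
    \sum_(p <- c) complex.Re (p.1 * wcoef q p.2).
  transitivity (complex.Re (cI (fun x => (w x * normc (q x) ^+ 2)%:C * tp e c x))).
    rewrite /=; apply: eq_Rintegral => x _; rewrite -hpsi -rmorphM /=; ring.
  by rewrite (cintegral_mul_tp ts) // Rec_sum.
have e2 : M^-1 * (\int[mu]_(x in D) psi x) = \sum_(p <- c) complex.Re (if p.2 == 0 then p.1 else 0).
  have -> : \int[mu]_(x in D) psi x = complex.Re (cI (fun x => 1 * tp e c x)).
    by rewrite /=; apply: eq_Rintegral => x _; rewrite -hpsi mul1r.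
  rewrite (cintegral_mul_tp ts); last by apply: icb; exact: bcmfun_cst.
  rewrite Rec_sum mulr_sumr; apply: eq_bigr => p _.
  rewrite (@eq_cintegral _ _ _ _ _ _ (e p.2)) => [|x _]; last by rewrite mul1r.
  rewrite (cintegral_e ts); case: eqP => _; last by rewrite !mulr0.
  by rewrite mulrC mulrC [p.1 * _]mulrC RecZ mulrA mulVf ?mul1r // gt_eqF.
rewrite e1 e2 !mulr_suml -sumrB; apply: ler_sum => p _.
case: eqP => [->|/eqP s0].
  have -> : wcoef q 0 = (wnorm q)%:C.
    rewrite /wcoef /wnorm -(cintegral_real mu mD); apply: eq_cintegral => x _.
    by rewrite (ts_0 ts) mulr1.
  by rewrite [p.1 * _]mulrC RecZ mulrC lerBlDr lerDl mulr_ge0 ?normc_ge0.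
rewrite mul0r sub0r lerNl.
apply: (@le_trans _ _ (normc (p.1 * wcoef q p.2))).
  by apply: le_trans (ler_norm _) _; rewrite normrN ler_Re_normc.
by rewrite normcM ler_wpM2l ?normc_ge0 // hnu.
Qed.

Hypothesis muE : (0 < mu (E `&` D))%E.

(** Integrate w |q|^2 against psi close to the indicator of E. If [winf] were positive, smallness of
    the nonconstant coefficients would keep the integral near the mean of psi times [winf], whereas
    w = 0 on E makes it small. The order of choices matters: q1 gives the bound B on |q1|^2, then
    psi is chosen with a precision depending on B, and q last, with a precision depending on the
    coefficients of psi; [near_minimizers_L1] allows q to be replaced by q1. *)
Lemma winf_eq0 : winf = 0.
Proof.
apply/eqP; rewrite eq_le winf_ge0 andbT leNgt; apply/negP => I0.
have muEf : mu (E `&` D) \is a fin_num.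
  rewrite ge0_fin_numE // (le_lt_trans _ muD) // le_measure ?inE //.
  exact: measurableI.
pose m := fine (mu (E `&` D)).
have m0 : 0 < m by rewrite fine_gt0 // muE ltey_eq muEf.
(* The lower bound winf (m / M) / 2 is 4 kappa, to be contradicted by three errors of at most kappa
   each. *)
pose kappa := winf * (m / M) / 8.
have k0 : 0 < kappa by rewrite !divr_gt0 // mulr_gt0 // divr_gt0.
pose theta := kappa / (4 * (winf + 1)).
have t0 : 0 < theta by rewrite divr_gt0 // mulr_gt0 //; lra.
pose eta := Num.min 1 (kappa * theta / 4).
have eta0 : 0 < eta by rewrite lt_min ltr01 divr_gt0 // mulr_gt0.
have eta1 : eta <= 1 by rewrite ge_min lexx.
have eta2 : eta <= kappa * theta / 4 by rewrite ge_min lexx orbT.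
have [q1 aq1 hq1] := winf_adherent eta0.
have bq1 := admissible_bcmfun aq1.
have [mq1 [B hB]] := bmfun_sqrnormc bq1.
have B0 : 0 <= B by apply: le_trans (hB point); exact: normr_ge0.
pose eps := Num.min (kappa / (B + 1)) (m / 2).
have eps0 : 0 < eps.
  by rewrite lt_min; apply/andP; split; apply: divr_gt0 => //; exact: ltr_wpDl.
have [psi [[c hc] upsi hpsi]] := dens mE eps0.
have bpsi : bmfun psi by apply: (rtrig_bmfun ts); exists c.
have b1E := @bmfun_indic R _ _ _ mE.
have C0 : 0 <= \sum_(p <- c) normc p.1 by apply: sumr_ge0 => p _; exact: normc_ge0.
pose nu := kappa / (\sum_(p <- c) normc p.1 + 1).
have nu0 : 0 < nu by apply: divr_gt0 => //; exact: ltr_wpDl.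
pose eta' := Num.min eta (nu ^+ 2 / (winf + 1)).
have eta'0 : 0 < eta' by rewrite lt_min eta0 divr_gt0 ?exprn_gt0 //; lra.
have eta'1 : eta' <= eta by rewrite ge_min lexx.
have eta'2 : eta' <= nu ^+ 2 / (winf + 1) by rewrite ge_min lexx orbT.
have [q aq hq] := winf_adherent eta'0; have bq := admissible_bcmfun aq.
have hnu s : s != 0 -> normc (wcoef q s) <= nu.
  move=> s0; rewrite -(@ler_pXn2r _ 2) ?nnegrE ?normc_ge0 ?(ltW nu0) //.
  apply: le_trans (wcoef_small s0 aq hq) _.
  apply: (@le_trans _ _ (nu ^+ 2 / (winf + 1) * (winf + 1))).
    by apply: ler_pM => //; [exact: ltW|lra|lra].
  by rewrite divfK //; apply/lt0r_neq0; lra.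
have h1 := wnorm_test bq (ltW nu0) hc hnu.
have h2 : (\sum_(p <- c) normc p.1) * nu <= kappa.
  rewrite /nu mulrCA ger_pMr // ler_pdivrMr ?ltr_wpDl // mul1r lerDl //.
have h3 : m / 2 <= \int[mu]_(x in D) psi x.
  have eE : \int[mu]_(x in D) (\1_E x : R) = m by rewrite /Rintegral integral_indic.
  have := le_normr_Rintegral mD (ib (bmfunB bpsi b1E)).
  rewrite RintegralB //; [|exact: ib|exact: ib].
  rewrite eE ler_norml => /andP[+ _].
  have : eps <= m / 2 by rewrite ge_min lexx orbT.
  by move: hpsi; set x := Rintegral _ _ _; set y := Rintegral _ _ _; lra.
have h4 : winf * (m / M) / 2 <= M^-1 * (\int[mu]_(x in D) psi x) * wnorm q.
  have -> : winf * (m / M) / 2 = M^-1 * (m / 2) * winf by field; rewrite gt_eqF.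
  apply: ler_pM => //; [|exact: ltW| |exact: winf_le].
    by rewrite mulr_ge0 ?invr_ge0 ?divr_ge0 ?ltW.
  by rewrite ler_pM2l // invr_gt0.
have h5 : \int[mu]_(x in D) (w x * psi x * normc (q x) ^+ 2) <=
   B * eps + \int[mu]_(x in D) (w x * `|normc (q x) ^+ 2 - normc (q1 x) ^+ 2|).
  apply: (@le_trans _ _ (\int[mu]_(x in D) (B * `|psi x - \1_E x| +
     w x * `|normc (q x) ^+ 2 - normc (q1 x) ^+ 2|))); last first.
    rewrite RintegralD //.
    - by rewrite RintegralZl // ?lerD2r ?ler_wpM2l //; exact/ib/bmfun_norm/bmfunB.
    - by apply: ib; apply: bmfunM; [exact: bmfun_cst|exact/bmfun_norm/bmfunB].
    - by apply: ib; apply: bmfunM => //; apply/bmfun_norm/bmfunB; exact: bmfun_sqrnormc.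
  apply: le_Rintegral => //.
  - by apply: ib; apply: bmfunM; [exact: bmfunM|exact: bmfun_sqrnormc].
  - apply: ib; apply: bmfunD; first by apply: bmfunM; [exact: bmfun_cst|exact/bmfun_norm/bmfunB].
    by apply: bmfunM => //; apply/bmfun_norm/bmfunB; exact: bmfun_sqrnormc.
  move=> x _; have /andP[p0 p1] := upsi x.
  have hBx := le_trans (ler_norm _) (hB x).
  rewrite /w !indicE in_setC; case: (x \in E) => /=.
    by rewrite !mul0r addr0 mulr_ge0.
  rewrite !mul1r subr0 (ger0_norm p0).
  have := ler_norm (normc (q x) ^+ 2 - normc (q1 x) ^+ 2).
  have := normr_ge0 (normc (q x) ^+ 2 - normc (q1 x) ^+ 2).
  have := sqr_ge0 (normc (q1 x)); nra.
have h6 := near_minimizers_L1 t0 aq aq1 (le_trans hq (lerD (lexx _) eta'1)) hq1.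
have h7 : 2 * eta / theta + theta * (2 * (winf + eta)) <= kappa.
  have -> : kappa = kappa / 2 + kappa / 2 by rewrite -splitr.
  apply: lerD.
    rewrite ler_pdivrMr //; lra.
  rewrite /theta mulrAC ler_pdivrMr; last by rewrite mulr_gt0 //; lra.
  nra.
have h8 : B * eps <= kappa.
  apply: (@le_trans _ _ (B * (kappa / (B + 1)))).
    by rewrite ler_wpM2l // ge_min lexx.
  by rewrite mulrCA ger_pMr // ler_pdivrMr ?ltr_wpDl // mul1r lerDl.
have : winf * (m / M) / 2 = 4 * kappa by rewrite /kappa; field; rewrite gt_eqF.
by lra.
Qed.

Lemma szego delta : 0 < delta -> exists2 q, admissible q & wnorm q <= delta.
Proof. by move=> /winf_adherent; rewrite winf_eq0 add0r. Qed.

End Szego.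

(** * Characters of the torus and of space-time *)

Section Coordinates.
Context {R : realType} {disp : measure_display} {T : measurableType disp}.
Variables (mu : {measure set T -> \bar R}) (D : set T) (Gm : zmodType)
  (e : Gm -> T -> R[i]) (M : R).
Hypothesis ts : trig_system mu D e M.

(** Only the trace on D matters: a set such as {s < c} is a level set of a trigonometric polynomial
    inside the fundamental domain only. *)
Definition good_on (B : set T) := exists2 B', good_set mu D e B' & B `&` D = B' `&` D.

Lemma good_onC B : good_on B -> good_on (~` B).
Proof.
move=> [B' gB' h]; exists (~` B'); first exact: (good_setC ts).
apply/seteqP; split => x [nB Dx]; split => // Bx; apply: nB.
- by have : (B' `&` D) x by []; rewrite -h => -[].
- by have : (B `&` D) x by []; rewrite h => -[].
Qed.

Lemma good_on_bigcup (F : nat -> set T) : (forall n, good_on (F n)) ->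
  good_on (\bigcup_n F n).
Proof.
move=> h; have [G hG] := choice (fun n => let: ex_intro2 B a b := h n in
  ex_intro (fun B => good_set mu D e B /\ F n `&` D = B `&` D) B (conj a b)).
exists (\bigcup_n G n); first by apply: (good_bigcup ts) => n; have [] := hG n.
by rewrite !setI_bigcupl; apply: eq_bigcupr => n _; have [] := hG n.
Qed.

Lemma good_on_sigma (G : set (set T)) : G `<=` good_on -> <<s G >> `<=` good_on.
Proof.
move=> h; apply: smallest_sub => //; split.
- by exists set0 => //; exact: (good_set0 ts).
- by move=> A gA; rewrite setTD; exact: good_onC.
- exact: good_on_bigcup.
Qed.

Lemma good_on_approximable B : good_on B -> approximable mu D e (\1_B).
Proof.
move=> [B' [_ _ ap] h] eps /ap [psi [tp_ up hp]]; exists psi; split => //.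
rewrite (@eq_Rintegral _ _ _ mu D (fun x => `|psi x - \1_B' x|)) // => x.
rewrite inE => Dx; congr (`|_ - _|); rewrite !indicE; congr (_%:R).
have : (x \in B `&` D) = (x \in B' `&` D) by rewrite h.
by rewrite !in_setI (mem_set Dx) !andbT => ->.
Qed.

(** The window [r - 2 pi, r) is a full period ending where the arc |u| < r ends, so only the left
    end of the arc has to be tested. *)
Lemma cos_gt_itv (r u : R) : 0 <= r <= pi -> r - 2 * pi <= u < r ->
  (cos r < cos u) = (- r < u).
Proof.
move=> /andP[r0 rpi] /andP[u1 u2]; have p0 := @pi_gt0 R.
have [ru|ru] := ltP (- r) u.
  have h : `|u| <= pi by rewrite ler_norml; lra.
  by rewrite -(cos_norm u) ltr_cos ?in_itv /= ?r0 ?rpi ?normr_ge0 ?h // ltr_norml ru u2.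
apply/negbTE; rewrite -leNgt -cosN.
have [upi|upi] := leP (- u) pi.
  by rewrite leNgt ltr_cos ?in_itv /= -?leNgt; lra.
have -> : cos (- u) = cos (u + pi *+ 2) by rewrite cosD2pi cosN.
by rewrite leNgt ltr_cos ?in_itv /= ?mulr2n -?leNgt; lra.
Qed.

Variable c : T -> R.
Hypothesis c_D : forall x, D x -> - pi <= c x < pi.
Hypothesis c_cos : rtrig e (fun x => cos (c x)).
Hypothesis c_sin : rtrig e (fun x => sin (c x)).

(** Within [-pi, pi) the values above s form the arc of centre m = (s + pi) / 2 and half-width r =
    (pi - s) / 2, where cos(c - m) > cos r. The addition formula makes this a level set of a
    trigonometric polynomial. *)
Lemma good_on_gt (s : R) : good_on [set x | s < c x].
Proof.
have [s1|s1] := ltP s (- pi).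
  exists (~` set0); first by apply: (good_setC ts); exact: (good_set0 ts).
  by apply/seteqP; split => x [_ Dx]; split => //; rewrite /=; have := c_D Dx; lra.
have [s2|s2] := leP pi s.
  exists set0; first exact: (good_set0 ts).
  by apply/seteqP; split => x [] //= sx Dx; have := c_D Dx; lra.
pose m := (s + pi) / 2; pose r := (pi - s) / 2.
exists [set x | cos r < cos (c x) * cos m + sin (c x) * sin m].
  apply: (good_indic_gt ts); apply: rtrigD; apply: (rtrigM ts) => //; exact: (rtrig_cst ts).
apply/seteqP; split => x [/= h Dx]; split => //; move: h; have cx := c_D Dx.
- by rewrite -cosB cos_gt_itv /m /r; lra.
- by rewrite -cosB cos_gt_itv /m /r; lra.
Qed.

Lemma good_on_coord (A : set R) : measurable A -> good_on (c @^-1` A).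
Proof.
have -> : (measurable : set (set R)) = <<s @RGenOInfty.G R >> by exact: RGenOInfty.measurableE.
move: A; apply: smallest_sub; first split.
- by rewrite preimage_set0; exists set0 => //; exact: (good_set0 ts).
- by move=> A gA; rewrite setTD preimage_setC; exact: good_onC.
- by move=> F hF; rewrite preimage_bigcup; exact: good_on_bigcup.
move=> _ [s ->]; have := good_on_gt s; congr good_on.
by apply/seteqP; split => x; rewrite /= in_itv /= andbT.
Qed.

End Coordinates.

(** * Fubini for products of bounded functions *)

Section Products.
Context {R : realType} {d1 d2 : measure_display}
  {T1 : measurableType d1} {T2 : measurableType d2}.
Variables (m1 : {sigma_finite_measure set T1 -> \bar R})
  (m2 : {sigma_finite_measure set T2 -> \bar R}).
Variables (D1 : set T1) (D2 : set T2).
Hypothesis mD1 : measurable D1.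
Hypothesis mD2 : measurable D2.
Hypothesis f1 : (m1 D1 < +oo)%E.
Hypothesis f2 : (m2 D2 < +oo)%E.

Lemma bmfun_fst (a : T1 -> R) : bmfun a -> bmfun (fun z : T1 * T2 => a z.1).
Proof.
move=> [ma [B hB]]; split; last by exists B => z.
exact: (measurableT_comp ma measurable_fst).
Qed.

Lemma bmfun_snd (b : T2 -> R) : bmfun b -> bmfun (fun z : T1 * T2 => b z.2).
Proof.
move=> [mb [B hB]]; split; last by exists B => z.
exact: (measurableT_comp mb measurable_snd).
Qed.

Lemma prod_lty : ((m1 \x m2) (D1 `*` D2) < +oo)%E.
Proof.
by rewrite product_measure1E // lte_mul_pinfty // ge0_fin_numE.
Qed.

Lemma Rintegral_prod (a : T1 -> R) (b : T2 -> R) : bmfun a -> bmfun b ->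
  \int[(m1 \x m2)%E]_(z in D1 `*` D2) (a z.1 * b z.2) =
  (\int[m1]_(x in D1) a x) * (\int[m2]_(y in D2) b y).
Proof.
move=> ba bb.
have mD : measurable (D1 `*` D2) by exact: measurableX.
have bab : bmfun (fun z : T1 * T2 => a z.1 * b z.2).
  by apply: bmfunM; [exact: bmfun_fst|exact: bmfun_snd].
have iab := bmfun_rintegrable mD prod_lty bab.
have ia := bmfun_rintegrable mD1 f1 ba; have ib := bmfun_rintegrable mD2 f2 bb.
rewrite {1}/Rintegral integral_mkcond -integral12_prod_meas1; last first.
  by apply/(integrable_mkcond _ mD).
have fb : (\int[m2]_(y in D2) (b y)%:E)%E \is a fin_num by exact: integrable_fin_num.
rewrite mulrC -RintegralZl //; congr fine; rewrite [RHS]integral_mkcond.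
apply: eq_integral => x _; rewrite /fubini_F patchE; case: ifPn => xD.
  transitivity (\int[m2]_(y in D2) ((a x)%:E * (b y)%:E))%E.
    rewrite [RHS]integral_mkcond; apply: eq_integral => y _.
    rewrite !patchE in_setX xD /=; case: ifP => // _; by rewrite EFinM.
  by rewrite integralZl // /Rintegral EFinM fineK // muleC.
rewrite (eq_integral (cst 0%E)) ?integral0 // => y _.
by rewrite patchE in_setX (negbTE xD).
Qed.

Lemma cintegral_prod (u : T1 -> R[i]) (v : T2 -> R[i]) : bcmfun u -> bcmfun v ->
  cintegral (m1 \x m2)%E (D1 `*` D2) (fun z => u z.1 * v z.2) =
  cintegral m1 D1 u * cintegral m2 D2 v.
Proof.
move=> [ru iu] [rv iv].
have mD : measurable (D1 `*` D2) by exact: measurableX.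
have I (a : T1 -> R) (b : T2 -> R) : bmfun a -> bmfun b ->
    rintegrable (m1 \x m2)%E (D1 `*` D2) (fun z => a z.1 * b z.2).
  move=> ba bb; apply: (bmfun_rintegrable mD prod_lty).
  by apply: bmfunM; [exact: bmfun_fst|exact: bmfun_snd].
congr Complex => /=.
  rewrite -(Rintegral_prod ru rv) -(Rintegral_prod iu iv) -RintegralB //; [|exact: I|exact: I].
  by apply: eq_Rintegral => z _; exact: RecM.
rewrite -(Rintegral_prod ru iv) -(Rintegral_prod iu rv) -RintegralD //; [|exact: I|exact: I].
by apply: eq_Rintegral => z _; exact: ImcM.
Qed.

End Products.

(** * Exponentials on the circle *)

Section Circle.
Context {R : realType}.

(* [measurableTypeR R] and [R] carry the same sigma-algebra through distinct
   structures, so the identity map has to be pushed forward. *)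
Lemma Rintegral_lebesgueR (D : set R) (f : R -> R) : measurable D ->
  measurable_fun setT f -> (@lebesgue_measure R).-integrable D (EFin \o f) ->
  \int[lebesgueR]_(x in D) f x = \int[@lebesgue_measure R]_(x in D) f x.
Proof.
move=> mD mf intf; congr fine.
pose phi : measurableTypeR R -> R := id.
have mphi : measurable_fun setT phi by move=> _ Y mY; rewrite setTI.
have := @integral_pushforward _ _ _ _ _ phi mphi (@lebesgue_measure R) D (EFin \o f).
by move=> <- //; exact/measurable_EFinP.
Qed.

Lemma cisD (a b : R) : cis (a + b) = cis a * cis b.
Proof. by congr Complex; [exact: cosD|rewrite sinD addrC]. Qed.

Lemma cisN (a : R) : cis (- a) = conjc (cis a).
Proof. by congr Complex; rewrite ?cosN ?sinN. Qed.

Lemma cis0 : cis (0 : R) = 1.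
Proof. by congr Complex; rewrite ?cos0 ?sin0. Qed.

Lemma normc_cis (a : R) : normc (cis a) = 1.
Proof. by rewrite /= cos2Dsin2 sqrtr1. Qed.

Lemma bcmfun_cis (disp : measure_display) (T : measurableType disp) (c : T -> R) :
  measurable_fun setT c -> bcmfun (fun x => cis (c x)).
Proof.
move=> mc; split; split.
- apply: (measurableT_comp _ mc); apply: continuous_measurable_fun; exact: continuous_cos.
- by exists 1 => x; exact: cos_max.
- apply: (measurableT_comp _ mc); apply: continuous_measurable_fun; exact: continuous_sin.
- by exists 1 => x; exact: sin_max.
Qed.

Lemma sin_intpi (n : int) : sin (n%:~R * pi) = 0 :> R.
Proof.
have H (m : nat) : sin (m%:R * pi) = 0 :> R.
  elim: m => [|m IH]; first by rewrite mul0r sin0.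
  by rewrite -natr1 mulrDl mul1r sinDpi IH oppr0.
by case: n => m; rewrite ?NegzE ?mulrNz ?mulNr ?sinN H ?oppr0.
Qed.

(** Real and imaginary parts have primitives with equal values at -pi and pi. *)
Lemma integral_cis (n : int) : n != 0 ->
  cintegral lebesgueR `[- pi, pi[ (fun t : R => cis (n%:~R * t)) = 0.
Proof.
move=> n0; have nR : (n%:~R : R) != 0 by rewrite intr_eq0.
have p0 := @pi_gt0 R; have pp : - pi < pi :> R by lra.
have H (F f : R -> R) : continuous F -> continuous f ->
    (forall x : R, is_derive x (1 : R) F (f x)) -> F pi = F (- pi) ->
    \int[lebesgueR]_(x in `[- pi, pi[) f x = 0.
  move=> cF cf dF e.
  have cf' : {within `[- pi, pi], continuous f} by exact: continuous_subspaceT.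
  have intf : (@lebesgue_measure R).-integrable `[- pi, pi[ (EFin \o f).
    apply: (@integrableS _ (measurableTypeR R) R _ `[- pi, pi]) => //.
      by apply: subset_itvl; rewrite bnd_simp.
    by apply: continuous_compact_integrable => //; exact: segment_compact.
  rewrite Rintegral_lebesgueR //; last exact: continuous_measurable_fun.
  rewrite Rintegral_itv_bndo_bndc //.
  have dF' : {in `]- pi, pi[, F^`()%classic =1 f}.
    by move=> x _; rewrite derive1E; have := dF x => /@derive_val ->.
  rewrite /Rintegral (continuous_FTC2 pp cf' _ dF') ?e ?subee //.
  split.
  - by move=> x _; have := dF x => -[].
  - by apply: cvg_at_right_filter; exact: cF.
  - by apply: cvg_at_left_filter; exact: cF.
have cl (c : R) : continuous (fun t : R => c * t).
  by move=> x; apply: cvgM; [exact: cvg_cst|exact: cvg_id].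
congr Complex => /=.
- apply: (H (fun t => n%:~R^-1 * sin (n%:~R * t))).
  + move=> x; apply: cvgM; first exact: cvg_cst.
    by apply: continuous_comp; [exact: cl|exact: continuous_sin].
  + by move=> x; apply: continuous_comp; [exact: cl|exact: continuous_cos].
  + by move=> x; apply: is_derive_eq; rewrite /GRing.scale /=; field.
  + by rewrite mulrN sinN sin_intpi oppr0.
- apply: (H (fun t => - (n%:~R^-1 * cos (n%:~R * t)))).
  + move=> x; apply: cvgN; apply: cvgM; first exact: cvg_cst.
    by apply: continuous_comp; [exact: cl|exact: continuous_cos].
  + by move=> x; apply: continuous_comp; [exact: cl|exact: continuous_sin].
  + by move=> x; apply: is_derive_eq; rewrite /GRing.scale /=; field.
  + by rewrite mulrN cosN.
Qed.

Lemma lebesgueR_circle : lebesgueR (`[- pi, pi[ : set R) = (2 * pi)%:E.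
Proof.
have p0 := @pi_gt0 R.
rewrite /lebesgueR lebesgue_measure_itv /= lte_fin ifT; last by lra.
by rewrite -EFinB; congr EFin; ring.
Qed.

End Circle.

Section Torus.
Context {R : realType}.

(** Frequencies are row vectors, unlike the tuples in [dot], because [trig_system] asks for an
    additive group; [dot_tuple_of_row] links the two. *)
Definition rdot n (k : 'rV[int]_n) (x : n.-tuple R) : R :=
  \sum_(i < n) (k ord0 i)%:~R * tnth x i.
Definition ex n (k : 'rV[int]_n) (x : n.-tuple R) : R[i] := cis (rdot k x).
Definition est n (s : int * 'rV[int]_n) (z : R * n.-tuple R) : R[i] :=
  cis (s.1%:~R * z.1 + rdot s.2 z.2).

Local Notation lam n := (lebesgue_tuple R n).

Definition circle : set R := `[- pi, pi[%classic.

Lemma rdotD n (k l : 'rV[int]_n) x : rdot (k + l) x = rdot k x + rdot l x.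
Proof.
by rewrite -big_split; apply: eq_bigr => i _; rewrite mxE rmorphD mulrDl.
Qed.

Lemma rdotN n (k : 'rV[int]_n) x : rdot (- k) x = - rdot k x.
Proof. by rewrite -sumrN; apply: eq_bigr => i _; rewrite mxE rmorphN mulNr. Qed.

Lemma rdot0 n (x : n.-tuple R) : rdot 0 x = 0.
Proof. by rewrite /rdot big1 // => i _; rewrite mxE mul0r. Qed.

Lemma measurable_rdot n (k : 'rV[int]_n) : measurable_fun setT (rdot k).
Proof.
apply: measurable_sum => i; apply: measurable_funM => //.
exact: measurable_tnth.
Qed.

Lemma bcmfun_ex n (k : 'rV[int]_n) : bcmfun (ex k).
Proof. by apply: bcmfun_cis; exact: measurable_rdot. Qed.

Lemma bcmfun_est n (s : int * 'rV[int]_n) : bcmfun (est s).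
Proof.
apply: bcmfun_cis; apply: measurable_funD.
  by apply: measurable_funM => //; exact: measurable_fst.
exact: (measurableT_comp (measurable_rdot s.2) measurable_snd).
Qed.

Lemma measurable_cell n : measurable (@cell R n).
Proof.
have -> : @cell R n = \bigcap_(i in [set: 'I_n]) ((fun x => tnth x i) @^-1` `[- pi, pi[).
  apply/seteqP; split => x h i => [_|].
    by rewrite /= in_itv; exact: h.
  by have := h i I; rewrite /= in_itv.
apply: fin_bigcap_measurable; first exact: finite_finset.
by move=> i _; rewrite -[X in measurable X]setTI; apply: measurable_tnth.
Qed.

Lemma tcons_cell n : @tcons R n @^-1` (@cell R n.+1) = @st_cell R n.
Proof.
apply/seteqP; split => -[t x] /=.
  move=> h; split => /=; first by rewrite in_itv /=; have := h ord0; rewrite tnth0.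
  by move=> i; have := h (lift ord0 i); rewrite tnthS.
move=> [] /=; rewrite in_itv /= => ht hx i.
case: (unliftP ord0 i) => [j ->|->]; last by rewrite tnth0.
by rewrite tnthS; exact: hx.
Qed.

Lemma lebesgue_cell n : lam n (@cell R n) = ((2 * pi) ^+ n)%:E.
Proof.
elim: n => [|n IH].
  have -> : @cell R 0 = setT by apply/seteqP; split => // x _ [].
  by rewrite /= diracT.
transitivity ((lebesgueR \x lam n)%E (@tcons R n @^-1` (@cell R n.+1))); first by [].
rewrite tcons_cell /st_cell product_measure1E //; last exact: measurable_cell.
transitivity (lebesgueR circle * lam n (@cell R n))%E; first by [].
by rewrite IH /circle lebesgueR_circle -EFinM exprS.
Qed.

Lemma lebesgue_cell_lty n : (lam n (@cell R n) < +oo)%E.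
Proof. by rewrite lebesgue_cell ltry. Qed.

Lemma circle_lty : (lebesgueR circle < +oo)%E.
Proof. by rewrite /circle lebesgueR_circle ltry. Qed.

Lemma measurable_st_cell n : measurable (@st_cell R n).
Proof. by apply: measurableX => //; exact: measurable_cell. Qed.

Lemma dxdt_st_cell n : @dxdt R n (@st_cell R n) = ((2 * pi) ^+ n.+1)%:E.
Proof.
rewrite /dxdt /= product_measure1E //; last exact: measurable_cell.
transitivity (lebesgueR circle * lam n (@cell R n))%E; first by [].
by rewrite lebesgue_cell /circle lebesgueR_circle -EFinM exprS.
Qed.

Lemma Rintegral_tcons n (g : n.+1.-tuple R -> R) : bmfun g ->
  \int[lam n.+1]_(x in @cell R n.+1) g x =
  \int[(lebesgueR \x lam n)%E]_(z in @st_cell R n) g (tcons z).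
Proof.
move=> bg; congr fine.
have mt := @measurable_tcons R n.
have := @integral_pushforward _ _ _ _ _ _ mt (lebesgueR \x lam n)%E
  (@cell R n.+1) (EFin \o g).
rewrite tcons_cell => <- //.
- by apply/measurable_EFinP; have [] := bg.
- have bgt : bmfun (fun z => g (@tcons R n z)).
    have [mg [B hB]] := bg.
    by split; [exact: (measurableT_comp mg mt)|exists B => z].
  have fst_cell : ((lebesgueR \x lam n)%E (@st_cell R n) < +oo)%E.
    by have := dxdt_st_cell n; rewrite /dxdt /= => ->; rewrite ltry.
  have mst := @measurable_st_cell n.
  exact: (bmfun_rintegrable mst fst_cell bgt).
- exact: measurable_cell.
Qed.

Lemma cintegral_tcons n (u : n.+1.-tuple R -> R[i]) : bcmfun u ->
  cintegral (lam n.+1) (@cell R n.+1) u =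
  cintegral (lebesgueR \x lam n)%E (@st_cell R n) (fun z => u (tcons z)).
Proof. by move=> [ru iu]; congr Complex; rewrite Rintegral_tcons. Qed.

(** Serves both the induction on the dimension in [cintegral_ex] and the space-time case
    [cintegral_est]. *)
Lemma cintegral_circle_cell n (m : int) (k : 'rV[int]_n) :
  m != 0 \/ cintegral (lam n) (@cell R n) (ex k) = 0 ->
  cintegral (lebesgueR \x lam n)%E (@st_cell R n)
    (fun z : R * n.-tuple R => cis (m%:~R * z.1) * ex k z.2) = 0.
Proof.
have bm : bcmfun (fun t : R => cis (m%:~R * t)).
  by apply: bcmfun_cis; exact: measurable_funM.
have mc := @measurable_cell n.
have mI : measurable circle by exact: measurable_itv.
rewrite (cintegral_prod mI mc circle_lty (lebesgue_cell_lty n) bm (bcmfun_ex k)).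
by move=> [m0|->]; rewrite ?mulr0 // /circle integral_cis // mul0r.
Qed.

Lemma cintegral_ex n (k : 'rV[int]_n) : k != 0 -> cintegral (lam n) (@cell R n) (ex k) = 0.
Proof.
elim: n k => [|n IH] k k0.
  by case/eqP: k0; apply/rowP => -[].
rewrite cintegral_tcons; last exact: bcmfun_ex.
pose k' : 'rV[int]_n := \row_i k ord0 (lift ord0 i).
rewrite -[RHS](@cintegral_circle_cell n (k ord0 ord0) k').
  apply: eq_cintegral => z _.
  rewrite /ex -cisD; congr cis; rewrite /rdot big_ord_recl tnth0; congr (_ + _).
  by apply: eq_bigr => i _; rewrite tnthS mxE.
have [k00|k00] := eqVneq (k ord0 ord0) 0; [right|by left].
apply: IH; apply: contra k0 => /eqP /rowP h; apply/eqP/rowP => i.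
rewrite mxE; case: (unliftP ord0 i) => [j ->|->]; last exact: k00.
by have := h j; rewrite !mxE.
Qed.

Lemma cintegral_est n (s : int * 'rV[int]_n) : s != 0 ->
  cintegral (@dxdt R n) (@st_cell R n) (est s) = 0.
Proof.
move=> s0; rewrite -[RHS](@cintegral_circle_cell n s.1 s.2).
  by apply: eq_cintegral => z _; rewrite /ex -cisD.
have [s10|s10] := eqVneq s.1 0; [right|by left].
apply: cintegral_ex; apply: contra s0 => /eqP s20; apply/eqP.
by rewrite (surjective_pairing s) s10 s20.
Qed.

Lemma trig_system_ex n :
  trig_system (lam n) (@cell R n) (@ex n) ((2 * pi) ^+ n).
Proof.
split.
- exact: measurable_cell.
- exact: lebesgue_cell.
- by rewrite exprn_gt0 // mulr_gt0 // pi_gt0.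
- by move=> x; rewrite /ex rdot0 cis0.
- by move=> s t x; rewrite /ex rdotD cisD.
- by move=> s x; rewrite /ex rdotN cisN.
- exact: bcmfun_ex.
- exact: cintegral_ex.
Qed.

Lemma trig_system_est n :
  trig_system (@dxdt R n) (@st_cell R n) (@est n) ((2 * pi) ^+ n.+1).
Proof.
split.
- exact: measurable_st_cell.
- exact: dxdt_st_cell.
- by rewrite exprn_gt0 // mulr_gt0 // pi_gt0.
- by move=> z; rewrite /est /= rdot0 mul0r addr0 cis0.
- by move=> s t z; rewrite /est -cisD; congr cis; rewrite /= rdotD rmorphD /=; ring.
- by move=> s z; rewrite /est -cisN; congr cis; rewrite /= rdotN rmorphN /=; ring.
- exact: bcmfun_est.
- exact: cintegral_est.
Qed.

Lemma big_setU_sub (T : Type) (I : finType) (F : I -> set (set T)) (P : set (set T)) :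
  (forall i, F i `<=` P) -> \big[setU/set0]_i F i `<=` P.
Proof.
move=> h; apply: (big_ind (fun A => A `<=` P)) => // A B hA hB x.
by case; [exact: hA|exact: hB].
Qed.

Lemma rdot_delta n (i : 'I_n) (x : n.-tuple R) : rdot (delta_mx ord0 i) x = tnth x i.
Proof.
rewrite /rdot (bigD1 i) //= big1 ?addr0 => [|j ji]; rewrite mxE eqxx /= ?eqxx ?mul1r //.
by rewrite (negPf ji) mul0r.
Qed.

(** Coordinate cylinders generate the product sigma-algebra, and the cosine and sine of a coordinate
    are trigonometric polynomials, the sine being the real part of -i e^{ix}. *)
Lemma dense_ex n (A : set (n.-tuple R)) : measurable A ->
  approximable (lam n) (@cell R n) (@ex n) (\1_A).
Proof.
move=> mA; have ts := trig_system_ex n; apply: (good_on_approximable (mu := lam n)).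
move: A mA; apply: (good_on_sigma ts); apply: big_setU_sub => i _ [B mB <-].
rewrite setTI; apply: (good_on_coord ts) => //.
- have := rtrig_Re ts (trig_e (@ex n) (delta_mx ord0 i)).
  by congr rtrig; apply/funext => x; rewrite /ex rdot_delta.
- have := rtrig_Re ts (trigZ ts (- 'i%C) (trig_e (@ex n) (delta_mx ord0 i))).
  by congr rtrig; apply/funext => x; rewrite /ex rdot_delta /=; ring.
Qed.

Lemma dense_est n (A : set (R * n.-tuple R)) : measurable A ->
  approximable (@dxdt R n) (@st_cell R n) (@est n) (\1_A).
Proof.
move=> mA; have ts := trig_system_est n; apply: (good_on_approximable (mu := @dxdt R n)).
have coord (c : R * n.-tuple R -> R) s (B : set R) : (forall z, st_cell z -> - pi <= c z < pi) ->
    (forall z, est s z = cis (c z)) -> measurable B ->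
    good_on (@dxdt R n) (@st_cell R n) (@est n) (c @^-1` B).
  move=> hc hs mB; apply: (good_on_coord ts) => //.
  - have := rtrig_Re ts (trig_e (@est n) s).
    by congr rtrig; apply/funext => x; rewrite hs.
  - have := rtrig_Re ts (trigZ ts (- 'i%C) (trig_e (@est n) s)).
    by congr rtrig; apply/funext => x; rewrite hs /=; ring.
move: A mA; apply: (good_on_sigma ts) => _ [[B mB <-]|[B mB <-]]; rewrite setTI.
  apply: (coord fst (1, 0)) => // [z [/= h _]|z]; first by move: h; rewrite in_itv.
  by rewrite /est /= rdot0 addr0 mul1r.
move: B mB; apply: smallest_sub; first split.
- by rewrite preimage_set0; exists set0 => //; exact: (good_set0 ts).
- by move=> B gB; rewrite setTD preimage_setC; exact: (good_onC ts).
- by move=> F hF; rewrite preimage_bigcup; exact: (good_on_bigcup ts).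
apply: big_setU_sub => i _ [B mB <-]; rewrite setTI.
apply: (coord (fun z => tnth z.2 i) (0, delta_mx ord0 i)) => // [z [/= _ h]|z]; first exact: h.
by rewrite /est /= rdot_delta mul0r add0r.
Qed.

End Torus.

(** * Uniform approximation of continuous periodic functions *)

Section FejerGrid.
Context {R : realType}.
Variable N : nat.
Hypothesis N0 : (0 < N)%N.
(** N + 1 nodes, because the frequencies a - b and a - b + 1 with a, b < N have absolute value at
    most N, the range where [grid_sum] gives orthogonality. *)
Let M := N.+1.

Definition grid (j : nat) : R := 2 * pi * j%:R / M%:R.

(** Fejer's kernel. Sampling it on a grid, in place of convolving with it, yields a finite sum of
    trigonometric polynomials directly. *)
Definition fejer (t : R) : R :=
  N%:R^-1 * normc (\sum_(n < N) cis (n%:R * t)) ^+ 2.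

Lemma fejer_ge0 t : 0 <= fejer t.
Proof. by rewrite mulr_ge0 ?invr_ge0 ?sqr_ge0. Qed.

Lemma cis_exp (a : R) n : cis a ^+ n = cis (n%:R * a).
Proof.
elim: n => [|n IH]; first by rewrite expr0 mul0r cis0.
by rewrite exprS IH -cisD; congr cis; rewrite -natr1; ring.
Qed.

Lemma cis2pi (n : int) : cis (2 * pi * n%:~R) = 1 :> R[i].
Proof.
have H (m : nat) : cis (2 * pi * m%:R) = 1 :> R[i].
  have e : cis (2 * pi) = 1 :> R[i].
    by congr Complex; rewrite mulr_natl ?cos2pi ?sin2pi.
  by rewrite mulrC -cis_exp e expr1n.
case: n => m; first exact: H.
by rewrite NegzE mulrNz mulrN cisN H conjc1.
Qed.

Lemma cis_neq1 (x : R) : 0 < `|x| < 2 * pi -> cis x != 1.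
Proof.
move=> /andP[x0 x1]; apply/eqP => -[h _]; move: h; rewrite -(cos_norm x).
have -> : `|x| = (`|x| / 2) *+ 2 by rewrite mulr2n -splitr.
rewrite cos_mulr2n cos2sin2 => h.
have : 0 < sin (`|x| / 2) by apply: sin_gt0_pi; apply/andP; split; lra.
move=> s0; have : sin (`|x| / 2) ^+ 2 = 0 by move: h; rewrite mulr2n; lra.
by move/eqP; rewrite sqrf_eq0 gt_eqF.
Qed.

Lemma grid_sum (m : int) (t : R) : (absz m < M)%N ->
  \sum_(j < M) cis (m%:~R * (t - grid j)) = if m == 0 then M%:R else 0.
Proof.
move=> mM; case: eqP => [->|/eqP m0].
  under eq_bigr do rewrite mul0r cis0.
  by rewrite sumr_const card_ord.
pose w : R[i] := cis (- (2 * pi * m%:~R / M%:R)).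
have -> : \sum_(j < M) cis (m%:~R * (t - grid j)) =
    cis (m%:~R * t) * \sum_(j < M) w ^+ j.
  rewrite mulr_sumr; apply: eq_bigr => j _.
  by rewrite /w cis_exp -cisD; congr cis; rewrite /grid; ring.
have p0 := @pi_gt0 R.
have w1 : w != 1.
  apply: cis_neq1; rewrite normrN normrM normfV normrM ger0_norm; last by lra.
  rewrite [`|M%:R|]ger0_norm // -intr_norm -natr_absz.
  have h : (0 < absz m)%N by rewrite absz_gt0.
  rewrite divr_gt0 ?mulr_gt0 ?ltr0n //= ltr_pdivrMr ?ltr0n //.
  by rewrite ltr_pM2l ?ltr_nat ?mulr_gt0.
have wM : w ^+ M = 1.
  rewrite /w cis_exp; have -> : M%:R * - (2 * pi * m%:~R / M%:R) = 2 * pi * (- m)%:~R :> R.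
    by rewrite mulrNz; field; rewrite pnatr_eq0.
  exact: cis2pi.
apply/eqP; rewrite mulf_eq0; apply/orP; right.
have /eqP := subrX1 w M; rewrite wM subrr eq_sym mulf_eq0 subr_eq0 (negPf w1) /=.
by [].
Qed.

Lemma fejerE t : fejer t = complex.Re
  ((N%:R^-1)%:C * \sum_(a < N) \sum_(b < N) cis ((a%:Z - b%:Z)%:~R * t)).
Proof.
rewrite RecZ /fejer; congr (_ * _).
apply: complexI; rewrite -mulc_conj.
have -> : \sum_(a < N) \sum_(b < N) cis ((a%:Z - b%:Z)%:~R * t) =
   (\sum_(n < N) cis (n%:R * t)) * conjc (\sum_(n < N) cis (n%:R * t)) :> R[i].
  rewrite mulr_suml; apply: eq_bigr => a _; rewrite rmorph_sum mulr_sumr.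
  apply: eq_bigr => b _; transitivity (cis (a%:R * t) * cis (- (b%:R * t))).
    by rewrite -cisD; congr cis; rewrite intrB; ring.
  by rewrite cisN.
by rewrite mulc_conj.
Qed.

Lemma fejer_sum t : \sum_(j < M) fejer (t - grid j) = M%:R.
Proof.
under eq_bigr do rewrite fejerE.
rewrite -Rec_sum -mulr_sumr exchange_big /=.
have -> : \sum_(a < N) \sum_(j < M) \sum_(b < N) cis ((a%:Z - b%:Z)%:~R * (t - grid j)) =
    \sum_(a < N) (M%:R : R[i]).
  apply: eq_bigr => a _; rewrite exchange_big /= (bigD1 a) //= [X in _ + X]big1 => [|b ba].
    by rewrite addr0 grid_sum ?subrr ?eqxx.
  rewrite grid_sum; first by rewrite subr_eq0 eqz_nat; case: eqP => // /val_inj ab; rewrite ab eqxx in ba.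
  have := ltn_ord a; have := ltn_ord b; rewrite /M; lia.
rewrite sumr_const card_ord RecZ -mulrnA.
have -> : ((M * N)%:R : R[i]) = ((M * N)%:R)%:C by rewrite rmorph_nat.
by rewrite /= natrM mulrC mulfK // pnatr_eq0 -lt0n.
Qed.

(** A factor e^{it} raises a - b by one, so only the N - 1 pairs with b = a + 1 survive: M - M (N -
    1) / N = M / N. *)
Lemma fejer_cos_sum t :
  \sum_(j < M) fejer (t - grid j) * (1 - cos (t - grid j)) = M%:R / N%:R.
Proof.
have -> : \sum_(j < M) fejer (t - grid j) * (1 - cos (t - grid j)) =
    \sum_(j < M) fejer (t - grid j) - \sum_(j < M) fejer (t - grid j) * cos (t - grid j).
  by rewrite -sumrB; apply: eq_bigr => j _; rewrite mulrBr mulr1.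
rewrite fejer_sum.
have -> : \sum_(j < M) fejer (t - grid j) * cos (t - grid j) = complex.Re ((N%:R^-1)%:C *
    \sum_(a < N) \sum_(b < N) \sum_(j < M) cis ((a%:Z - b%:Z + 1)%:~R * (t - grid j))).
  under [in RHS]eq_bigr do rewrite exchange_big /=.
  rewrite exchange_big /= mulr_sumr Rec_sum; apply: eq_bigr => j _.
  rewrite /fejer RecZ -mulrA; congr (_ * _).
  have -> : \sum_(a < N) \sum_(b < N) cis ((a%:Z - b%:Z + 1)%:~R * (t - grid j)) =
      (normc (\sum_(n < N) cis (n%:R * (t - grid j))) ^+ 2)%:C * cis (t - grid j).
    rewrite -mulc_conj mulr_suml mulr_suml; apply: eq_bigr => a _.
    rewrite rmorph_sum mulr_sumr mulr_suml; apply: eq_bigr => b _.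
    transitivity (cis (a%:R * (t - grid j)) * cis (- (b%:R * (t - grid j))) * cis (t - grid j)).
      by rewrite -!cisD; congr cis; rewrite intrD intrB; ring.
    by rewrite cisN.
  by rewrite RecZ.
have -> : \sum_(a < N) \sum_(b < N) \sum_(j < M) cis ((a%:Z - b%:Z + 1)%:~R * (t - grid j)) =
    \sum_(a < N) \sum_(b < N) (if b == a.+1 :> nat then M%:R else 0 : R[i]).
  apply: eq_bigr => a _; apply: eq_bigr => b _.
  rewrite grid_sum; last by have := ltn_ord a; have := ltn_ord b; rewrite /M; lia.
  by congr (if _ then _ else _); apply/eqP/eqP; lia.
have -> : \sum_(a < N) \sum_(b < N) (if b == a.+1 :> nat then M%:R else 0 : R[i]) =
    (N.-1 * M)%:R.
  case: N N0 => // n _; rewrite big_ord_recr /= [X in _ + X]big1 ?addr0 => [|b _]; last first.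
    by case: eqP => // h; have := ltn_ord b; rewrite h ltnn.
  rewrite (eq_bigr (fun=> M%:R)) => [|a _]; first by rewrite sumr_const card_ord -mulrnA mulnC.
  have an : (a.+1 < n.+1)%N by have := ltn_ord a.
  rewrite (bigD1 (Ordinal an)) //= eqxx big1 ?addr0 // => b /eqP ba.
  by case: eqP => // h; case: ba; exact: val_inj.
rewrite RecZ; have -> : ((N.-1 * M)%:R : R[i]) = ((N.-1 * M)%:R)%:C by rewrite rmorph_nat.
rewrite /= natrM -subn1 natrB //; field.
by rewrite pnatr_eq0 -lt0n.
Qed.

End FejerGrid.

Section UniformContinuity.
Context {R : realType} (d : nat).
Variable phi : R * d.-tuple R -> R.
Hypothesis cphi : continuous phi.
Hypothesis pphi : st_periodic phi.

(** Passes to row vectors, where boxes are compact by [rV_compact] and balls are described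
    coordinatewise. *)
Definition st_point (v : 'rV[R]_d.+1) : R * d.-tuple R :=
  (v ord0 ord0, [tuple v ord0 (lift ord0 i) | i < d]).

Definition st_coord (z : R * d.-tuple R) : 'rV[R]_d.+1 := \row_i tnth (tcons z) i.

Lemma st_coordK z : st_point (st_coord z) = z.
Proof.
case: z => t x; congr pair; first by rewrite mxE tnth0.
by apply: eq_from_tnth => i; rewrite tnth_mktuple mxE tnthS.
Qed.

Let Phi v := phi (st_point v).

Lemma Phi_continuous (v : 'rV[R]_d.+1) (eps : R) : 0 < eps -> exists2 delta, 0 < delta &
  forall u : 'rV[R]_d.+1, (forall i, `|u ord0 i - v ord0 i| < delta) -> `|Phi u - Phi v| < eps.
Proof.
move=> eps0; have := @cphi (st_point v) _ (nbhsx_ballx (phi (st_point v)) eps eps0).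
move=> [[A B] /= [nA nB] sAB].
have [d1 /= d10 hA] := (nbhs_ballP _ _).1 nA.
have : exists2 d2, 0 < d2 & forall x : d.-tuple R,
    (forall i, `|tnth x i - v ord0 (lift ord0 i)| < d2) -> B x.
  move: nB; rewrite nbhsE => -[_ [[W oW <-] Wv] sW].
  have /nbhs_ballP [d2 /= d20 hW] : nbhs (\row_i tnth (st_point v).2 i) W.
    by apply: open_nbhs_nbhs; split.
  exists d2 => // x hx; apply: sW; apply: hW; split => // i j.
  rewrite !mxE tnth_mktuple -ball_normE /= distrC; exact: hx.
move=> [d2 d20 hB]; exists (Num.min d1 d2); first by rewrite lt_min d10.
move=> u hu; rewrite distrC; apply: (sAB (st_point u)); split => /=.
  by apply: hA; rewrite -ball_normE /= distrC (lt_le_trans (hu ord0)) // ge_min lexx.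
apply: hB => i; rewrite tnth_mktuple (lt_le_trans (hu _)) //.
by rewrite ge_min lexx orbT.
Qed.

(** In [korovkin], v is moved into [-pi, pi) and then u to within pi of v in each coordinate; this
    box contains both. *)
Let K : set 'rV[R]_d.+1 := [set v | forall i, `[- (2 * pi), 2 * pi]%classic (v ord0 i)].

Let cK : compact K.
Proof.
apply: (@rV_compact _ _ (fun=> `[- (2 * pi), 2 * pi]%classic)) => i.
exact: segment_compact.
Qed.

Lemma near_coord (v : 'rV[R]_d.+1) (delta : R) : 0 < delta ->
  nbhs v [set v' : 'rV[R]_d.+1 | forall i, `|v' ord0 i - v ord0 i| < delta].
Proof.
move=> d0; apply/nbhs_ballP; exists delta => //= u [_ hu] i.
by have := hu ord0 i; rewrite -ball_normE /= distrC.
Qed.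

Lemma Phi_unif (eps : R) : 0 < eps -> exists2 delta, 0 < delta &
  forall u v : 'rV[R]_d.+1, K v ->
  (forall i, `|u ord0 i - v ord0 i| < delta) -> `|Phi u - Phi v| < eps.
Proof.
move=> eps0; have e2 : 0 < eps / 2 by rewrite divr_gt0.
have nc := (compact_near_coveringP K).1 cK.
pose P (n : nat) (v : 'rV[R]_d.+1) := forall u : 'rV[R]_d.+1,
  (forall i, `|u ord0 i - v ord0 i| < n.+1%:R^-1) -> `|Phi u - Phi v| < eps.
have [|n _ hn] := nc nat \oo P _.
  move=> v _; have [delta d0 hd] := Phi_continuous v e2.
  have d2 : 0 < delta / 2 by rewrite divr_gt0.
  exists ([set v' : 'rV[R]_d.+1 | forall i, `|v' ord0 i - v ord0 i| < delta / 2],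
    [set n | n.+1%:R^-1 < delta / 2]).
    by split; [exact: near_coord|exact: near_infty_natSinv_lt (PosNum d2)].
  move=> [v' n] /= [hv' hn] u hu.
  have -> : Phi u - Phi v' = (Phi u - Phi v) - (Phi v' - Phi v) by ring.
  rewrite (le_lt_trans (ler_normB _ _)) // [ltRHS](splitr eps) ltrD //; apply: hd => i.
    have -> : u ord0 i - v ord0 i = (u ord0 i - v' ord0 i) + (v' ord0 i - v ord0 i) by ring.
    rewrite (le_lt_trans (ler_normD _ _)) // [ltRHS](splitr delta) ltrD //.
    exact: lt_trans (hu i) hn.
  by rewrite (lt_trans (hv' i)) // ltr_pdivrMr // ltr_pMr // ltr1n.
exists n.+1%:R^-1 => // u v Kv; exact: (hn n (leqnn _) v Kv).
Qed.

Lemma Phi_bounded : exists2 B, 0 <= B & forall v : 'rV[R]_d.+1, K v -> `|Phi v| <= B.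
Proof.
have nc := (compact_near_coveringP K).1 cK.
pose P (n : nat) (v : 'rV[R]_d.+1) := `|Phi v| <= n%:R.
have [|n _ hn] := nc nat \oo P _.
  move=> v _; have [delta d0 hd] := Phi_continuous v ltr01.
  exists ([set v' : 'rV[R]_d.+1 | forall i, `|v' ord0 i - v ord0 i| < delta],
    [set n | `|Phi v| + 1 <= n%:R]).
    split; first exact: near_coord.
    exists (Num.truncn (`|Phi v| + 1)).+1 => // n /= hn.
    by rewrite (le_trans (ltW (truncnS_gt _))) // ler_nat.
  move=> [v' n] /= [hv' hn]; rewrite /P (le_trans _ hn) //.
  have -> : Phi v' = Phi v + (Phi v' - Phi v) by ring.
  by rewrite (le_trans (ler_normD _ _)) // lerD2l ltW // hd.
by exists n%:R => // v Kv; exact: (hn n (leqnn _) v Kv).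
Qed.

Lemma Phi_periodic (v : 'rV[R]_d.+1) (m : 'I_d.+1 -> int) :
  Phi (\row_i (v ord0 i + 2 * pi * (m i)%:~R)) = Phi v.
Proof.
rewrite /Phi [in RHS]/st_point -(pphi (v ord0 ord0) _ (m ord0) [tuple m (lift ord0 i) | i < d]).
congr phi.
congr pair; first by rewrite mxE.
by apply: eq_from_tnth => i; rewrite !tnth_mktuple mxE.
Qed.

Lemma shift_period (c x : R) : exists m : int, c - pi <= x + 2 * pi * m%:~R < c + pi.
Proof.
have p0 := @pi_gt0 R; have p2 : 0 < 2 * pi :> R by lra.
exists (- Num.floor ((x - c + pi) / (2 * pi))).
rewrite mulrNz mulrN; set q := Num.floor _.
have /andP[] := floor_itv ((x - c + pi) / (2 * pi)); rewrite -/q.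
rewrite ler_pdivlMr // ltr_pdivrMr // intrD; lra.
Qed.

Lemma cosD2piz (x : R) (m : int) : cos (x + 2 * pi * m%:~R) = cos x.
Proof.
have H (n : nat) (y : R) : cos (y + 2 * pi * n%:R) = cos y.
  elim: n y => [|n IH] y; first by rewrite mulr0 addr0.
  rewrite -[RHS]IH -[RHS]cosD2pi; congr cos.
  by rewrite -natr1 mulr2n; ring.
case: m => n; first exact: H.
rewrite NegzE mulrNz -[LHS](H n.+1); congr cos; rewrite pmulrn; ring.
Qed.

(* Korovkin's bound: continuity is tested on the functions [1 - cos] only. *)
Lemma korovkin (eps : R) : 0 < eps -> exists2 C, 0 <= C & forall u v : 'rV[R]_d.+1,
  `|Phi u - Phi v| <= eps + C * \sum_i (1 - cos (u ord0 i - v ord0 i)).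
Proof.
move=> eps0; have p0 := @pi_gt0 R.
have [delta0 d00 hd] := Phi_unif eps0; have [B B0 hB] := Phi_bounded.
pose delta := Num.min delta0 (pi / 2).
have d0 : 0 < delta by rewrite lt_min d00 divr_gt0.
have dpi : delta <= pi / 2 by rewrite ge_min lexx orbT.
have cd : 0 < 1 - cos delta.
  by rewrite subr_gt0 -(@cos0 R) ltr_cos ?in_itv /=; lra.
exists (2 * B / (1 - cos delta)) => [|u v].
  by rewrite divr_ge0 ?mulr_ge0 // ltW.
have [mv hmv] := choice (fun i => shift_period 0 (v ord0 i)).
pose v' : 'rV[R]_d.+1 := \row_i (v ord0 i + 2 * pi * (mv i)%:~R).
have [mu hmu] := choice (fun i => shift_period (v' ord0 i) (u ord0 i)).
pose u' : 'rV[R]_d.+1 := \row_i (u ord0 i + 2 * pi * (mu i)%:~R).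
have -> : Phi u = Phi u' by rewrite Phi_periodic.
have -> : Phi v = Phi v' by rewrite Phi_periodic.
have -> : \sum_i (1 - cos (u ord0 i - v ord0 i)) = \sum_i (1 - cos (u' ord0 i - v' ord0 i)).
  apply: eq_bigr => i _; congr (1 - _); rewrite !mxE -(cosD2piz _ (mu i - mv i)).
  by congr cos; rewrite intrB; ring.
have Kv : K v'.
  by move=> i; have := hmv i; rewrite /= in_itv /= mxE; lra.
have Ku : K u'.
  move=> i; have := hmv i; have := hmu i; rewrite /= in_itv /= !mxE; lra.
have c0 i : 0 <= 1 - cos (u' ord0 i - v' ord0 i) by rewrite subr_ge0 cos_le1.
have [h|] := pselect (forall i, `|u' ord0 i - v' ord0 i| < delta).
  rewrite ler_wpDr ?mulr_ge0 ?sumr_ge0 ?divr_ge0 ?mulr_ge0 // ?(ltW cd) //.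
  apply: ltW; apply: hd => // i; rewrite (lt_le_trans (h i)) // ge_min lexx //.
move=> nh; have [i /negP] := (existsNP _).2 nh; rewrite -leNgt => hi.
apply: ler_wpDl; first exact: ltW.
apply: (@le_trans _ _ (2 * B / (1 - cos delta) * (1 - cos (u' ord0 i - v' ord0 i)))).
  rewrite (le_trans (ler_normB _ _)) // -mulrA.
  apply: (@le_trans _ _ (2 * B)); first by have := hB _ Ku; have := hB _ Kv; lra.
  rewrite ler_peMr ?mulr_ge0 // mulrC ler_pdivlMr // mul1r lerD2l lerN2 -cos_norm.
  rewrite leNgt ltr_cos ?in_itv /= ?normr_ge0 /= -?leNgt //; last by lra.
  by have := hmu i; rewrite ler_norml !mxE; lra.
rewrite ler_wpM2l ?divr_ge0 ?mulr_ge0 ?(ltW cd) //.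
by rewrite (bigD1 i) //= lerDl sumr_ge0.
Qed.

End UniformContinuity.

Section UniformApproximation.
Context {R : realType} (d : nat).
Local Notation e := (@est R d).
Local Notation rtrig := (rtrig e).
Let ts := @trig_system_est R d.

Lemma trig_axis (i : 'I_d.+1) (m : int) :
  trig e (fun z => cis (m%:~R * st_coord z ord0 i)).
Proof.
case: (unliftP ord0 i) => [j ->|->].
  apply: (trig_ext _ (trig_e e (0, m *: delta_mx ord0 j))) => z.
  rewrite /est /= mul0r add0r mxE tnthS; congr cis.
  rewrite -rdot_delta /rdot mulr_sumr; apply: eq_bigr => k _.
  by rewrite mxE rmorphM /= mulrA.
apply: (trig_ext _ (trig_e e (m, 0))) => z.
by rewrite /est /= rdot0 addr0 mxE tnth0.
Qed.

Lemma rtrig_fejer (N : nat) (i : 'I_d.+1) (c : R) :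
  rtrig (fun z => fejer N (st_coord z ord0 i - c)).
Proof.
have -> : (fun z => fejer N (st_coord z ord0 i - c)) = (fun z => complex.Re
    ((N%:R^-1)%:C * \sum_(a < N) \sum_(b < N)
      cis (- ((a%:Z - b%:Z)%:~R * c)) * cis ((a%:Z - b%:Z)%:~R * st_coord z ord0 i))).
  apply/funext => z; rewrite fejerE; congr (complex.Re (_ * _)).
  apply: eq_bigr => a _; apply: eq_bigr => b _; rewrite -cisD; congr cis; ring.
apply: (rtrig_Re ts); apply: (trigZ ts); apply: (trig_sum ts) => a; apply: (trig_sum ts) => b.
by apply: (trigZ ts); exact: trig_axis.
Qed.

Lemma rtrig_prod (I : Type) (s : seq I) (F : I -> R * d.-tuple R -> R) :
  (forall i, rtrig (F i)) -> rtrig (fun z => \prod_(i <- s) F i z).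
Proof.
move=> h; apply: (trig_ext _ (trig_prod ts s h)) => z.
by rewrite rmorph_prod.
Qed.

Lemma rtrig_sum (I : Type) (s : seq I) (F : I -> R * d.-tuple R -> R) :
  (forall i, rtrig (F i)) -> rtrig (fun z => \sum_(i <- s) F i z).
Proof.
move=> h; apply: (trig_ext _ (trig_sum ts s h)) => z.
by rewrite rmorph_sum.
Qed.

(** Average the values of phi at the nodes with tensor Fejer weights. These are nonnegative with sum
    1 ([sumK]) and give 1 - cos the mean 1 / N in each coordinate ([sumK2]), so [korovkin] bounds
    the error by eps / 2 + C (d + 1) / N. *)
Lemma uniform_trig (phi : R * d.-tuple R -> R) : continuous phi -> st_periodic phi ->
  forall eps, 0 < eps -> exists P, rtrig P /\ forall z, `|phi z - P z| <= eps.
Proof.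
move=> cphi pphi eps eps0; have e2 : 0 < eps / 2 by rewrite divr_gt0.
have [C C0 hC] := korovkin cphi pphi e2.
pose N := (Num.truncn (C * d.+1%:R / (eps / 2))).+1; pose M := N.+1.
have N0 : (0 < N)%N by [].
have hN : C * (d.+1%:R / N%:R) <= eps / 2.
  rewrite mulrA ler_pdivrMr ?ltr0n // [eps / 2 * _]mulrC -ler_pdivrMr //.
  have := truncnS_gt (C * d.+1%:R / (eps / 2)); rewrite -/N => /ltW; exact.
pose th (y : {ffun 'I_d.+1 -> 'I_M}) : 'rV[R]_d.+1 := \row_i grid N (y i).
pose K (y : {ffun 'I_d.+1 -> 'I_M}) z : R :=
  \prod_i fejer N (st_coord z ord0 i - grid N (y i)).
have K0 y z : 0 <= K y z by apply: prodr_ge0 => i _; exact: fejer_ge0.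
pose c : R := (M%:R ^+ d.+1)^-1.
have M0 : 0 < M%:R ^+ d.+1 :> R by rewrite exprn_gt0 // ltr0n.
have c0 : 0 <= c by rewrite invr_ge0 ltW.
have sumK z : c * \sum_y K y z = 1.
  rewrite /K -(bigA_distr_bigA (fun (i : 'I_d.+1) (j : 'I_M) => fejer N (st_coord z ord0 i - grid N j))) /=.
  under eq_bigr do rewrite fejer_sum //.
  by rewrite prodr_const card_ord mulVf // gt_eqF.
have sumK2 z i : c * \sum_y K y z * (1 - cos (st_coord z ord0 i - grid N (y i))) = N%:R^-1.
  pose F (k : 'I_d.+1) (j : 'I_M) : R := fejer N (st_coord z ord0 k - grid N j) *
    (if k == i then 1 - cos (st_coord z ord0 k - grid N j) else 1).
  have -> : \sum_y K y z * (1 - cos (st_coord z ord0 i - grid N (y i))) =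
     \sum_(y : {ffun 'I_d.+1 -> 'I_M}) \prod_k F k (y k).
    apply: eq_bigr => y _; rewrite /F big_split /=; congr (_ * _).
    by rewrite (bigD1 i) //= eqxx big1 ?mulr1 // => k /negPf ->.
  rewrite -bigA_distr_bigA /= (bigD1 i) //= [X in _ * (_ * X)](eq_bigr (fun=> M%:R)) => [|k ki]; last first.
    by under eq_bigr do rewrite /F (negPf ki) mulr1; rewrite fejer_sum.
  under eq_bigr do rewrite /F eqxx.
  rewrite fejer_cos_sum // prodr_const cardC1 card_ord /= /c exprS.
  have N1 : N%:R != 0 :> R by rewrite pnatr_eq0.
  have M1 : M%:R != 0 :> R by rewrite pnatr_eq0.
  rewrite -/M; move: (M%:R : R) M1 (N%:R : R) N1 => y y0 w w0.
  by field; rewrite w0 y0 expf_neq0.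
exists (fun z => c * \sum_y phi (st_point (th y)) * K y z); split.
  apply: (rtrigM ts); first exact: (rtrig_cst ts).
  apply: rtrig_sum => y; apply: (rtrigM ts); first exact: (rtrig_cst ts).
  by apply: rtrig_prod => i; exact: rtrig_fejer.
move=> z; rewrite -{1}[phi z]mulr1 -(sumK z) mulrCA -mulrBr mulr_sumr -sumrB.
rewrite normrM (ger0_norm c0).
apply: (@le_trans _ _ (c * \sum_y (K y z * (eps / 2) +
    \sum_i C * (K y z * (1 - cos (st_coord z ord0 i - grid N (y i))))))).
  rewrite ler_wpM2l // (le_trans (ler_norm_sum _ _ _)) //; apply: ler_sum => y _.
  rewrite -mulrBl normrM (ger0_norm (K0 y z)) mulrC.
  have -> : \sum_i C * (K y z * (1 - cos (st_coord z ord0 i - grid N (y i)))) =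
      K y z * (C * \sum_i (1 - cos (st_coord z ord0 i - grid N (y i)))).
    by rewrite !mulr_sumr; apply: eq_bigr => i _; rewrite mulrCA.
  rewrite -mulrDr ler_wpM2l // -{1}(st_coordK z) (le_trans (hC _ _)) //.
  by rewrite lerD2l ler_wpM2l // ler_sum // => i _; rewrite !mxE.
rewrite big_split /= mulrDr -mulr_suml mulrA sumK mul1r exchange_big /= mulr_sumr.
rewrite (eq_bigr (fun=> C * N%:R^-1)) => [|i _]; last first.
  by rewrite -mulr_sumr mulrCA sumK2.
rewrite sumr_const card_ord [leRHS](splitr eps) lerD2l.
by apply: le_trans hN; rewrite -[leLHS]mulr_natr -mulrA [N%:R^-1 * _]mulrC.
Qed.

Lemma continuous_periodic_bmfun (phi : R * d.-tuple R -> R) :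
  continuous phi -> st_periodic phi -> bmfun phi.
Proof.
move=> cphi pphi.
have h n : exists P, rtrig P /\ forall z, `|phi z - P z| <= n.+1%:R^-1.
  by apply: uniform_trig; rewrite ?invr_gt0.
have [P hP] := choice h.
split.
  apply: (measurable_fun_cvg (h := P)) => [n|z _].
    by have [/(rtrig_bmfun ts)[]] := hP n.
  apply/cvgrPdist_le => eps eps0.
  have [k _ hk] := near_infty_natSinv_lt (PosNum eps0).
  by exists k => // n /= kn; have [_ /(_ z) hz] := hP n; rewrite (le_trans hz) // ltW // hk.
have [tP hz] := hP 0%N; have [_ [B hB]] := rtrig_bmfun ts tP.
exists (1 + B) => z; have -> : phi z = (phi z - P 0%N z) + P 0%N z by rewrite subrK.
by rewrite (le_trans (ler_normD _ _)) // lerD // (le_trans (hz z)) // invr1.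
Qed.

End UniformApproximation.

(** * Free waves *)

Section SquareIntegrable.
Context {R : realType} {disp : measure_display} {T : measurableType disp}.
Variables (mu : {measure set T -> \bar R}) (D : set T).
Hypothesis mD : measurable D.
Implicit Types (u v : T -> R[i]).

Lemma normc_sqrM (z w : R[i]) : normc (z * w) ^+ 2 = normc z ^+ 2 * normc w ^+ 2.
Proof. by rewrite normcM exprMn. Qed.

Lemma sqr_normcD_le (z w : R[i]) :
  normc (z + w) ^+ 2 <= 2 * normc z ^+ 2 + 2 * normc w ^+ 2.
Proof.
rewrite !sqr_normcE RecD ImcD.
have := sqr_ge0 (complex.Re z - complex.Re w).
have := sqr_ge0 (complex.Im z - complex.Im w).
nra.
Qed.

Lemma cmeasurable_lin a u v : cmeasurable u -> cmeasurable v ->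
  cmeasurable (fun x => a * u x + v x).
Proof.
move=> [ru iu] [rv iv]; split.
  under eq_fun do rewrite RecD RecM.
  by apply: measurable_funD => //; apply: measurable_funB; apply: measurable_funM.
under eq_fun do rewrite ImcD ImcM.
by apply: measurable_funD => //; apply: measurable_funD; apply: measurable_funM.
Qed.

Lemma le_rintegrable (g h : T -> R) : measurable_fun D g ->
  (forall x, D x -> `|g x| <= h x) -> rintegrable mu D h -> rintegrable mu D g.
Proof.
move=> mg gh ih; apply: (le_integrable mD _ _ ih) => [|x Dx /=].
  exact/measurable_EFinP.
by rewrite lee_fin (le_trans (gh x Dx)) // ler_norm.
Qed.

Lemma rintegrableB (g h : T -> R) : rintegrable mu D g -> rintegrable mu D h ->
  rintegrable mu D (fun x => g x - h x).
Proof. by move=> ig ih; apply: rintegrableD => //; exact: rintegrableN. Qed.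

Lemma L2fun_lin a u v : L2fun mu D u -> L2fun mu D v -> L2fun mu D (fun x => a * u x + v x).
Proof.
move=> [mu_ iu] [mv iv]; have m := cmeasurable_lin a mu_ mv; split => //.
apply: (@le_rintegrable _ (fun x => 2 * normc a ^+ 2 * normc (u x) ^+ 2 + 2 * normc (v x) ^+ 2)).
- by apply: measurable_funTS; exact: cmeasurable_sqr.
- move=> x _; rewrite ger0_norm ?sqr_ge0 // (le_trans (sqr_normcD_le _ _)) //.
  by rewrite normc_sqrM mulrA.
- by apply: rintegrableD => //; apply: rintegrableZ.
Qed.

Lemma L2norm_fine u : rintegrable mu D (fun x => normc (u x) ^+ 2) ->
  L2norm mu D u = (Num.sqrt (\int[mu]_(x in D) normc (u x) ^+ 2))%:E.
Proof.
move=> iu; rewrite /L2norm -powR12_sqrt; last by apply: Rintegral_ge0 => x _; exact: sqr_ge0.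
by rewrite -poweR_EFin fineK //; exact: integrable_fin_num.
Qed.

Lemma memL2P u : memL2 mu D u <-> L2fun mu D u.
Proof.
split=> -[mu_ h]; split => //.
  apply/integrableP; split.
    by apply/measurable_EFinP; apply: measurable_funTS; exact: cmeasurable_sqr.
  under eq_integral => x _ do rewrite /= ger0_norm ?sqr_ge0 //.
  by apply: lty_poweRy h; rewrite invr_eq0.
by rewrite L2norm_fine // ltry.
Qed.

Definition sqI u := \int[mu]_(x in D) normc (u x) ^+ 2.

Lemma sqI_ge0 u : 0 <= sqI u.
Proof. by apply: Rintegral_ge0 => x _; exact: sqr_ge0. Qed.

End SquareIntegrable.

(** Parseval bounds one norm by finitely many coefficients up to eps, and Bessel bounds these by the
    other norm. *)
Lemma sqI_eq_coef {R : realType} {disp : measure_display} {T : measurableType disp}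
  (mu : {measure set T -> \bar R}) (D : set T) (Gm : zmodType)
  (e : Gm -> T -> R[i]) (M : R) (ts : trig_system mu D e M)
  (dens : forall A, measurable A -> approximable mu D e (\1_A)) (u v : T -> R[i]) :
  L2fun mu D u -> L2fun mu D v ->
  (forall s, normc (fc mu D e M u s) = normc (fc mu D e M v s)) -> sqI mu D u = sqI mu D v.
Proof.
have key (w w' : T -> R[i]) : L2fun mu D w -> L2fun mu D w' ->
    (forall s, normc (fc mu D e M w s) = normc (fc mu D e M w' s)) -> sqI mu D w <= sqI mu D w'.
  move=> Lw Lw' h; apply/ler_addgt0Pr => eps eps0.
  have [F0 /(_ (undup F0) (undup_uniq _))] := parseval ts dens Lw eps0.
  have sub : {subset F0 <= undup F0} by move=> x; rewrite mem_undup.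
  move=> /(_ sub); rewrite lerBlDl => /le_trans; apply; rewrite lerD2r.
  under eq_bigr do rewrite h.
  by apply: (bessel ts) => //; exact: undup_uniq.
by move=> Lu Lv h; apply/le_anti; rewrite !key.
Qed.

Section Waves.
Context {R : realType} (d : nat).
Local Notation lam := (lebesgue_tuple R d).
Local Notation Q := (@cell R d).
Local Notation SQ := (@st_cell R d).
Local Notation M0 := ((2 * pi) ^+ d : R).
Local Notation M1 := ((2 * pi) ^+ d.+1 : R).
Local Notation fcx := (fc lam Q (@ex R d) M0).
Implicit Types (f g : d.-tuple R -> R[i]) (u v : R * d.-tuple R -> R[i])
  (s : seq 'rV[int]_d) (a : 'rV[int]_d -> R[i]) (k : 'rV[int]_d).

Let tsx := trig_system_ex (R := R) d.
Let tst := trig_system_est (R := R) d.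
Let mQ := @measurable_cell R d.
Let mSQ := @measurable_st_cell R d.
Let fQ := @lebesgue_cell_lty R d.
Let fSQ : (@dxdt R d SQ < +oo)%E.
Proof. by rewrite dxdt_st_cell ltry. Qed.

Definition tuple_of_row k : d.-tuple int := [tuple k ord0 i | i < d].

Lemma tuple_of_row_surj (k : d.-tuple int) : exists k', k = tuple_of_row k'.
Proof.
exists (\row_i tnth k i); apply: eq_from_tnth => i.
by rewrite tnth_mktuple mxE.
Qed.

Lemma dot_tuple_of_row k (x : d.-tuple R) : dot (tuple_of_row k) x = rdot k x.
Proof. by apply: eq_bigr => i _; rewrite tnth_mktuple. Qed.

Lemma sqlen_tuple_of_row k : sqlen (tuple_of_row k) = (idot k k)%:~R :> R.
Proof.
rewrite /idot rmorph_sum; apply: eq_bigr => i _.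
by rewrite tnth_mktuple rmorphM expr2.
Qed.

Lemma fourier_fc f k : fourier f (tuple_of_row k) = fcx f k.
Proof.
rewrite /fourier /fc; congr (_ * _); apply: eq_cintegral => x _.
by rewrite dot_tuple_of_row /ex rdotN.
Qed.

Lemma L2T_L2fun f : L2T f -> L2fun lam Q f.
Proof. by move=> [_ /(memL2P lam mQ _)]. Qed.

Lemma L2T_lin (c : R[i]) f g : L2T f -> L2T g -> L2T (fun x => c * f x + g x).
Proof.
move=> [pu /(memL2P lam mQ _) Lu] [pv /(memL2P lam mQ _) Lv]; split.
  by move=> x k; rewrite pu pv.
by apply/(memL2P lam mQ _); exact: L2fun_lin.
Qed.

Lemma fourier_lin (c : R[i]) f g (k : d.-tuple int) : L2T f -> L2T g ->
  fourier (fun x => c * f x + g x) k = c * fourier f k + fourier g k.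
Proof.
move=> /L2T_L2fun Lu /L2T_L2fun Lv; have [k' ->] := tuple_of_row_surj k; rewrite !fourier_fc /fc.
have iu := L2fun_cintegrable tsx Lu; have iv := L2fun_cintegrable tsx Lv.
have be := bcmfun_ex (R := R) (- k').
rewrite (@eq_cintegral _ _ _ _ _ _ (fun x => c * (f x * ex (- k') x) + g x * ex (- k') x)).
  rewrite cintegralD ?cintegralZ //; first by ring.
  - exact: cintegrableM.
  - by apply: cintegrableZ => //; exact: cintegrableM.
  - exact: cintegrableM.
by move=> x _; ring.
Qed.

Lemma propagation_lin (c : R[i]) f g u v : L2T f -> L2T g ->
  is_propagation f u -> is_propagation g v ->
  is_propagation (fun x => c * f x + g x) (fun z => c * u z + v z).
Proof.
move=> Lu0 Lv0 [mu_ hu] [mv hv]; split; first exact: cmeasurable_lin.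
move=> t; have [Lu cu] := hu t; have [Lv cv] := hv t.
split; first exact: L2T_lin.
by move=> k; rewrite !fourier_lin // cu cv; ring.
Qed.

Lemma waves_lin (c : R[i]) u v : waves u -> waves v -> waves (fun z => c * u z + v z).
Proof.
move=> [f Lu pu] [g Lv pv]; exists (fun x => c * f x + g x).
  exact: L2T_lin.
exact: propagation_lin.
Qed.

Lemma sqI_propagation f u (t : R) : L2T f -> is_propagation f u ->
  sqI lam Q (fun x => u (t, x)) = sqI lam Q f.
Proof.
move=> Lu0 [_ /(_ t) [Lu cu]]; apply: (sqI_eq_coef tsx (@dense_ex R d)).
- exact: L2T_L2fun.
- exact: L2T_L2fun.
move=> k; have := cu (tuple_of_row k); rewrite !fourier_fc => ->.
by rewrite normcM normc_cis mul1r.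
Qed.

(** The multiplier has modulus 1, so every time slice has the norm of f; Tonelli, applicable as u is
    jointly measurable, integrates this over a period 2 pi. *)
Lemma energy f u : L2T f -> is_propagation f u ->
  L2fun (@dxdt R d) SQ u /\ sqI (@dxdt R d) SQ u = 2 * pi * sqI lam Q f.
Proof.
move=> Lu0 pu; have [mu_ hu] := pu.
pose G z : \bar R := (normc (u z) ^+ 2)%:E.
have mG : measurable_fun setT G by apply/measurable_EFinP; exact: cmeasurable_sqr.
have E : (\int[@dxdt R d]_(z in SQ) G z = (2 * pi * sqI lam Q f)%:E)%E.
  rewrite integral_mkcond /dxdt fubini_tonelli1 /=; last first.
  - by move=> z; rewrite patchE; case: ifP => // _; rewrite lee_fin sqr_ge0.
  - by apply/(measurable_restrictT _ _).1 => //; exact: measurable_funTS.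
  transitivity (\int[lebesgueR]_(t in circle) (sqI lam Q f)%:E)%E.
    rewrite [RHS]integral_mkcond; apply: eq_integral => t _.
    rewrite /fubini_F patchE; case: ifPn => tI.
      rewrite -(sqI_propagation t Lu0 pu) /sqI /Rintegral fineK; last first.
        apply: integrable_fin_num => //.
        by have [/L2T_L2fun [_]] := hu t.
      rewrite [RHS]integral_mkcond; apply: eq_integral => x _.
      by rewrite !patchE in_setX tI.
    rewrite (eq_integral (cst 0%E)) ?integral0 // => y _.
    by rewrite patchE in_setX (negbTE tI).
  rewrite integral_cst //=; last exact: measurable_itv.
  by rewrite [lebesgueR circle]lebesgueR_circle -EFinM mulrC.
split; last by rewrite /sqI /Rintegral E.
split => //; apply/integrableP; split.
  by apply: measurable_funTS.
under eq_integral => x _ do rewrite /= ger0_norm ?sqr_ge0 //.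
by rewrite E ltry.
Qed.

Lemma waves_L2fun u : waves u -> L2fun (@dxdt R d) SQ u.
Proof. by move=> [f Lu0 pu]; have [] := energy Lu0 pu. Qed.

Definition wave s a : R * d.-tuple R -> R[i] :=
  psum (@est R d) (fun r => a r.2) (map (@freq d) s).

Lemma waveE s a z : wave s a z = \sum_(k <- s) a k * est (freq k) z.
Proof. by rewrite /wave /psum big_map. Qed.

Lemma freq_inj : injective (@freq d).
Proof. by move=> k l []. Qed.

Lemma sqI_wave s a : uniq s -> sqI (@dxdt R d) SQ (wave s a) = M1 * mass s a.
Proof.
move=> us; rewrite /sqI (norm2_psum tst); last by rewrite map_inj_uniq //; exact: freq_inj.
by rewrite big_map.
Qed.

Lemma wave_slice s a t : (fun x => wave s a (t, x)) =
  psum (@ex R d) (fun k => cis (- t * (idot k k)%:~R) * a k) s.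
Proof.
apply/funext => x; rewrite waveE; apply: eq_bigr => k _.
rewrite /est /ex /= addrC cisD rmorphN mulNr mulNr [t * _]mulrC; ring.
Qed.

Lemma L2T_psum s a : L2T (psum (@ex R d) a s).
Proof.
split.
  move=> x k; apply: eq_bigr => l _; congr (_ * _); rewrite /ex.
  have -> : rdot l (translate x k) = rdot l x + 2 * pi * (\sum_i l ord0 i * tnth k i)%:~R.
    rewrite rmorph_sum mulr_sumr -big_split; apply: eq_bigr => i _ /=.
    by rewrite tnth_mktuple rmorphM /=; ring.
  by rewrite cisD cis2pi mulr1.
apply/(memL2P lam mQ _); have b := bcmfun_psum tsx a s; split.
  by have [[? _] [? _]] := b.
by apply: (bmfun_rintegrable mQ fQ); exact: bmfun_sqrnormc.
Qed.

Lemma propagation_wave s a : uniq s -> is_propagation (psum (@ex R d) a s) (wave s a).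
Proof.
move=> us; split.
  by have [[? _] [? _]] := bcmfun_psum tst (fun r => a r.2) (map (@freq d) s).
move=> t; rewrite wave_slice; split; first exact: L2T_psum.
move=> k; have [k' ->] := tuple_of_row_surj k; rewrite !fourier_fc !(fc_psum tsx) // sqlen_tuple_of_row.
by case: ifP => // _; rewrite mulr0.
Qed.

Lemma waves_wave s a : uniq s -> waves (wave s a).
Proof. by move=> us; exists (psum (@ex R d) a s); [exact: L2T_psum|exact: propagation_wave]. Qed.

Lemma trigpoly_wave s a : trigpoly (wave s a).
Proof.
exists [seq (a k, (freq k).1, tuple_of_row k) | k <- s] => t x.
by rewrite waveE big_map; apply: eq_bigr => k _ /=; rewrite dot_tuple_of_row.
Qed.

Lemma trigpoly_lin (c : R[i]) u v : trigpoly u -> trigpoly v -> trigpoly (fun z => c * u z + v z).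
Proof.
move=> [s hs] [r hr]; exists ([seq (c * p.1.1, p.1.2, p.2) | p <- s] ++ r) => t x.
rewrite hs hr big_cat big_map mulr_sumr; congr (_ + _).
by apply: eq_bigr => p _; rewrite mulrA.
Qed.

Lemma bcmfun_wave s a : bcmfun (wave s a).
Proof. exact: (bcmfun_psum tst). Qed.

(** The difference propagates f minus its partial Fourier sum, so [energy] reduces its norm to the
    least-squares error at time 0. The shape -1 * w + u is that of [sesquilinear] and
    [waves_lin]. *)
Lemma wave_approx f u s : L2T f -> is_propagation f u -> uniq s ->
  sqI (@dxdt R d) SQ (fun z => -1 * wave s (fcx f) z + u z) =
  2 * pi * (sqI lam Q f - M0 * mass s (fcx f)).
Proof.
move=> Lu0 pu us.
have pw := propagation_wave (fcx f) us; have Lw := L2T_psum s (fcx f).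
have [_ ->] := energy (L2T_lin (-1) Lw Lu0) (propagation_lin (-1) Lw Lu0 pw pu).
congr (_ * _); rewrite /sqI.
have := least_squares tsx (fcx f) (L2T_L2fun Lu0) us.
rewrite [X in _ = _ + M0 * X]big1 => [|k _]; last by rewrite subrr normc0 expr0n.
rewrite mulr0 addr0 => <-; apply: eq_Rintegral => x _.
by rewrite mulN1r addrC.
Qed.

Lemma wave_dense f u eps : L2T f -> is_propagation f u -> 0 < eps ->
  exists2 s, uniq s & sqI lam Q f - M0 * mass s (fcx f) <= eps.
Proof.
move=> Lu0 pu eps0; have [F0 hF] := parseval tsx (@dense_ex R d) (L2T_L2fun Lu0) eps0.
exists (undup F0); first exact: undup_uniq.
by apply: hF (undup_uniq _) _ => x; rewrite mem_undup.
Qed.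

End Waves.

(** * Operators on free waves *)

Section Operators.
Context {R : realType} (d : nat).
Local Notation SQ := (@st_cell R d).
Local Notation mu := (@dxdt R d).
Local Notation M1 := ((2 * pi) ^+ d.+1 : R).
Local Notation I2 := (sqI mu SQ).
Implicit Types (u v w : R * d.-tuple R -> R[i]) (s : seq 'rV[int]_d)
  (a : 'rV[int]_d -> R[i]) (T : @operator R d).

Let tst := trig_system_est (R := R) d.
Let mSQ := @measurable_st_cell R d.
Let fSQ : (mu SQ < +oo)%E.
Proof. by rewrite dxdt_st_cell ltry. Qed.

Lemma normTTE u : waves u -> normTT u = (Num.sqrt (I2 u))%:E.
Proof. by move=> /waves_L2fun [_ iu]; rewrite /normTT L2norm_fine. Qed.

Lemma opnorm_lt T (C : \bar R) : (opnorm T < C)%E -> exists C0, [/\ 0 <= C0, (C0%:E < C)%E &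
  forall u v, waves u -> waves v -> normc (T u v) <= C0 * (Num.sqrt (I2 u) * Num.sqrt (I2 v))].
Proof.
move=> /ereal_inf_lt [_ [C0 [C00 h] <-] C0C]; exists C0; split => // u v wu wv.
by have := h u v wu wv; rewrite !normTTE.
Qed.

Lemma mult_diag (g : R * d.-tuple R -> R) u :
  mult g u u = (\int[mu]_(z in SQ) (g z * normc (u z) ^+ 2))%:C.
Proof.
rewrite /mult -(cintegral_real mu mSQ); apply: eq_cintegral => z _.
by rewrite -mulrA mulc_conj -rmorphM.
Qed.

Lemma normc_realc (x : R) : normc x%:C = `|x|.
Proof. by rewrite /= expr0n addr0 sqrtr_sqr. Qed.

Lemma trig_wave_dense u (eps : R) : waves u -> 0 < eps -> exists s a,
  uniq s /\ Num.sqrt (I2 (fun z => -1 * wave s a z + u z)) <= eps.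
Proof.
move=> [f Lf pu] eps0; have p0 := @pi_gt0 R.
have e0 : 0 < eps ^+ 2 / (2 * pi) by rewrite divr_gt0 ?exprn_gt0 ?mulr_gt0.
have [s us hs] := wave_dense Lf pu e0.
exists s, (fc (lebesgue_tuple R d) (@cell R d) (@ex R d) ((2 * pi) ^+ d) f); split => //.
rewrite -[leRHS]gtr0_norm // -sqrtr_sqr ler_wsqrtr // wave_approx //.
by rewrite mulrC -ler_pdivlMr ?mulr_gt0.
Qed.

(** Expanding gives characters of frequency p.2 - (freq l - freq k), whose integral is M1 when this
    is 0 and 0 otherwise. *)
Lemma band_integral (c : seq (R[i] * (int * 'rV[int]_d))) (P : R * d.-tuple R -> R) s a :
  (forall z, (P z)%:C = tp (@est R d) c z) ->
  \int[mu]_(z in SQ) (P z * normc (wave s a z) ^+ 2) = M1 * band c s a.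
Proof.
move=> hP.
pose t (p : R[i] * (int * 'rV[int]_d)) k l : R[i] := p.1 * (a k * conjc (a l)).
pose G p k l z := t p k l * est (p.2 - (freq l - freq k)) z.
have bG p k l : cintegrable mu SQ (G p k l).
  apply: bcmfun_cintegrable => //; apply: bcmfunM; [exact: bcmfun_cst|exact: bcmfun_est].
transitivity (complex.Re (cintegral mu SQ
    (fun z => \sum_(p <- c) \sum_(k <- s) \sum_(l <- s) G p k l z))).
  have -> : (fun z => \sum_(p <- c) \sum_(k <- s) \sum_(l <- s) G p k l z) =
      (fun z => (P z * normc (wave s a z) ^+ 2)%:C); last by rewrite cintegral_real.
  apply/funext => z.
  transitivity ((P z)%:C * (normc (wave s a z) ^+ 2)%:C); last by rewrite -rmorphM.
  rewrite hP -mulc_conj waveE /tp mulr_suml.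
  apply: eq_bigr => p _; rewrite mulr_suml mulr_sumr; apply: eq_bigr => k _.
  rewrite rmorph_sum !mulr_sumr; apply: eq_bigr => l _.
  rewrite /G /t opprB !(ts_D tst) (ts_N tst) rmorphM /=; ring.
rewrite cintegral_sum // => [|p]; last first.
  by apply: cintegrable_sum => // k; exact: cintegrable_sum.
rewrite Rec_sum /band mulr_sumr; apply: eq_bigr => p _.
rewrite cintegral_sum // => [|k]; last exact: cintegrable_sum.
rewrite Rec_sum mulr_sumr; apply: eq_bigr => k _.
rewrite cintegral_sum // Rec_sum mulr_sumr; apply: eq_bigr => l _.
rewrite cintegralZ //; last by apply: bcmfun_cintegrable => //; exact: bcmfun_est.
rewrite (cintegral_e tst) subr_eq0 /bterm [p.2 == _]eq_sym.
by case: ifP => _; rewrite ?mulr0 // mulrC RecZ.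
Qed.

Section Member.
Variables (f : R * d.-tuple R -> R) (T : @operator R d).
Hypothesis intf : rintegrable mu SQ f.
Hypothesis f0 : forall z, 0 <= f z.
Hypothesis TY : Y0plus T.
Hypothesis Tf : forall u v, trigpoly u -> waves u -> trigpoly v -> waves v -> T u v = mult f u v.

Let Qf u := \int[mu]_(z in SQ) (f z * normc (u z) ^+ 2).

Lemma Y0plus_bounded : exists2 C, 0 <= C & forall u v, waves u -> waves v ->
  normc (T u v) <= C * (Num.sqrt (I2 u) * Num.sqrt (I2 v)).
Proof. by have [[_ /opnorm_lt [C [C0 _ h]]] _] := TY; exists C. Qed.

(** Stated for trigonometric waves, the only ones on which T is known to be multiplication by f. *)
Lemma Qf_bounded : exists2 C, 0 <= C & forall u, trigpoly u -> waves u -> Qf u <= C * I2 u.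
Proof.
have [C C0 h] := Y0plus_bounded; exists C => // u tu wu.
have := h u u wu wu; rewrite Tf // mult_diag normc_realc -expr2 sqr_sqrtr ?sqI_ge0 //.
exact: le_trans (ler_norm _).
Qed.

(** Half of eps pays for replacing T by a continuous phi in operator norm, half for replacing phi
    uniformly by a trigonometric polynomial, whose form is a band form. *)
Lemma Qf_band (eps : R) : 0 < eps -> exists c, forall s a, uniq s ->
  `|Qf (wave s a) - M1 * band c s a| <= eps * I2 (wave s a).
Proof.
move=> eps0; have e2 : 0 < eps / 2 by rewrite divr_gt0.
have [_ /(_ _ e2) [phi [cphi pphi phi0 /opnorm_lt [C [C0 Ce hC]]]]] := TY.
have [P [[c hc] hP]] := uniform_trig cphi pphi e2.
exists c => s a us; have ww := waves_wave a us; have tw := trigpoly_wave s a.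
rewrite -(band_integral s a hc).
have bw := bmfun_sqrnormc (bcmfun_wave s a).
have iP : rintegrable mu SQ (fun z => P z * normc (wave s a z) ^+ 2).
  apply: bmfun_rintegrable => //; apply: bmfunM => //.
  by apply: (rtrig_bmfun tst); exists c.
have iphi : rintegrable mu SQ (fun z => phi z * normc (wave s a z) ^+ 2).
  apply: bmfun_rintegrable => //; apply: bmfunM => //.
  exact: continuous_periodic_bmfun.
have I0 : 0 <= I2 (wave s a) by exact: sqI_ge0.
have := hC _ _ ww ww; rewrite Tf // !mult_diag -rmorphB normc_realc -expr2 sqr_sqrtr //.
move=> h1; have {}h1 := le_trans h1 (ler_wpM2r I0 (ltW Ce)).
have h2 : `|\int[mu]_(z in SQ) (phi z * normc (wave s a z) ^+ 2) -
    \int[mu]_(z in SQ) (P z * normc (wave s a z) ^+ 2)| <= eps / 2 * I2 (wave s a).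
  rewrite -RintegralB // (le_trans (le_normr_Rintegral _ _)) //; last first.
    rewrite /sqI -RintegralZl //; last exact: bmfun_rintegrable.
    apply: le_Rintegral => //.
    - exact: (rintegrable_norm (rintegrableB mSQ iphi iP)).
    - by apply: rintegrableZ => //; exact: bmfun_rintegrable.
    move=> z _; rewrite -mulrBl normrM [X in _ * X]ger0_norm ?sqr_ge0 //.
    by rewrite ler_wpM2r ?sqr_ge0.
  exact: (rintegrableB mSQ iphi iP).
apply: le_trans (ler_distD _ _ _) _; apply: le_trans (lerD h1 h2) _.
by rewrite -mulrDl -splitr.
Qed.

(** A nonnegative f of integral 0 makes T vanish on trigonometric waves; boundedness and density
    extend this to all waves, one argument at a time. *)
Lemma Yzero_of_integral0 : \int[mu]_(z in SQ) f z = 0 -> Yzero T.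
Proof.
move=> If0; have [C C0 hC] := Y0plus_bounded; have [[[hl hr] _] _] := TY.
have zero (g : R * d.-tuple R -> R) : bmfun g -> \int[mu]_(z in SQ) (f z * g z) = 0.
  move=> bg; have [_ [B hB]] := bg; have ifg := rintegrableM mSQ intf bg.
  apply/eqP; rewrite -normr_le0 (le_trans (le_normr_Rintegral mSQ ifg)) //.
  rewrite -(mulr0 B) -If0 -RintegralZl //; apply: le_Rintegral => //.
  - exact: rintegrable_norm.
  - exact: rintegrableZ.
  by move=> z _; rewrite normrM ger0_norm // mulrC ler_wpM2r.
have T0 s a s' a' : uniq s -> uniq s' -> T (wave s a) (wave s' a') = 0.
  move=> us us'; rewrite Tf; [|exact: trigpoly_wave|exact: waves_wave|
    exact: trigpoly_wave|exact: waves_wave].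
  have [br bi] := bcmfunM (bcmfun_wave s a) (bcmfunJ (bcmfun_wave s' a')).
  rewrite /mult; transitivity (Complex (0 : R) 0) => //; congr Complex.
    rewrite -[RHS](zero _ br); apply: eq_Rintegral => z _.
    by rewrite /= -mulrA RecZ.
  rewrite -[RHS](zero _ bi); apply: eq_Rintegral => z _.
  by rewrite /= -mulrA ImcM /= mul0r addr0.
have small (x : R[i]) (K : R) : 0 <= K -> (forall eps, 0 < eps -> normc x <= K * eps) -> x = 0.
  move=> K0 h; apply: eq0_normc; apply/eqP; rewrite -normr_le0; apply/ler_addgt0Pr => eps eps0.
  have K1 : 0 < K + 1 by rewrite ltr_wpDl.
  have := h (eps / (K + 1)); rewrite divr_gt0 // => /(_ isT); rewrite ger0_norm ?normc_ge0 //.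
  move=> /le_trans; apply; rewrite add0r mulrCA ger_pMr // ler_pdivrMr // mul1r.
  by rewrite lerDl.
have T1 s a v : uniq s -> waves v -> T (wave s a) v = 0.
  move=> us wv; have ww := waves_wave a us.
  apply: (small _ (C * Num.sqrt (I2 (wave s a)))) => [|eps eps0].
    by rewrite mulr_ge0 ?sqrtr_ge0.
  have [s' [a' [us' he]]] := trig_wave_dense wv eps0; have ww' := waves_wave a' us'.
  have := hr (-1) _ _ _ ww ww' wv; rewrite T0 // mulr0 add0r => <-.
  apply: le_trans (hC _ _ ww (waves_lin _ ww' wv)) _.
  by rewrite mulrA ler_wpM2l // mulr_ge0 ?sqrtr_ge0.
move=> u v wu wv.
apply: (small _ (C * Num.sqrt (I2 v))) => [|eps eps0]; first by rewrite mulr_ge0 ?sqrtr_ge0.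
have [s [a [us he]]] := trig_wave_dense wu eps0; have ww := waves_wave a us.
have := hl (-1) _ _ _ ww wu wv; rewrite T1 // mulr0 add0r => <-.
apply: le_trans (hC _ _ (waves_lin _ ww wu) wv) _; rewrite -mulrA ler_wpM2l // mulrC.
by rewrite ler_wpM2l ?sqrtr_ge0.
Qed.

(** If f were almost everywhere below eta, half of its mean, its integral I > 0 would be at most I /
    2. *)
Lemma mass_where_large : measurable_fun setT f -> ~ Yzero T -> exists2 eta : R, 0 < eta &
  (0 < mu ([set z | (eta <= f z)%R] `&` SQ))%E.
Proof.
move=> mf nT; pose I := \int[mu]_(z in SQ) f z.
have M0 : 0 < M1 := ts_M tst.
have I0 : 0 < I.
  rewrite lt_neqAle Rintegral_ge0 // andbT eq_sym; apply/eqP => I0.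
  by apply: nT; exact: Yzero_of_integral0.
pose eta := I / (2 * M1); have eta0 : 0 < eta by rewrite divr_gt0 ?mulr_gt0.
exists eta => //; rewrite lt0e measure_ge0 andbT; apply/eqP => E0.
pose E := [set z | eta <= f z].
have mE : measurable E.
  by have := mf measurableT `[eta, +oo[%classic (measurable_itv _); rewrite setTI;
    congr measurable; apply/seteqP; split => z /=; rewrite in_itv /= andbT.
have iE := rintegrableM mSQ intf (bmfun_indic mE).
have IE : \int[mu]_(z in SQ) (f z * \1_E z) = 0.
  transitivity (\int[mu]_(z in SQ `&` E) f z); last first.
    rewrite /Rintegral null_set_integral //.
    - exact: measurableI.
    - by apply: measurable_funTS; exact/measurable_EFinP.
    - by rewrite setIC.
  rewrite /Rintegral [in RHS]integral_mkcondr; congr fine; apply: eq_integral => z _.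
  by rewrite patchE indicE; case: ifP => _; rewrite ?mulr1 ?mulr0.
have : I <= eta * M1.
  have -> : eta * M1 = \int[mu]_(z in SQ) (eta + f z * \1_E z).
    rewrite RintegralD // ?IE ?addr0; last exact: (bmfun_rintegrable mSQ fSQ (bmfun_cst eta)).
    by rewrite Rintegral_cst // dxdt_st_cell.
  apply: le_Rintegral => //.
    by apply: rintegrableD => //; exact: (bmfun_rintegrable mSQ fSQ (bmfun_cst eta)).
  move=> z _; rewrite indicE; case: (boolP (z \in E)) => zE.
    by rewrite mulr1 lerDr ltW.
  rewrite mulr0 addr0 leNgt; apply: contra zE => /ltW h; exact: mem_set.
rewrite /eta invfM mulrA mulfVK ?gt_eqF // ler_pdivlMr // ; lra.
Qed.

End Member.
End Operators.

(** * Control of single coefficients *)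

(** The integral of w |conj(u) + z v|^2 is nonnegative for every z, and [quadratic_bound]
    applies. *)
Lemma weighted_CauchySchwarz {R : realType} {disp : measure_display} {T : measurableType disp}
  (mu : {measure set T -> \bar R}) (D : set T) (w : T -> R) (u v : T -> R[i]) :
  measurable D -> (mu D < +oo)%E -> bmfun w -> (forall x, 0 <= w x) -> bcmfun u -> bcmfun v ->
  normc (cintegral mu D (fun x => (w x)%:C * (u x * v x))) ^+ 2 <=
  (\int[mu]_(x in D) (w x * normc (u x) ^+ 2)) * (\int[mu]_(x in D) (w x * normc (v x) ^+ 2)).
Proof.
move=> mD fD bw w0 bu bv.
have ib g : bmfun g -> rintegrable mu D g by exact: bmfun_rintegrable.
have bwu := bmfunM bw (bmfun_sqrnormc bu); have bwv := bmfunM bw (bmfun_sqrnormc bv).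
have bm := bcmfunM (bcmfun_real bw) (bcmfunM bu bv).
apply: quadratic_bound => [||z].
- by apply: Rintegral_ge0 => x _; rewrite mulr_ge0 ?sqr_ge0.
- by apply: Rintegral_ge0 => x _; rewrite mulr_ge0 ?sqr_ge0.
have [bz _] := bcmfunM (bcmfun_cst z) bm.
rewrite -cintegralZ //; last exact: bcmfun_cintegrable.
rewrite /= -!RintegralZl //; try exact: ib.
have b2 := bmfunM (bmfun_cst 2) bz; have b3 := bmfunM (bmfun_cst (normc z ^+ 2)) bwv.
rewrite -RintegralD //; [|exact: ib|exact: ib].
rewrite -RintegralD //; [|exact: ib (bmfunD bwu b2)|exact: ib].
rewrite (@eq_Rintegral _ _ _ mu D (fun x => w x * normc (conjc (u x) + z * v x) ^+ 2)).
  by apply: Rintegral_ge0 => x _; rewrite mulr_ge0 ?sqr_ge0.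
move=> x _ /=; rewrite !sqr_normcE.
case: (u x) (v x) (z) => [u1 u2] [v1 v2] [z1 z2] /=; ring.
Qed.

Section LowFrequencies.
Context {R : realType} (d : nat).
Local Notation SQ := (@st_cell R d).
Local Notation mu := (@dxdt R d).
Local Notation M1 := ((2 * pi) ^+ d.+1 : R).
Local Notation I2 := (sqI mu SQ).
Implicit Types (u v w : R * d.-tuple R -> R[i]) (s : seq 'rV[int]_d)
  (a : 'rV[int]_d -> R[i]) (k l : 'rV[int]_d).

Let tst := trig_system_est (R := R) d.
Let mSQ := @measurable_st_cell R d.
Let fSQ : (mu SQ < +oo)%E.
Proof. by rewrite dxdt_st_cell ltry. Qed.
Let M0 : 0 < M1 := ts_M tst.

Definition cut k a l : R[i] := if prec l k then 0 else a l.
Definition low k a l : R[i] := if prec l k then a l else 0.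

Lemma wave_cut k s a z : wave s (cut k a) z = wave s a z + -1 * wave s (low k a) z.
Proof.
rewrite !waveE mulr_sumr -big_split; apply: eq_bigr => l _ /=.
by rewrite /cut /low; case: ifP => _; ring.
Qed.

Lemma mass_cut k s a : mass s (cut k a) <= mass s a.
Proof.
apply: ler_sum => l _; rewrite /cut; case: ifP => // _.
by rewrite normc0 expr0n sqr_ge0.
Qed.

(* Only [k] itself contributes: the frequencies of [wave s (cut k a)] are
   [k] and its successors, and those of [q - 1] are positive. *)
Lemma leading_coefficient k s a q : uniq s -> k \in s -> admissible (@est R d) (@pos d) q ->
  M1%:C * a k =
  cintegral mu SQ (fun z => wave s (cut k a) z * (est (- freq k) z * q z)).
Proof.
move=> us ks [c hc ->].
pose v z := wave s (cut k a) z * est (- freq k) z.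
have fcM u r : M1%:C * fc mu SQ (@est R d) M1 u r = cintegral mu SQ (fun z => u z * est (- r) z).
  by rewrite /fc mulrA -rmorphM mulfV ?gt_eqF // rmorph1 mul1r.
have uF : uniq (map (@freq d) s) by rewrite map_inj_uniq //; exact: freq_inj.
have bv : bcmfun v by apply: bcmfunM; [exact: bcmfun_wave|exact: bcmfun_est].
have bt : bcmfun (tp (@est R d) c) by apply: (trig_bcmfun tst); exists c.
rewrite (@eq_cintegral _ _ _ _ _ _ (fun z => v z + v z * tp (@est R d) c z)) => [|z _]; last first.
  by rewrite /v; ring.
rewrite cintegralD //; [|exact: bcmfun_cintegrable|exact/bcmfun_cintegrable/bcmfunM].
rewrite (cintegral_mul_tp tst); last exact: bcmfun_cintegrable.
rewrite big_seq big1 => [|p pc]; last first.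
  rewrite (@eq_cintegral _ _ _ _ _ _ (fun z => wave s (cut k a) z * est (- (freq k - p.2)) z)).
    rewrite -fcM (fc_psum tst) //; case: ifP => [/mapP [l ls hl]|_]; last by rewrite !mulr0.
    rewrite hl /= /cut /prec -hl opprB addrCA subrr addr0 (allP hc p pc) !mulr0 //.
  by move=> z _; rewrite opprB /v -mulrA -(ts_D tst) [p.2 + _]addrC.
rewrite addr0 -fcM (fc_psum tst) // map_f // /= /cut.
by rewrite (negPf (prec_irr k)).
Qed.

Variables (f : R * d.-tuple R -> R) (eta : R).
Hypothesis mf : measurable_fun setT f.
Hypothesis f0 : forall z, 0 <= f z.
Hypothesis intf : rintegrable mu SQ f.
Hypothesis eta0 : 0 < eta.
Hypothesis muE : (0 < mu ([set z | (eta <= f z)%R] `&` SQ))%E.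

Definition Qform s a : R := M1^-1 * \int[mu]_(z in SQ) (f z * normc (wave s a z) ^+ 2).

Lemma Qform_ge0 s a : 0 <= Qform s a.
Proof.
rewrite mulr_ge0 ?invr_ge0 ?(ltW M0) //; apply: Rintegral_ge0 => z _.
by rewrite mulr_ge0 ?sqr_ge0.
Qed.

Let E := [set z | eta <= f z].

Let mE : measurable E.
Proof.
have := mf measurableT (measurable_itv `[eta, +oo[); rewrite setTI.
by congr measurable; apply/seteqP; split => z /=; rewrite in_itv /= andbT.
Qed.

(** Split the integral of [leading_coefficient] at E. On E, f >= eta bounds the full wave by
    [Qform], and removing the predecessors of k costs [mass s (low k a)]; off E, q is small and only
    delta * mass is left. *)
Lemma coefficient_bound k (delta : R) : 0 < delta -> exists2 K, 0 <= K &
  forall s a, uniq s -> k \in s ->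
  normc (a k) ^+ 2 <= K * (Qform s a / eta + mass s (low k a)) + delta * mass s a.
Proof.
(* With this precision for q, the part off E adds at most 2 * M1 * mass * (delta * M1 / 2) = delta *
   M1^2 * mass to M1^2 |a_k|^2. *)
move=> delta0; have d2 : 0 < delta * M1 / 2 by rewrite divr_gt0 ?mulr_gt0.
have [q aq hq] := szego tst (@dense_est R d) (@posD d) (@pos_total d) mE muE d2.
have bq := admissible_bcmfun tst aq.
pose Kq := I2 q; have Kq0 : 0 <= Kq by exact: sqI_ge0.
exists (4 * Kq / M1); first by rewrite divr_ge0 ?mulr_ge0 // ltW.
move=> s a us ks; pose v := wave s (cut k a); pose g z := est (- freq k) z * q z.
have bv : bcmfun v by exact: bcmfun_wave.
have bg : bcmfun g by apply: bcmfunM => //; exact: bcmfun_est.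
have gq z : normc (g z) = normc (q z) by rewrite normcM (normc_e tst) mul1r.
have bE : bmfun (\1_E : _ -> R) by exact: bmfun_indic.
have bE' : bmfun (\1_(~` E) : _ -> R) by apply: bmfun_indic; exact: measurableC.
have ind0 (A : set (R * d.-tuple R)) z : 0 <= (\1_A z : R) by rewrite indicE ler0n.
have ind1 (A : set (R * d.-tuple R)) z : (\1_A z : R) <= 1 by rewrite indicE lern1; case: (_ \in _).
have ib h : bmfun h -> rintegrable mu SQ h by exact: bmfun_rintegrable.
pose X := \int[mu]_(z in SQ) (\1_E z * normc (v z) ^+ 2).
pose B1 := cintegral mu SQ (fun z => (\1_E z)%:C * (v z * g z)).
pose B2 := cintegral mu SQ (fun z => (\1_(~` E) z)%:C * (v z * g z)).
have split12 : M1%:C * a k = B1 + B2.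
  rewrite (leading_coefficient a us ks aq) -cintegralD //; first last.
  - by apply: bcmfun_cintegrable => //; apply: bcmfunM; [exact: bcmfun_real|exact: bcmfunM].
  - by apply: bcmfun_cintegrable => //; apply: bcmfunM; [exact: bcmfun_real|exact: bcmfunM].
  apply: eq_cintegral => z _; rewrite -mulrDl -[LHS]mul1r; congr (_ * _).
  by rewrite -rmorphD !indicE in_setC; case: (_ \in _); rewrite /= ?addr0 ?add0r.
have int0 (A : set (R * d.-tuple R)) y : 0 <= \int[mu]_(z in SQ) (\1_A z * normc (y z) ^+ 2).
  by apply: Rintegral_ge0 => z _; rewrite mulr_ge0 ?sqr_ge0.
have h1 : normc B1 ^+ 2 <= X * Kq.
  apply: le_trans (weighted_CauchySchwarz mSQ fSQ bE (ind0 E) bv bg) _.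
  apply: ler_wpM2l; first exact: int0.
  apply: le_Rintegral => //.
  - by apply: ib; apply: bmfunM => //; exact: bmfun_sqrnormc.
  - by apply: ib; exact: bmfun_sqrnormc.
  by move=> z _; rewrite gq ler_piMl ?sqr_ge0.
have h2 : normc B2 ^+ 2 <= M1 * mass s a * (delta * M1 / 2).
  apply: le_trans (weighted_CauchySchwarz mSQ fSQ bE' (ind0 (~` E)) bv bg) _.
  apply: ler_pM; [exact: int0|exact: int0| |].
  - apply: le_trans (ler_wpM2l (ltW M0) (mass_cut k s a)); rewrite -sqI_wave //.
    apply: le_Rintegral => //.
    + by apply: ib; apply: bmfunM => //; exact: bmfun_sqrnormc.
    + by apply: ib; exact: bmfun_sqrnormc.
    by move=> z _; rewrite ler_piMl ?sqr_ge0.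
  by under eq_Rintegral do rewrite gq.
have h3 : X <= 2 * M1 * (Qform s a / eta + mass s (low k a)).
  have bw := bmfun_sqrnormc (bcmfun_wave s a); have bl := bmfun_sqrnormc (bcmfun_wave s (low k a)).
  have ifw : rintegrable mu SQ (fun z => f z * normc (wave s a z) ^+ 2) by exact: rintegrableM.
  have -> : 2 * M1 * (Qform s a / eta + mass s (low k a)) = 2 / eta * \int[mu]_(z in SQ)
      (f z * normc (wave s a z) ^+ 2) + 2 * I2 (wave s (low k a)).
    by rewrite sqI_wave // /Qform; field; rewrite !gt_eqF.
  rewrite /sqI -!RintegralZl //; last exact: ib.
  rewrite -RintegralD //; [|exact: rintegrableZ|by apply: rintegrableZ => //; exact: ib].
  apply: le_Rintegral => //.
  - by apply: ib; apply: bmfunM => //; exact: bmfun_sqrnormc.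
  - by apply: rintegrableD => //; apply: rintegrableZ => //; exact: ib.
  move=> z _; have hw0 := sqr_ge0 (normc (wave s a z)); have hl0 := sqr_ge0 (normc (wave s (low k a) z)).
  rewrite indicE; case: (boolP (z \in E)) => zE; last first.
    have p2 : 0 <= 2 / eta by rewrite divr_ge0 // ltW.
    rewrite mul0r addr_ge0 //; last exact: mulr_ge0.
    by rewrite mulr_ge0 // mulr_ge0.
  rewrite mul1r /v wave_cut (le_trans (sqr_normcD_le _ _)) // lerD //; last first.
    by rewrite mulN1r normcN.
  have /set_mem : z \in E by []; rewrite /E /= => hz.
  by rewrite -mulrA ler_wpM2l // mulrA ler_peMl // mulrC ler_pdivlMr // mul1r.
have : M1 ^+ 2 * normc (a k) ^+ 2 <= 2 * (2 * M1 * (Qform s a / eta + mass s (low k a)) * Kq) +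
    2 * (M1 * mass s a * (delta * M1 / 2)).
  have -> : M1 ^+ 2 * normc (a k) ^+ 2 = normc (M1%:C * a k) ^+ 2.
    by rewrite normc_sqrM normc_realc -real_normK ?num_real.
  rewrite split12 (le_trans (sqr_normcD_le _ _)) // lerD // ler_wpM2l //.
  by rewrite (le_trans h1) // ler_wpM2r.
rewrite -ler_pdivlMl ?(exprn_gt0 2 M0) // => /le_trans; apply.
have p2 : 0 < 2 * pi :> R by rewrite mulr_gt0 // pi_gt0.
by rewrite le_eqVlt; apply/orP; left; apply/eqP; field; rewrite !gt_eqF.
Qed.

(** Induction on the length of a list P containing the predecessors of k: those of a predecessor l
    lie in [rem l P], by transitivity and irreflexivity. *)
Lemma low_bound k (eps : R) : 0 < eps -> exists C, forall s a, uniq s -> k \in s ->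
  normc (a k) ^+ 2 <= C * Qform s a + eps * mass s a.
Proof.
have [P hP] := prec_finite k; move: {2}(size P) (leqnn (size P)) => n.
elim: n => [|n IH] in k P hP eps *.
all: move=> szP eps0; have e2 : 0 < eps / 2 by rewrite divr_gt0.
all: have [K K0 hK] := coefficient_bound k e2.
  exists (K / eta) => s a us ks; apply: le_trans (hK s a us ks) _.
  have -> : mass s (low k a) = 0.
    rewrite /mass big1 // => l _; rewrite /low; case: ifP => [/hP|_]; last by rewrite normc0 expr0n.
    by move: szP; rewrite leqn0 => /nilP ->.
  rewrite addr0 mulrA mulrAC lerD2l ler_wpM2r ?sumr_ge0 // => [l _|]; first exact: sqr_ge0.
  by move: eps0; lra.
(* At most N predecessors enter, with factor K, so their total error K * N * e' is at most eps /
   2. *)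
pose N := (size P)%:R : R; pose e' := eps / 2 / (K * N + 1).
have KN : 0 <= K * N by rewrite mulr_ge0.
have KN1 : 0 < K * N + 1 by rewrite ltr_wpDl.
have e'0 : 0 < e' by rewrite divr_gt0.
(* The condition on l is placed inside the existential so that [choice] gives a function of l
   alone. *)
have hl l : exists C, prec l k -> forall s a, uniq s -> l \in s ->
    normc (a l) ^+ 2 <= C * Qform s a + e' * mass s a.
  case: (boolP (prec l k)) => lk; last by exists 0.
  have lP := hP l lk.
  have [||//|C hC] := @IH l (rem l P) _ e'.
  - move=> m ml; apply: rem_mem; first by apply: contraTneq ml => ->; exact: prec_irr.
    by apply: hP; exact: prec_trans ml lk.
  - by rewrite size_rem //; move: szP; case: (size P).
  by exists C => _.
have [Cl hCl] := choice hl.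
pose C := \sum_(l <- P) `|Cl l|.
exists (K / eta + K * N * C) => s a us ks; apply: le_trans (hK s a us ks) _.
have Q0 := Qform_ge0 s a.
have m0 : 0 <= mass s a by apply: sumr_ge0 => l _; exact: sqr_ge0.
have hlow : mass s (low k a) <= N * (C * Qform s a + e' * mass s a).
  rewrite /mass (bigID (fun l => prec l k)) /= [X in _ + X]big1 => [|l /negPf lk]; last first.
    by rewrite /low lk normc0 expr0n.
  rewrite addr0 -big_filter.
  apply: le_trans (_ : \sum_(l <- [seq l <- s | prec l k]) (C * Qform s a + e' * mass s a) <= _).
    rewrite big_seq [leRHS]big_seq; apply: ler_sum => l.
    rewrite mem_filter => /andP[lk ls]; rewrite /low lk.
    apply: le_trans (hCl l lk s a us ls) _; rewrite lerD2r ler_wpM2r // /C.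
    rewrite (big_rem l) /=; last exact: hP.
    by rewrite (le_trans (ler_norm _)) // lerDl sumr_ge0.
  rewrite big_const_seq count_predT iter_addr addr0 -[leLHS]mulr_natl ler_wpM2r //.
    have C0 : 0 <= C by exact: sumr_ge0.
    by rewrite addr_ge0 // mulr_ge0 // ltW.
  rewrite ler_nat; apply: uniq_leq_size; first exact: filter_uniq.
  by move=> l; rewrite mem_filter => /andP[/hP].
have hKe : K * N * e' <= eps / 2.
  by rewrite /e' mulrCA ger_pMr // ler_pdivrMr // mul1r lerDl.
have h := ler_wpM2l K0 hlow; have h' := ler_wpM2r m0 hKe.
have -> : K * (Qform s a / eta + mass s (low k a)) = K / eta * Qform s a + K * mass s (low k a) by ring.
rewrite [in leRHS](splitr eps); move: h h'; rewrite !mulrDr !mulrDl !mulrA; lra.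
Qed.

End LowFrequencies.

(** * Observability *)

(** By monotone convergence, bounds uniform in m for the bounded weights min(g, m) pass to g. *)
Lemma truncation_le {R : realType} {disp : measure_display} {T : measurableType disp}
  (mu : {measure set T -> \bar R}) (D : set T) (g w : T -> R) (B : R) :
  measurable D -> measurable_fun setT g -> (forall x, 0 <= g x) ->
  measurable_fun setT w -> (forall x, 0 <= w x) ->
  rintegrable mu D (fun x => g x * w x) ->
  (forall m : nat, \int[mu]_(x in D) (Num.min (g x) m%:R * w x) <= B) ->
  \int[mu]_(x in D) (g x * w x) <= B.
Proof.
move=> mD mg g0 mw w0 igw hB.
pose h (m : nat) x : \bar R := (Num.min (g x) m%:R * w x)%:E.
have min0 m x : 0 <= Num.min (g x) m%:R by rewrite le_min g0 ler0n.
have mh m : measurable_fun setT (fun x => Num.min (g x) m%:R * w x).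
  by apply: measurable_funM => //; exact: measurable_minr.
have ih m : rintegrable mu D (fun x => Num.min (g x) m%:R * w x).
  apply: le_rintegrable igw => //; first exact: measurable_funTS.
  by move=> x _; rewrite ger0_norm ?mulr_ge0 // ler_wpM2r // ge_min lexx.
have cv : (\int[mu]_(x in D) h m x)%E @[m --> \oo] -->
    (\int[mu]_(x in D) limn (fun m => h m x))%E.
  apply: cvg_monotone_convergence => //.
  - by move=> m; apply: measurable_funTS; exact/measurable_EFinP.
  - by move=> m x _; rewrite lee_fin mulr_ge0.
  - move=> x _ m n mn; rewrite lee_fin ler_wpM2r // le_min ge_min lexx /=.
    by rewrite ge_min ler_nat mn orbT.
have limh x : limn (fun m => h m x) = (g x * w x)%:E.
  apply: lim_near_cst => //.
  exists (Num.truncn (g x)).+1 => // m /= hm; rewrite /h min_l //.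
  by rewrite (le_trans (ltW (truncnS_gt _))) // ler_nat.
rewrite -lee_fin /Rintegral fineK; last exact: integrable_fin_num.
under eq_integral do rewrite -limh.
rewrite -(cvg_lim _ cv) //; apply: lime_le; first by apply/cvg_ex; eexists; exact: cv.
near=> m; have := hB m; rewrite -lee_fin /Rintegral fineK //.
exact: (integrable_fin_num mD (ih m)).
Unshelve. all: by end_near. Qed.

Section Observability.
Context {R : realType} (d : nat).
Local Notation lam := (lebesgue_tuple R d).
Local Notation Q := (@cell R d).
Local Notation SQ := (@st_cell R d).
Local Notation mu := (@dxdt R d).
Local Notation M0 := ((2 * pi) ^+ d : R).
Local Notation M1 := ((2 * pi) ^+ d.+1 : R).
Local Notation I2 := (sqI mu SQ).
Local Notation fcx := (fc lam Q (@ex R d) M0).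
Implicit Types (u v w : R * d.-tuple R -> R[i]) (s : seq 'rV[int]_d)
  (a : 'rV[int]_d -> R[i]) (k l : 'rV[int]_d).

Let tst := trig_system_est (R := R) d.
Let mSQ := @measurable_st_cell R d.
Let fSQ : (mu SQ < +oo)%E.
Proof. by rewrite dxdt_st_cell ltry. Qed.

Variables (f : R * d.-tuple R -> R) (T : @operator R d).
Hypothesis mf : measurable_fun setT f.
Hypothesis f0 : forall z, 0 <= f z.
Hypothesis intf : rintegrable mu SQ f.
Hypothesis TY : Y0plus T.
Hypothesis Tf : forall u v, trigpoly u -> waves u -> trigpoly v -> waves v -> T u v = mult f u v.

Let Qf u := \int[mu]_(z in SQ) (f z * normc (u z) ^+ 2).

Lemma L2fun_weight (g : R * d.-tuple R -> R) u : bmfun g -> L2fun mu SQ u ->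
  rintegrable mu SQ (fun z => g z * normc (u z) ^+ 2).
Proof.
move=> bg [_ iu]; have := rintegrableM mSQ iu bg.
by congr integrable; apply/funext => z; rewrite /= mulrC.
Qed.

(* Both [f] and the propagation [u] are unbounded, so the comparison with the
   trigonometric waves goes through the truncations [min(f, m)]. *)
Lemma observed_partial_sum (h : d.-tuple R -> R[i]) u s : L2T h -> is_propagation h u ->
  uniq s -> rintegrable mu SQ (fun z => f z * normc (u z) ^+ 2) ->
  forall C, 0 <= C -> (forall v, trigpoly v -> waves v -> Qf v <= C * I2 v) ->
  Qf (wave s (fcx h)) <= 2 * Qf u + 8 * C * I2 (fun z => -1 * wave s (fcx h) z + u z).
Proof.
move=> Lh pu us ifu C C0 hC; set w := wave s (fcx h); set tau := I2 _.
have wu : waves u by exists h.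
have ww : waves w by exact: waves_wave.
have bw : bcmfun w by exact: bcmfun_wave.
have wwu := waves_lin (-1) ww wu.
apply: truncation_le => //.
- by have [] := bmfun_sqrnormc bw.
- by move=> z; exact: sqr_ge0.
- by apply: rintegrableM => //; exact: bmfun_sqrnormc.
move=> m; pose g z := Num.min (f z) m%:R.
have g0 z : 0 <= g z by rewrite le_min f0 ler0n.
have gf z : g z <= f z by rewrite ge_min lexx.
have gm z : g z <= m%:R by rewrite ge_min lexx orbT.
have bg : bmfun g.
  split; first exact: measurable_minr.
  by exists m%:R => z; rewrite ger0_norm.
pose G v := \int[mu]_(z in SQ) (g z * normc (v z) ^+ 2).
have iG v : waves v -> rintegrable mu SQ (fun z => g z * normc (v z) ^+ 2).
  by move=> /waves_L2fun; exact: L2fun_weight.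
have GD v v' v'' : waves v -> waves v' -> waves v'' ->
    (forall z, normc (v'' z) ^+ 2 <= 2 * normc (v z) ^+ 2 + 2 * normc (v' z) ^+ 2) ->
    G v'' <= 2 * G v + 2 * G v'.
  move=> wv wv' wv'' e; rewrite /G -!RintegralZl //; [|exact: iG|exact: iG].
  rewrite -RintegralD //; [|by apply: rintegrableZ => //; exact: iG|by apply: rintegrableZ => //; exact: iG].
  apply: le_Rintegral => //; first exact: iG.
    by apply: rintegrableD => //; apply: rintegrableZ => //; exact: iG.
  by move=> z _; have := ler_wpM2l (g0 z) (e z); lra.
have Gtau : G (fun z => -1 * w z + u z) <= 4 * C * tau.
  apply/ler_addgt0Pr => eps eps0.
  (* As m is fixed, u may be approximated by a trigonometric wave with a precision depending on m.
     The factor 4 C + 2 m collects the contributions of that error. *)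
  pose K := 4 * C + 2 * m%:R + 1; have K0 : 0 < K by rewrite ltr_wpDl // addr_ge0 ?mulr_ge0.
  have e0 : 0 < Num.sqrt (eps / K) by rewrite sqrtr_gt0 divr_gt0.
  have [s' [a' [us' he]]] := trig_wave_dense wu e0.
  have {}he : I2 (fun z => -1 * wave s' a' z + u z) <= eps / K.
    by move: he; rewrite ler_sqrt // divr_ge0 // ltW.
  set w' := wave s' a' in he; have ww' : waves w' by exact: waves_wave.
  have wd : waves (fun z => -1 * w z + w' z) by exact: waves_lin.
  have wwu' : waves (fun z => -1 * w' z + u z) by exact: waves_lin.
  have h1 : G (fun z => -1 * w z + u z) <=
      2 * G (fun z => -1 * w z + w' z) + 2 * G (fun z => -1 * w' z + u z).
    apply: GD => // z; have -> : -1 * w z + u z = (-1 * w z + w' z) + (-1 * w' z + u z) by ring.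
    exact: sqr_normcD_le.
  have h2 : G (fun z => -1 * w' z + u z) <= m%:R * (eps / K).
    apply: le_trans (ler_wpM2l (ler0n _ _) he); rewrite /sqI -RintegralZl //; last first.
      by have [] := waves_L2fun wwu'.
    apply: le_Rintegral => //; first exact: iG.
      by apply: rintegrableZ => //; have [] := waves_L2fun wwu'.
    by move=> z _; rewrite ler_wpM2r ?sqr_ge0.
  have td : trigpoly (fun z => -1 * w z + w' z) by apply: trigpoly_lin; exact: trigpoly_wave.
  have bd : bcmfun (fun z => -1 * w z + w' z).
    by apply: bcmfunD; [apply: bcmfunM => //; exact: bcmfun_cst|exact: bcmfun_wave].
  have h3 : G (fun z => -1 * w z + w' z) <= Qf (fun z => -1 * w z + w' z).
    apply: le_Rintegral => //; first exact: iG.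
      by apply: rintegrableM => //; exact: bmfun_sqrnormc.
    by move=> z _; rewrite ler_wpM2r ?sqr_ge0.
  have h4 : I2 (fun z => -1 * w z + w' z) <= 2 * tau + 2 * (eps / K).
    apply: le_trans (_ : 2 * tau + 2 * I2 (fun z => -1 * w' z + u z) <= _); last first.
      by rewrite lerD2l ler_wpM2l.
    have i1 : rintegrable mu SQ (fun z => normc (-1 * w z + u z) ^+ 2) by have [] := waves_L2fun wwu.
    have i2 : rintegrable mu SQ (fun z => normc (-1 * w' z + u z) ^+ 2) by have [] := waves_L2fun wwu'.
    rewrite /tau /sqI -!RintegralZl // -RintegralD //; [|exact: rintegrableZ|exact: rintegrableZ].
    apply: le_Rintegral => //; first by have [] := waves_L2fun wd.
      by apply: rintegrableD => //; exact: rintegrableZ.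
    move=> z _; have -> : -1 * w z + w' z = (-1 * w z + u z) + -1 * (-1 * w' z + u z) by ring.
    by apply: le_trans (sqr_normcD_le _ _) _; rewrite [-1 * (_ + _)]mulN1r normcN.
  have h5 := le_trans h3 (le_trans (hC _ td wd) (ler_wpM2l C0 h4)).
  have hK : (4 * C + 2 * m%:R) * (eps / K) <= eps.
    by rewrite mulrCA ger_pMr // ler_pdivrMr // mul1r lerDl.
  move: h1 h2 h5 hK; move: (G _) (G _) (eps / K) => x y e; nra.
have Gu : G u <= Qf u.
  apply: le_Rintegral => //; first exact: iG.
  by move=> z _; rewrite ler_wpM2r ?sqr_ge0.
have Gneg : G w <= 2 * G (fun z => -1 * w z + u z) + 2 * G u.
  apply: GD => // z; have := sqr_normcD_le (-1 * w z + u z) (- u z).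
  by rewrite addrK mulN1r !normcN.
move: Gneg Gtau Gu; rewrite -/(G w); lra.
Qed.

Hypothesis nT : ~ Yzero T.

Lemma partial_sum_coercive : exists2 C, 0 <= C & forall s a, uniq s ->
  mass s a <= C * Qf (wave s a).
Proof.
have M1_0 : 0 < M1 := ts_M tst.
have [eta eta0 muE] := mass_where_large intf f0 TY Tf mf nT.
have [|eps eps0|k eps eps0|C C0 hC] := @coercive R d (Qform f).
- exact: Qform_ge0.
- have [c hc] := Qf_band TY Tf eps0; exists c => s a us.
  have := hc s a us; rewrite sqI_wave // => h.
  rewrite /Qform -(ler_pM2l M1_0) -{1}(gtr0_norm M1_0) -normrM mulrBr mulrA mulfV ?gt_eqF //.
  by rewrite mul1r mulrCA.
- exact: (low_bound mf f0 intf eta0 muE).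
exists (C / M1); first by rewrite divr_ge0 // ltW.
by move=> s a us; rewrite -mulrA; exact: hC.
Qed.

(** Apply [partial_sum_coercive] to a partial Fourier sum of h and compare the observations by
    [observed_partial_sum]; the truncation error can be made arbitrarily small for each h, so it
    leaves no trace in the constant. *)
Lemma observability : exists2 K, 0 <= K & forall (h : d.-tuple R -> R[i]) u,
  L2T h -> is_propagation h u -> rintegrable mu SQ (fun z => f z * normc (u z) ^+ 2) ->
  sqI lam Q h <= K * Qf u.
Proof.
have p0 : 0 < 2 * pi :> R by rewrite mulr_gt0 // pi_gt0.
have M0_0 : 0 < M0 by rewrite exprn_gt0.
have [C C0 hC] := partial_sum_coercive.
have [D D0 hD] := Qf_bounded TY Tf.
exists (M0 * C * 2); first by rewrite !mulr_ge0 // ?exprn_ge0 // ?mulr_ge0 // pi_ge0.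
move=> h u Lh pu ifu; apply/ler_addgt0Pr => eps eps0.
(* The 1 accounts for the tail of h itself, the other term for its effect on the observation. *)
pose K := 1 + M0 * C * (8 * D * (2 * pi)).
have K0 : 0 < K by rewrite ltr_pwDl // !mulr_ge0 ?exprn_ge0 ?mulr_ge0 ?pi_ge0.
have e0 : 0 < eps / K by rewrite divr_gt0.
have [s us hs] := wave_dense Lh pu e0.
have := observed_partial_sum Lh pu us ifu D0 hD; rewrite wave_approx // => h1.
have h2 := hC s (fcx h) us.
have h3 : M0 * mass s (fcx h) <= M0 * (C * (2 * Qf u + 8 * D * (2 * pi * (eps / K)))).
  rewrite ler_wpM2l ?(ltW M0_0) // (le_trans h2) // ler_wpM2l // (le_trans h1) //.
  by rewrite lerD2l ler_wpM2l ?mulr_ge0 // ler_wpM2l // ltW.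
have hK : K * (eps / K) = eps by rewrite mulrC mulfVK ?gt_eqF.
rewrite -[X in _ + X]hK; move: (eps / K) h3 hs => e; rewrite /K.
move: (M0 * mass s (fcx h)) M0 (Qf u) (sqI _ _ _) => x m q y; lra.
Qed.

End Observability.

Lemma time_periodize_st_cell {R : realType} (d : nat) (A : Type) (g : R * d.-tuple R -> A) z :
  @st_cell R d z -> time_periodize g z = g z.
Proof.
move=> [/= ht _]; move: ht; rewrite in_itv /= => /andP[h1 h2].
have p0 : 0 < 2 * pi :> R by rewrite mulr_gt0 // pi_gt0.
rewrite /time_periodize (_ : Num.floor _ = 0) ?mulr0 ?subr0 -?surjective_pairing //.
apply: floor_def; rewrite divr_ge0 ?(ltW p0) //=; last by lra.
rewrite ltr_pdivrMr // add0r mul1r; lra.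
Qed.

Theorem theorem2p2 (R : realType) (d : nat) (hd : (1 <= d)%N)
    (chi : R * d.-tuple R -> R[i]) (chiL2 : L2RT chi)
    (supp_chi : esupport chi `<=` [set z | - pi < z.1 < pi])
    (chiY : fun_mem (Y0plus `\` Yzero)
       (fun z => normc (time_periodize chi z) ^+ 2)) :
  exists2 C : R, 0 < C &
    forall (u0 : d.-tuple R -> R[i]) (u : R * d.-tuple R -> R[i]),
      L2T u0 -> is_propagation u0 u ->
      (normT u0 <= C%:E * normRT (fun z => (chi z * u z)%R))%E.
Proof.
pose SQ := @st_cell R d; pose mu := @dxdt R d; have mSQ := @measurable_st_cell R d.
have [if' [T [TY nT] Tf]] := chiY.
set f' := (fun z => _) in if' Tf.
(* Integrability gives measurability on the cell only; the extension by 0 is measurable everywhere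
   and defines the same form. *)
pose f : R * d.-tuple R -> R := f' \_ SQ.
have fE z : st_cell z -> f z = f' z by move=> Dz; rewrite /f patchE mem_set.
have f0 z : 0 <= f z by rewrite /f patchE; case: ifP => // _; exact: sqr_ge0.
have mf : measurable_fun setT f.
  apply: (iffLR (measurable_restrictT _ mSQ)); apply/measurable_EFinP.
  by have /integrableP[] := if'.
have intf : rintegrable mu SQ f.
  apply: (eq_integrable mSQ (EFin \o f')) if' => z /set_mem Dz /=.
  by rewrite fE.
have Tf' u v : trigpoly u -> waves u -> trigpoly v -> waves v -> T u v = mult f u v.
  move=> tu wu tv wv; rewrite Tf //; apply: eq_cintegral => z Dz.
  by rewrite fE.
have [K K0 hK] := observability mf f0 intf TY Tf' nT.
(* The added 1 keeps the constant positive when K = 0. *)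
exists (Num.sqrt K + 1); first by rewrite ltr_wpDl ?sqrtr_ge0.
move=> u0 u Lu0 pu.
have [mchi _] := chiL2.2; have [mu_ _] := pu.
have mst : measurable (@strip R d) by apply: measurableX => //; exact: measurable_cell.
pose v z := chi z * u z.
have mv : cmeasurable v.
  move: mchi mu_ => [r1 i1] [r2 i2]; split.
    by under eq_fun do rewrite RecM; apply: measurable_funB; apply: measurable_funM.
  by under eq_fun do rewrite ImcM; apply: measurable_funD; apply: measurable_funM.
have C0 : 0 < Num.sqrt K + 1 by rewrite ltr_wpDl ?sqrtr_ge0.
(* An infinite right-hand side leaves nothing to prove; a finite one makes f |u|^2 integrable on the
   cell, as [observability] requires. *)
have [voo|] := ltP (normRT v) +oo%E; last first.
  by rewrite leye_eq -/v => /eqP ->; rewrite gt0_muley ?lte_fin // leey.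
have [_ iv] : L2fun mu (@strip R d) v by apply/memL2P.
have sub : SQ `<=` @strip R d by move=> z [].
have ivSQ : rintegrable mu SQ (fun z => normc (v z) ^+ 2).
  exact: integrableS iv.
have fv z : st_cell z -> normc (v z) ^+ 2 = f z * normc (u z) ^+ 2.
  by move=> Dz; rewrite fE // /f' time_periodize_st_cell // normc_sqrM.
have ifu : rintegrable mu SQ (fun z => f z * normc (u z) ^+ 2).
  apply: (eq_integrable mSQ (EFin \o (fun z => normc (v z) ^+ 2))) ivSQ => z /set_mem Dz /=.
  by rewrite fv.
have Lu0' := L2T_L2fun Lu0.
rewrite /normT /normRT (L2norm_fine (@measurable_cell R d)) //; last by have [] := Lu0'.
rewrite (L2norm_fine mst) //.
rewrite -EFinM lee_fin.
have h1 := hK u0 u Lu0 pu ifu.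
have h2 : \int[mu]_(z in SQ) (f z * normc (u z) ^+ 2) <=
    \int[mu]_(z in @strip R d) normc (v z) ^+ 2.
  apply: le_trans (_ : \int[mu]_(z in SQ) normc (v z) ^+ 2 <= _).
    by rewrite le_eqVlt; apply/orP; left; apply/eqP; apply: eq_Rintegral => z /set_mem /fv.
  apply: fine_le; [exact: integrable_fin_num|exact: integrable_fin_num|].
  apply: ge0_subset_integral => //.
    by apply/measurable_EFinP; apply: measurable_funTS; exact: cmeasurable_sqr.
  by move=> z _; rewrite lee_fin sqr_ge0.
have h3 := le_trans h1 (ler_wpM2l K0 h2).
apply: le_trans (ler_wsqrtr h3) _; rewrite sqrtrM // ler_wpM2r ?sqrtr_ge0 //.
by rewrite lerDl.
Qed.
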